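(* Let $G\in\mathcal{N}_{max}$. If $G$ contains a non-virtually abelian nilpotent subgroup, then there exists a ring of algebraic integers $O$ that is e-interpretable in $G$; hence (for $G$ finitely generated) $\mathcal{D}(O)\leq_P\mathcal{D}(G)$.
   Context: $\mathcal{N}_{max}$ is the class of groups $G$ such that for all $c\geq 1$, every nonempty set of $c$-nilpotent subgroups of $G$ has a maximal element with respect to inclusion; here ''$c$-nilpotent'' means nilpotent of class at most $c$. A group is virtually abelian if it has an abelian subgroup of finite index. A ring of algebraic integers is the integral closure of $\mathbb{Z}$ in a finite field extension of $\mathbb{Q}$. An equation in a group $G$ (respectively ring $R$) is an equality of two terms built from variables and elements of $G$ (resp. $R$), called coefficients; coefficients may be arbitrary elements. A system of equations is a finite conjunction of equations. A subset $X\subseteq G^m$ is e-definable in $G$ if there is a finite system $\Sigma(\mathbf{x},\mathbf{y})$ of equations with coefficients in $G$, $\mathbf x=(x_1,\dots,x_m)$, $\mathbf y=(y_1,\dots,y_k)$, such that for every $\mathbf{a}\in G^m$ one has $\mathbf{a}\in X$ if and only if $\Sigma(\mathbf{a},\mathbf{y})$ has a solution $\mathbf{y}\in G^k$. A ring $R$ is e-interpretable in $G$ if for some $m$ there are an e-definable set $X\subseteq G^m$ and a surjective map $\phi:X\to R$ such that the preimages under $\phi$ of the equality relation of $R$ and of the graphs of the addition and multiplication of $R$ are e-definable in $G$. For a finitely generated structure $\mathcal{M}$ (group or ring), the Diophantine problem $\mathcal{D}(\mathcal{M})$ is the problem of deciding, given a finite system of equations with coefficients in $\mathcal{M}$ (given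 as terms in a fixed finite generating set), whether it has a solution in $\mathcal{M}$. $\mathcal{D}(\mathcal{A})\leq_P\mathcal{D}(\mathcal{B})$ means that there is a polynomial-time algorithm transforming each finite system $\Sigma$ in $\mathcal{A}$ into a finite system $\Sigma^*$ in $\mathcal{B}$ such that $\Sigma$ has a solution in $\mathcal{A}$ if and only if $\Sigma^*$ has a solution in $\mathcal{B}$. *)

(* Defs.v *)
From HB Require Import structures.
From mathcomp Require Import all_boot all_order all_algebra all_field.
From mathcomp Require Import boolp classical_sets functions cardinality.

Set Implicit Arguments.
Unset Strict Implicit.
Unset Printing Implicit Defensive.

Import GRing.Theory.
Local Open Scope classical_set_scope.

Section Subgroups.
Variable G : groupType.
Implicit Types (A H K : set G) (c n : nat).
Local Open Scope group_scope.

Definition subgroup H : Prop :=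
  [/\ H 1, forall x y, H x -> H y -> H (x * y) & forall x, H x -> H x^-1].

Definition generated A : set G := smallest subgroup A.

Definition commutator_subgroup H K : set G :=
  generated [set z | exists x y, [/\ H x, K y & z = [~ x, y]]].

(* Indexed from 0: [lower_central H n] is the term gamma_(n+1) of the lower
   central series of H, so class at most c means [lower_central H c] trivial. *)
Fixpoint lower_central H n : set G :=
  if n is n'.+1 then commutator_subgroup (lower_central H n') H else H.

Definition c_nilpotent c H : Prop := subgroup H /\ lower_central H c = [set 1].

Definition nilpotent H : Prop := exists c, c_nilpotent c H.

Definition finite_index A H : Prop :=
  finite_set [set [set x * a | a in A] | x in H].

Definition virtually_abelian H : Prop :=
  exists A, [/\ subgroup A, A `<=` H,
                forall x y, A x -> A y -> commute x y & finite_index A H].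

End Subgroups.

Definition Nmax (G : groupType) : Prop :=
  forall c : nat, (1 <= c)%N ->
  forall F : set (set G), F !=set0 -> (forall H, F H -> c_nilpotent c H) ->
  exists M, F M /\ forall H, F H -> M `<=` H -> H = M.

(* Terms over variables in V and constant symbols in C. For e-definability the
   constants are the elements of the structure themselves, for Diophantine
   problems they are the symbols of a finite generating family. *)
Inductive gterm (V C : Type) : Type :=
| GVar of V
| GCst of C
| GOne
| GMul of gterm V C & gterm V C
| GInv of gterm V C.

Inductive rterm (V C : Type) : Type :=
| RVar of V
| RCst of C
| RZero
| ROne
| RAdd of rterm V C & rterm V C
| RMul of rterm V C & rterm V C
| ROpp of rterm V C.

Definition gsystem (V C : Type) : Type := seq (gterm V C * gterm V C).
Definition rsystem (V C : Type) : Type := seq (rterm V C * rterm V C).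

Section GroupSystems.
Variables (G : groupType) (V C : Type) (cst : C -> G) (rho : V -> G).
Local Open Scope group_scope.

Fixpoint geval (t : gterm V C) : G :=
  match t with
  | GVar v => rho v
  | GCst c => cst c
  | GOne => 1
  | GMul t1 t2 => geval t1 * geval t2
  | GInv t1 => (geval t1)^-1
  end.

Definition gsatisfies (S : gsystem V C) : bool :=
  all (fun e => geval e.1 == geval e.2) S.

End GroupSystems.

Section RingSystems.
Variables (R : pzRingType) (V C : Type) (cst : C -> R) (rho : V -> R).
Local Open Scope ring_scope.

Fixpoint reval (t : rterm V C) : R :=
  match t with
  | RVar v => rho v
  | RCst c => cst c
  | RZero => 0
  | ROne => 1
  | RAdd t1 t2 => reval t1 + reval t2
  | RMul t1 t2 => reval t1 * reval t2
  | ROpp t1 => - reval t1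
  end.

Definition rsatisfies (S : rsystem V C) : bool :=
  all (fun e => reval e.1 == reval e.2) S.

End RingSystems.

Definition tuple_valuation (G : Type) (m k : nat)
    (a : m.-tuple G) (y : k.-tuple G) (v : 'I_m + 'I_k) : G :=
  match v with inl i => tnth a i | inr j => tnth y j end.

Definition e_definable (G : groupType) (m : nat) (X : set (m.-tuple G)) : Prop :=
  exists (k : nat) (S : gsystem ('I_m + 'I_k) G),
    forall a : m.-tuple G,
      X a <-> exists y : k.-tuple G, gsatisfies id (tuple_valuation a y) S.

(* phi is a total function, but only its restriction to X is ever used. *)
Definition e_interpretable (R : pzRingType) (G : groupType) : Prop :=
  exists (m : nat) (X : set (m.-tuple G)) (phi : m.-tuple G -> R),
    [/\ e_definable X,
        forall r : R, exists2 x, X x & phi x = r,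
        e_definable [set t : (m + m).-tuple G | exists x y,
          [/\ X x, X y, t = [tuple of x ++ y] & phi x = phi y]],
        e_definable [set t : (m + (m + m)).-tuple G | exists x y z,
          [/\ X x, X y, X z, t = [tuple of x ++ (y ++ z)]
            & (phi x + phi y)%R = phi z]]
      & e_definable [set t : (m + (m + m)).-tuple G | exists x y z,
          [/\ X x, X y, X z, t = [tuple of x ++ (y ++ z)]
            & (phi x * phi y)%R = phi z]]].

Section AlgebraicIntegers.
Variable L : fieldExtType rat.
Local Open Scope ring_scope.

Definition integral_pred : {pred L} :=
  fun x => `[< integralOver (intr : int -> L) x >].

Lemma integral_predP x :
  reflect (integralOver (intr : int -> L) x) (x \in integral_pred).
Proof. exact: asboolP. Qed.

Lemma integral_subring : subring_closed integral_pred.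
Proof.
split; first exact/integral_predP/integral1.
- move=> x y /integral_predP ix /integral_predP iy.
  exact/integral_predP/integral_sub.
- move=> x y /integral_predP ix /integral_predP iy.
  exact/integral_predP/integral_mul.
Qed.

HB.instance Definition _ :=
  GRing.isSubringClosed.Build L integral_pred integral_subring.

Record algint : Type := AlgInt {
  algint_val :> L;
  algint_valP : algint_val \in integral_pred
}.

HB.instance Definition _ := [isSub for algint_val].
HB.instance Definition _ := [Choice of algint by <:].
HB.instance Definition _ := [SubChoice_isSubComNzRing of algint by <:].

End AlgebraicIntegers.

(* Polynomial time. A program acts on finitely many stacks of bits, each push,
   pop, skip and test costing one unit. Two stacks form a tape and finite control
   can be kept in further stacks, so this is the multitape Turing machine model
   with time measured up to a constant factor. *)
Definition store : Type := nat -> seq bool.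

Definition set_stack (s : store) (i : nat) (w : seq bool) : store :=
  fun j => if j == i then w else s j.

Inductive prog : Type :=
| Skip
| Push of nat & bool
| Pop of nat
| Seq of prog & prog
| IfTop of nat & prog & prog
| WhileNonempty of nat & prog.

(* [exec p s t s']: started in s, the program p halts after t steps in s'.
   [IfTop i p q] runs q if the i-th stack is empty or has top bit false. *)
Inductive exec : prog -> store -> nat -> store -> Prop :=
| ExecSkip s : exec Skip s 1 s
| ExecPush s i b : exec (Push i b) s 1 (set_stack s i (b :: s i))
| ExecPop s i : exec (Pop i) s 1 (set_stack s i (behead (s i)))
| ExecSeq p q s1 s2 s3 t1 t2 :
    exec p s1 t1 s2 -> exec q s2 t2 s3 -> exec (Seq p q) s1 (t1 + t2) s3
| ExecIfTrue i p q s s' t :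
    head false (s i) = true -> exec p s t s' -> exec (IfTop i p q) s t.+1 s'
| ExecIfFalse i p q s s' t :
    head false (s i) = false -> exec q s t s' -> exec (IfTop i p q) s t.+1 s'
| ExecWhileStop i p s :
    s i = [::] -> exec (WhileNonempty i p) s 1 s
| ExecWhileStep i p s1 s2 s3 t1 t2 :
    s1 i <> [::] -> exec p s1 t1 s2 -> exec (WhileNonempty i p) s2 t2 s3 ->
    exec (WhileNonempty i p) s1 (t1 + t2).+1 s3.

Definition input_store (w : seq bool) : store := set_stack (fun=> [::]) 0 w.

Definition poly_time (A B : Type) (encA : A -> seq bool) (encB : B -> seq bool)
    (f : A -> B) : Prop :=
  exists (p : prog) (c d : nat), forall a : A, exists (t : nat) (s : store),
    [/\ exec p (input_store (encA a)) t s, s 0 = encB (f a)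
      & (t <= c * size (encA a) ^ d + c)%N].

Definition poly_reducible (A B : Type)
    (encA : A -> seq bool) (encB : B -> seq bool)
    (PA : A -> Prop) (PB : B -> Prop) : Prop :=
  exists2 f : A -> B, poly_time encA encB f & forall a, PA a <-> PB (f a).

(* Systems are coded by bit strings in prefix notation. A variable is named by
   an arbitrary bit string (in particular by a numeral in any base), a generator
   by its index in unary; every code below is prefix-free. *)
Definition enc_var (v : seq bool) : seq bool :=
  flatten [seq [:: true; b] | b <- v] ++ [:: false].

Definition enc_cst (r : nat) (i : 'I_r) : seq bool := nseq i true ++ [:: false].

Fixpoint enc_gterm (r : nat) (t : gterm (seq bool) 'I_r) : seq bool :=
  match t with
  | GVar v => [:: false; false; false] ++ enc_var v
  | GCst i => [:: false; false; true] ++ enc_cst i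
  | GOne => [:: false; true; false]
  | GMul t1 t2 => [:: true; false; false] ++ enc_gterm t1 ++ enc_gterm t2
  | GInv t1 => [:: true; true; false] ++ enc_gterm t1
  end.

Fixpoint enc_rterm (r : nat) (t : rterm (seq bool) 'I_r) : seq bool :=
  match t with
  | RVar v => [:: false; false; false] ++ enc_var v
  | RCst i => [:: false; false; true] ++ enc_cst i
  | RZero => [:: false; true; false]
  | ROne => [:: false; true; true]
  | RAdd t1 t2 => [:: true; false; false] ++ enc_rterm t1 ++ enc_rterm t2
  | RMul t1 t2 => [:: true; false; true] ++ enc_rterm t1 ++ enc_rterm t2
  | ROpp t1 => [:: true; true; false] ++ enc_rterm t1
  end.

Definition enc_system (T : Type) (enc : T -> seq bool) (S : seq (T * T)) :
    seq bool :=
  flatten [seq true :: enc e.1 ++ enc e.2 | e <- S] ++ [:: false].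

Definition generates_group (G : groupType) (r : nat) (g : 'I_r -> G) : Prop :=
  generated (range g) = setT.

Definition subring (R : pzRingType) (S : set R) : Prop :=
  [/\ S 1%R, forall x y, S x -> S y -> S (x - y)%R
    & forall x y, S x -> S y -> S (x * y)%R].

Definition generates_ring (R : pzRingType) (r : nat) (g : 'I_r -> R) : Prop :=
  smallest (@subring R) (range g) = setT.

Definition gsolvable (G : groupType) (r : nat) (g : 'I_r -> G)
    (S : gsystem (seq bool) 'I_r) : Prop :=
  exists rho : seq bool -> G, gsatisfies g rho S.

Definition rsolvable (R : pzRingType) (r : nat) (g : 'I_r -> R)
    (S : rsystem (seq bool) 'I_r) : Prop :=
  exists rho : seq bool -> R, rsatisfies g rho S.

(* D(R) <=_P D(G), the coefficients being given in the families o and g. *)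
Definition diophantine_reducible (R : pzRingType) (G : groupType) (r s : nat)
    (o : 'I_r -> R) (g : 'I_s -> G) : Prop :=
  poly_reducible (enc_system (@enc_rterm r)) (enc_system (@enc_gterm s))
                 (rsolvable o) (gsolvable g).

(* Main.v *)
Require Import Defs.
From HB Require Import structures.
From mathcomp Require Import all_boot all_order all_algebra all_field.
From mathcomp Require Import boolp classical_sets functions cardinality.
From mathcomp Require Import spectral zify ring.

(** Let M be a maximal c-nilpotent subgroup containing the given one. Nilpotent
    subgroups of G are finitely generated, and by maximality the centraliser Z of
    M is the centre of M, so Z is finitely generated abelian and e-definable. So
    are the group W of those w centralising Z with [w, M] in Z, and the group U of
    those u centralising Z with [W, u] in Z, because M, Z and W are finitely
    generated. The commutator, taken modulo the torsion of Z, is a bilinear map f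
    from W x U to a lattice. If f vanished, the second centre of M modulo the
    first would be finite, hence so would be all the later factors of the upper
    central series, and M would be virtually abelian.

    Modulo the left kernel of f, W is a lattice on which each u in U acts as an
    integer matrix F u. Matrices A such that all A (F u) are again of the form
    F v make up a ring, coded in G by the rows of A and the v's of finitely many
    u's, with e-definable operations; its centre S is a nonzero commutative ring
    of integer matrices. A common eigenvector of S gives a homomorphism chi from
    S onto an order of a number field L, with finitely generated kernel.
    Algebraic integers of L are coded as fractions chi s / chi t: chi t is nonzero
    if and only if chi t divides some (2 chi v - 1)(3 chi w - 1), and integrality
    is expressed by a monic equation whose degree is the size of the matrices.

    For the reduction, every node of a ring term gets fresh group variables tied
    to those of its children by the formula defining the operation; the output is
    written in one pass over the input, with a stack of pending nodes. *)

Set Implicit Arguments.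
Unset Strict Implicit.
Unset Printing Implicit Defensive.

Import Order.TTheory GRing.Theory Num.Theory.

(** * E-definability *)

(** An e-definable set is the projection of a solution set, so only positive conditions are
    available. Conditions on all elements of a group are therefore tested on finitely many
    generators; for W this requires showing that it is nilpotent, of class 2, before the maximal
    condition applies to it. No e-definition of M itself is at hand: U is an e-definable group
    containing it which W still pairs into Z. The torsion of Z has bounded exponent N, so equality
    modulo torsion is an equation x^N = 1. Multiplication is the delicate operation. A matrix is
    coded twice, by its rows and by its products with generators, so that a row of A B (F u) is a
    single value of f, taken at a row code of A and a product code of B. The ring S may have zero
    divisors, hence the passage to chi, and chi may map it onto a proper order, hence the fractions.
    A nonvanishing condition becomes positive because 1/2 and 1/3 are not algebraic integers: 2a - 1
    and 3b - 1 never vanish, while every nonzero integer divides some (2v - 1)(3w - 1). *)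

Section Definability.
Variable G : groupType.
Local Open Scope group_scope.

Definition join_val (T V W : Type) (a : V -> T) (y : W -> T) (v : V + W) : T :=
  match v with inl v => a v | inr w => y w end.

Fixpoint gsubst (V V' C C' : Type) (s : V -> gterm V' C') (k : C -> gterm V' C')
    (t : gterm V C) : gterm V' C' :=
  match t with
  | GVar v => s v
  | GCst c => k c
  | GOne => GOne _ _
  | GMul t1 t2 => GMul (gsubst s k t1) (gsubst s k t2)
  | GInv t1 => GInv (gsubst s k t1)
  end.

Lemma geval_subst V V' C C' (c' : C' -> G) (rho : V' -> G) s k (t : gterm V C) :
  geval c' rho (gsubst s k t) =
  geval (fun x => geval c' rho (k x)) (fun v => geval c' rho (s v)) t.
Proof. by elim: t => //= [t1 -> t2 ->|t ->]. Qed.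

Lemma eq_geval V C (c c' : C -> G) (rho rho' : V -> G) :
  c =1 c' -> rho =1 rho' -> geval c rho =1 geval c' rho'.
Proof. by move=> ec er; elim=> //= [t1 -> t2 ->|t ->]. Qed.

Definition gsys_subst (V V' C C' : Type) (s : V -> gterm V' C')
    (k : C -> gterm V' C') (S : gsystem V C) : gsystem V' C' :=
  [seq (gsubst s k e.1, gsubst s k e.2) | e <- S].

Lemma gsatisfies_subst V V' C C' (c' : C' -> G) (rho : V' -> G) s k
    (S : gsystem V C) :
  gsatisfies c' rho (gsys_subst s k S) =
  gsatisfies (fun x => geval c' rho (k x)) (fun v => geval c' rho (s v)) S.
Proof.
by rewrite /gsatisfies all_map; apply: eq_all => e /=; rewrite !geval_subst.
Qed.

Lemma eq_gsatisfies V C (c c' : C -> G) (rho rho' : V -> G) :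
  c =1 c' -> rho =1 rho' -> gsatisfies c rho =1 gsatisfies c' rho'.
Proof.
by move=> ec er S; apply: eq_all => e /=; rewrite !(eq_geval ec er).
Qed.

(* E-definability with arbitrary index types in place of tuples. *)
Definition gdef (V : Type) (P : (V -> G) -> Prop) : Prop :=
  exists (W : finType) (S : gsystem (V + W) G),
    forall a, P a <-> exists y : W -> G, gsatisfies id (join_val a y) S.

Lemma gdef_ext V (P Q : (V -> G) -> Prop) :
  (forall a, P a <-> Q a) -> gdef P -> gdef Q.
Proof.
move=> PQ [W [S SP]]; exists W, S => a; rewrite -SP; exact: iff_sym.
Qed.

(** Terms with coefficients, and not only variables, may be substituted; commutators and powers are
    covered in this way. *)
Lemma gdef_subst V V' (P : (V -> G) -> Prop) (s : V -> gterm V' G) :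
  gdef P -> gdef (fun a => P (fun v => geval id a (s v))).
Proof.
case=> W [S SP].
exists W, (gsys_subst (fun x => match x with
    | inl v => gsubst (fun v => GVar _ (inl v)) (fun c => GCst _ c) (s v)
    | inr w => GVar _ (inr w) end) (fun c => GCst _ c) S) => a.
rewrite SP; split=> -[y Hy]; exists y; move: Hy; rewrite gsatisfies_subst;
  by rewrite (@eq_gsatisfies _ _ _ id _ (join_val (fun v => geval id a (s v)) y))
    // => -[v|w] //=; rewrite geval_subst.
Qed.

Lemma gdef_comp V V' (P : (V -> G) -> Prop) (f : V -> V') :
  gdef P -> gdef (fun a => P (fun v => a (f v))).
Proof. by move=> /(gdef_subst (fun v => GVar _ (f v))). Qed.

Lemma gdef_eq V (t1 t2 : gterm V G) :
  gdef (fun a => geval id a t1 = geval id a t2).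
Proof.
pose i := gsubst (fun v : V => GVar G (inl v : V + void)) (fun c => GCst _ c).
exists void, [:: (i t1, i t2)] => a; split=> [e|[y]].
  exists (of_void G).
  by rewrite /gsatisfies /= !geval_subst andbT; apply/eqP.
by rewrite /gsatisfies /= !geval_subst andbT => /eqP.
Qed.

Lemma gdef_true V : gdef (fun _ : V -> G => True).
Proof. by apply: gdef_ext (gdef_eq (GOne V G) (GOne V G)) => a. Qed.

Lemma gdef_and V (P Q : (V -> G) -> Prop) :
  gdef P -> gdef Q -> gdef (fun a => P a /\ Q a).
Proof.
move=> [W [S SP]] [W' [S' SQ]].
pose f := fun v : V + W => GVar G (match v with
  inl v => inl v | inr w => inr (inl w) end : V + (W + W')).
pose f' := fun v : V + W' => GVar G (match v with
  inl v => inl v | inr w => inr (inr w) end : V + (W + W')).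
exists (W + W')%type, (gsys_subst f (fun c => GCst _ c) S ++
  gsys_subst f' (fun c => GCst _ c) S') => a.
rewrite SP SQ; split=> [[[y Hy] [y' Hy']]|[y]].
  exists (fun w => match w with inl w => y w | inr w => y' w end).
  rewrite /gsatisfies all_cat; apply/andP; split.
    rewrite -[all _ _]/(gsatisfies _ _ _) gsatisfies_subst.
    by rewrite (@eq_gsatisfies _ _ _ id _ (join_val a y)) // => -[].
  rewrite -[all _ _]/(gsatisfies _ _ _) gsatisfies_subst.
  by rewrite (@eq_gsatisfies _ _ _ id _ (join_val a y')) // => -[].
rewrite /gsatisfies all_cat => /andP[].
rewrite -![all _ _]/(gsatisfies _ _ _) !gsatisfies_subst => H H'; split.
  exists (fun w => y (inl w)); move: H.
  by rewrite (@eq_gsatisfies _ _ _ id _ (join_val a (fun w => y (inl w)))) // => -[].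
exists (fun w => y (inr w)); move: H'.
by rewrite (@eq_gsatisfies _ _ _ id _ (join_val a (fun w => y (inr w)))) // => -[].
Qed.

Lemma gdef_ex V (W : finType) (P : (V + W -> G) -> Prop) :
  gdef P -> gdef (fun a => exists y : W -> G, P (join_val a y)).
Proof.
case=> W' [S SP].
pose f := fun v : (V + W) + W' => GVar G (match v with
  inl (inl v) => inl v | inl (inr w) => inr (inl w) | inr w => inr (inr w) end
  : V + (W + W')).
exists (W + W')%type, (gsys_subst f (fun c => GCst _ c) S) => a; split.
  move=> [y /SP[y' Hy]]; exists (join_val y y'); rewrite gsatisfies_subst.
  by rewrite (@eq_gsatisfies _ _ _ id _ (join_val (join_val a y) y')) // => -[[]|].
move=> [y]; rewrite gsatisfies_subst => H.
exists (fun w => y (inl w)); apply/SP; exists (fun w => y (inr w)); move: H.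
rewrite (@eq_gsatisfies _ _ _ id _ (join_val (join_val a (fun w => y (inl w)))
  (fun w => y (inr w)))) // => -[[]|] //.
Qed.

Lemma gdef_all_seq V (I : eqType) (s : seq I) (P : I -> (V -> G) -> Prop) :
  (forall i, gdef (P i)) -> gdef (fun a => forall i, i \in s -> P i a).
Proof.
move=> H; elim: s => [|i s IH]; first by apply: gdef_ext (gdef_true V).
apply: gdef_ext (gdef_and (H i) IH) => a; split=> [[Pi Ps] j|Pa].
  by rewrite inE => /predU1P[->|/Ps].
by split=> [|j js]; apply: Pa; rewrite inE ?eqxx // js orbT.
Qed.

Lemma gdef_all V (I : finType) (P : I -> (V -> G) -> Prop) :
  (forall i, gdef (P i)) -> gdef (fun a => forall i, P i a).
Proof.
move=> H; apply: gdef_ext (gdef_all_seq (enum I) H) => a.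
by split=> Pa i; [apply: Pa; rewrite mem_enum|].
Qed.

Lemma gdef_e_definable m (X : set (m.-tuple G)) :
  gdef (fun a : 'I_m -> G => X [tuple a i | i < m]) -> e_definable X.
Proof.
case=> W [S SX]; exists #|W|.
exists (gsys_subst (fun v => GVar G (match v with
  inl v => inl v | inr w => inr (enum_rank w) end)) (fun c => GCst _ c) S) => a.
have -> : X a <-> X [tuple tnth a i | i < m].
  by rewrite (_ : [tuple _ | i < m] = a) //; apply/eq_from_tnth => i; rewrite tnth_mktuple.
rewrite SX; split=> [[y Hy]|[y]].
  exists [tuple y (enum_val i) | i < #|W|]; rewrite gsatisfies_subst.
  rewrite (@eq_gsatisfies _ _ _ id _ (join_val (tnth a) y)) // => -[i|w] //=.
  by rewrite tnth_mktuple enum_rankK.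
rewrite gsatisfies_subst => H; exists (fun w => tnth y (enum_rank w)); move: H.
by rewrite (@eq_gsatisfies _ _ _ id _
  (join_val (tnth a) (fun w => tnth y (enum_rank w)))) // => -[].
Qed.

End Definability.

(** * Interpretations of a ring and the polynomial relations definable through them *)

Section Interpretations.
Variables (G : groupType) (R : pzRingType) (I : finType).
Variables (D : (I -> G) -> Prop) (phi : (I -> G) -> R).
Local Open Scope ring_scope.

(* The elements of R are coded by the families in D via phi; the relations
   named by sdef are those whose pullback along phi is e-definable. *)
Definition sdef (V : Type) (Q : (V -> R) -> Prop) : Prop :=
  gdef (fun g : V * I -> G => (forall v, D (fun i => g (v, i))) /\
          Q (fun v => phi (fun i => g (v, i)))).

(** The structure interpreted is the subset [S] with the operations of [R]. Keeping it inside [R]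
    lets a ring of matrices be handled without making it a type. *)
Record interp (S : set R) : Prop := Interp {
  interp_in : forall a, D a -> S (phi a);
  interp_surj : forall r, S r -> exists2 a, D a & phi a = r;
  interp_dom : gdef D;
  interp_eq : sdef (fun r : 'I_2 -> R => r 0 = r 1);
  interp_add : sdef (fun r : 'I_3 -> R => r 0 + r 1 = r 2%:R);
  interp_mul : sdef (fun r : 'I_3 -> R => r 0 * r 1 = r 2%:R) }.

Variables (S : set R) (HI : interp S).
Hypothesis subS : Defs.subring S.

(** Equivalence on values in [S] suffices, because the codes in [D] have no other values. *)
Lemma sdef_ext V (Q Q' : (V -> R) -> Prop) :
  (forall r, (forall v, S (r v)) -> Q r <-> Q' r) -> sdef Q -> sdef Q'.
Proof.
move=> QQ'; apply: gdef_ext => g; split=> -[Dg Qg]; split=> //;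
  by apply/QQ' => // v; apply: (interp_in HI).
Qed.

Lemma sdef_and V (Q Q' : (V -> R) -> Prop) :
  sdef Q -> sdef Q' -> sdef (fun r => Q r /\ Q' r).
Proof. by move=> dQ dQ'; apply: gdef_ext (gdef_and dQ dQ') => g; tauto. Qed.

Lemma gdef_dom (V : finType) :
  gdef (fun g : V * I -> G => forall v, D (fun i => g (v, i))).
Proof.
by apply: gdef_all => v; apply: (gdef_comp (fun i => (v, i))); apply: interp_dom HI.
Qed.

Lemma sdef_comp (V V' : finType) (f : V' -> V) (Q : (V' -> R) -> Prop) :
  sdef Q -> sdef (fun r : V -> R => Q (r \o f)).
Proof.
move=> /(gdef_comp (fun vi : V' * I => (f vi.1, vi.2))) /(gdef_and (gdef_dom V)).
apply: gdef_ext => g; split=> [[Dg [_ Qg]]|[Dg Qg]]; split=> //.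
by split=> [v|]; [exact: (Dg (f v))|exact: Qg].
Qed.

(** Quantification over elements of [S] becomes quantification over codes, since every element has
    one. *)
Lemma sdef_ex (V W : finType) (Q : (V + W -> R) -> Prop) : sdef Q ->
  sdef (fun r : V -> R =>
    exists y : W -> R, (forall w, S (y w)) /\ Q (join_val r y)).
Proof.
move=> /(gdef_comp (fun vi : (V + W) * I => match vi.1 with
   inl v => inl (v, vi.2) | inr w => inr (w, vi.2) end : V * I + W * I))
  /gdef_ex /(gdef_and (gdef_dom V)); apply: gdef_ext => g.
split=> [[Dg [y /= [Dy Qy]]]|[Dg [y [Sy Qy]]]]; split=> //.
  exists (fun w => phi (fun i => y (w, i))); split=> [w|].
    by apply: (interp_in HI); apply: (Dy (inr w)).
  by move: Qy; congr Q; apply/funext => -[].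
have /choice[z Hz] : forall w, exists a, D a /\ phi a = y w.
  by move=> w; have [a Da ea] := interp_surj HI (Sy w); exists a.
exists (fun wi => z wi.1 wi.2); split=> [[v|w]|] /=.
- exact: Dg.
- by case: (Hz w).
- move: Qy; congr Q; apply/funext => -[v|w] //=.
  by case: (Hz w) => _ <-.
Qed.

(** A code of [c] is inserted into the definition of equality as a family of coefficients. *)
Lemma sdef_cst (V : finType) (v : V) (c : R) : S c -> sdef (fun r => r v = c).
Proof.
move=> Sc; have [a Da ac] := interp_surj HI Sc.
have := gdef_subst (fun ji : 'I_2 * I => if ji.1 == 0 then GVar G (v, ji.2)
   else GCst (V * I) (a ji.2)) (interp_eq HI).
move=> /(gdef_and (gdef_dom V)); apply: gdef_ext => g /=.
split=> [[Dg [_ e]]|[Dg e]]; split=> //; first by rewrite -ac -e.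
split; last by rewrite e -ac.
by move=> i; case: eqP => _; [exact: (Dg v)|exact: Da].
Qed.

Lemma subring0 : S 0.
Proof. by case: subS => S1 SB _; rewrite -(subrr 1); apply: SB. Qed.

Lemma subringN x : S x -> S (- x).
Proof. by case: subS => _ SB _ Sx; rewrite -sub0r; apply: SB => //; apply: subring0. Qed.

Lemma subringD x y : S x -> S y -> S (x + y).
Proof. by case: subS => _ SB _ Sx Sy; rewrite -(opprK y); apply: SB => //; apply: subringN. Qed.

Variables (C : Type) (cst : C -> R).
Hypothesis Scst : forall c, S (cst c).

Lemma subring_reval V (rho : V -> R) t :
  (forall v, S (rho v)) -> S (reval cst rho t).
Proof.
case: subS => S1 SB SM Sr.
elim: t => //= [|t1 H1 t2 H2|t1 H1 t2 H2|t1 H1].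
- exact: subring0.
- exact: subringD.
- exact: SM.
- exact: subringN.
Qed.

(** The existential variables [false] and [true] hold the values of the two operands. *)
Lemma sdef_bin (op : R -> R -> R) (V : finType) (e1 e2 : (V -> R) -> R) :
  (forall r, (forall v, S (r v)) -> S (e1 r)) ->
  (forall r, (forall v, S (r v)) -> S (e2 r)) ->
  sdef (fun r : 'I_3 -> R => op (r 0) (r 1) = r 2%:R) ->
  sdef (fun r : V + unit -> R => e1 (r \o inl) = r (inr tt)) ->
  sdef (fun r : V + unit -> R => e2 (r \o inl) = r (inr tt)) ->
  sdef (fun r : V + unit -> R => op (e1 (r \o inl)) (e2 (r \o inl)) = r (inr tt)).
Proof.
move=> Se1 Se2 dop
  /(sdef_comp (fun v : V + unit => match v with
     inl v => inl (inl v) | inr _ => inr false end : (V + unit) + bool)) d1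
  /(sdef_comp (fun v : V + unit => match v with
     inl v => inl (inl v) | inr _ => inr true end : (V + unit) + bool)) d2.
have := sdef_comp (fun j : 'I_3 => if j == 0 then inr false else if j == 1 then
  inr true else inl (inr tt) : (V + unit) + bool) dop.
move=> /(sdef_and d1) /(sdef_and d2) /sdef_ex.
apply: sdef_ext => r Sr; split=> [[y [_ /= [e2y [e1y]]]]|e].
  by move=> <-; rewrite -e2y -e1y.
exists (fun b : bool => if b then e2 (r \o inl) else e1 (r \o inl)); split.
  by case; [apply: Se2|apply: Se1] => v; apply: Sr.
by [].
Qed.

Lemma sdef_reval (V : finType) (t : rterm V C) :
  sdef (fun r : V + unit -> R => reval cst (r \o inl) t = r (inr tt)).
Proof.
elim: t => [v|c|||t1 IH1 t2 IH2|t1 IH1 t2 IH2|t IH] /=.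
- have := sdef_comp (fun j : 'I_2 => if j == 0 then inl v else inr tt : V + unit)
    (interp_eq HI).
  by apply: sdef_ext.
- by apply: sdef_ext (sdef_cst (inr tt) (Scst c)) => r _; split.
- by apply: sdef_ext (sdef_cst (inr tt) subring0) => r _; split.
- by case: subS => S1 _ _; apply: sdef_ext (sdef_cst (inr tt) S1) => r _; split.
- apply: (@sdef_bin +%R V (fun r => reval cst r t1) (fun r => reval cst r t2)
      _ _ (interp_add HI) IH1 IH2) => r; exact: subring_reval.
- apply: (@sdef_bin *%R V (fun r => reval cst r t1) (fun r => reval cst r t2)
      _ _ (interp_mul HI) IH1 IH2) => r; exact: subring_reval.
(* The opposite is defined through addition: the value of [t] plus the result equals zero, which is
   held by [inr true]. *)
- have IH' := sdef_comp (fun v : V + unit => match v with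
    inl v => inl (inl v) | inr _ => inr false end : (V + unit) + bool) IH.
  have := sdef_comp (fun j : 'I_3 => if j == 0 then inr false else if j == 1 then
    inl (inr tt) else inr true : (V + unit) + bool) (interp_add HI).
  have := sdef_cst (inr true : (V + unit) + bool) subring0.
  move=> /sdef_and /[apply] /(sdef_and IH') /sdef_ex.
  apply: sdef_ext => r Sr; split=> [[y [_ /= [ey [y0]]]]|e].
    by rewrite /= y0 -ey => /eqP; rewrite addrC addr_eq0 => /eqP ->.
  exists (fun b : bool => if b then 0 else reval cst (r \o inl) t); split.
    by case; [exact: subring0|apply: subring_reval => v; apply: Sr].
  by split=> //; split=> //=; rewrite -e subrr.
Qed.

Lemma sdef_req (V : finType) (t1 t2 : rterm V C) :
  sdef (fun r : V -> R => reval cst r t1 = reval cst r t2).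
Proof.
have /sdef_ex := sdef_and (sdef_reval t1) (sdef_reval t2).
apply: sdef_ext => r Sr; split=> [[y [_ [e1 e2]]]|e].
  by rewrite [LHS]e1 [RHS]e2.
by exists (fun=> reval cst r t1); split=> // _; apply: subring_reval.
Qed.

End Interpretations.

(** * Coding the elements of a second ring by pairs from the first *)

Section Pairs.
Variables (G : groupType) (R R' : pzRingType) (I : finType).
Variables (D : (I -> G) -> Prop) (phi : (I -> G) -> R).
Variables (S : set R) (X : R -> R -> Prop) (psi : R -> R -> R').
Hypothesis HI : interp D phi S.
Local Open Scope ring_scope.

(** The Boolean index separates the two components; in the application [false] is the numerator and
    [true] the denominator. *)
Definition pair_dom (g : bool * I -> G) : Prop :=
  [/\ D (fun i => g (false, i)), D (fun i => g (true, i)) &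
      X (phi (fun i => g (false, i))) (phi (fun i => g (true, i)))].

Definition pair_val (g : bool * I -> G) : R' :=
  psi (phi (fun i => g (false, i))) (phi (fun i => g (true, i))).

Lemma pair_sdef (V : finType) (Q : (V -> R') -> Prop) :
  sdef D phi (fun r : V * bool -> R =>
    (forall v, X (r (v, false)) (r (v, true))) /\
    Q (fun v => psi (r (v, false)) (r (v, true)))) ->
  sdef pair_dom pair_val Q.
Proof.
move=> /(gdef_comp (fun vi : V * bool * I => (vi.1.1, (vi.1.2, vi.2)))).
apply: gdef_ext => g /=; split=> [[Dg [Xg Qg]]|[Dg Qg]].
  split=> // v; split; [exact: (Dg (v, false))|exact: (Dg (v, true))|exact: Xg].
by split=> [[v b]|]; [case: (Dg v); case: b|split=> // v; case: (Dg v)].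
Qed.

Lemma pair_interp :
  (forall r', exists2 s : R * R, S s.1 /\ S s.2 & X s.1 s.2 /\ psi s.1 s.2 = r') ->
  sdef D phi (fun r : bool -> R => X (r false) (r true)) ->
  sdef D phi (fun r : 'I_2 * bool -> R =>
    (forall v, X (r (v, false)) (r (v, true))) /\
    psi (r (0, false)) (r (0, true)) = psi (r (1, false)) (r (1, true))) ->
  sdef D phi (fun r : 'I_3 * bool -> R =>
    (forall v, X (r (v, false)) (r (v, true))) /\
    psi (r (0, false)) (r (0, true)) + psi (r (1, false)) (r (1, true)) =
    psi (r (2%:R, false)) (r (2%:R, true))) ->
  sdef D phi (fun r : 'I_3 * bool -> R =>
    (forall v, X (r (v, false)) (r (v, true))) /\
    psi (r (0, false)) (r (0, true)) * psi (r (1, false)) (r (1, true)) =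
    psi (r (2%:R, false)) (r (2%:R, true))) ->
  interp pair_dom pair_val [set: R'].
Proof.
move=> surj dX deq dadd dmul; split=> //.
- move=> r' _; have [[s t] /= [Ss St] [Xst <-]] := surj r'.
  have [a Da ea] := interp_surj HI Ss; have [b Db eb] := interp_surj HI St.
  exists (fun bi => if bi.1 then b bi.2 else a bi.2).
    by split; rewrite /= ?ea ?eb.
  by rewrite /pair_val /= ea eb.
- by apply: gdef_ext dX => g; split=> [[Dg Xg]|[Df Dt Xg]]; split=> //; case.
- exact: (pair_sdef (Q := fun r : 'I_2 -> R' => r 0 = r 1)).
- exact: (pair_sdef (Q := fun r : 'I_3 -> R' => r 0 + r 1 = r 2%:R)).
- exact: (pair_sdef (Q := fun r : 'I_3 -> R' => r 0 * r 1 = r 2%:R)).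
Qed.

End Pairs.

Lemma tuple_cat_inv (T : Type) m n (a : 'I_(m + n) -> T)
    (x : m.-tuple T) (y : n.-tuple T) :
  [tuple a i | i < m + n] = [tuple of x ++ y] <->
  x = [tuple a (lshift n i) | i < m] /\ y = [tuple a (rshift m i) | i < n].
Proof.
split=> [e|[-> ->]].
  split; apply/eq_from_tnth => i; rewrite tnth_mktuple.
    by rewrite -(tnth_lshift x y) -e tnth_mktuple.
  by rewrite -(tnth_rshift x y) -e tnth_mktuple.
apply/eq_from_tnth => i; rewrite tnth_mktuple -[i]fintype.splitK.
by case: (fintype.split i) => j /=; rewrite ?tnth_lshift ?tnth_rshift tnth_mktuple.
Qed.

(** * From families over finite index types to tuples *)

Section ToTuples.
Variables (G : groupType) (R : pzRingType) (I : finType).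
Variables (D : (I -> G) -> Prop) (phi : (I -> G) -> R).
Hypothesis HI : interp D phi [set: R].
Local Open Scope ring_scope.

Let fam (x : #|I|.-tuple G) (i : I) := tnth x (enum_rank i).

Let fam_mk (a : 'I_#|I| -> G) : fam [tuple a j | j < #|I|] = a \o enum_rank.
Proof. by apply/funext => i; rewrite /fam tnth_mktuple. Qed.

Lemma ternary_e_definable (op : R -> R -> R) :
  sdef D phi (fun r : 'I_3 -> R => op (r 0) (r 1) = r 2%:R) ->
  e_definable [set t : (#|I| + (#|I| + #|I|)).-tuple G | exists x y z,
          [/\ D (fam x), D (fam y), D (fam z), t = [tuple of x ++ (y ++ z)]
            & op (phi (fam x)) (phi (fam y)) = phi (fam z)]].
Proof.
move=> dop; apply: gdef_e_definable.
have := gdef_comp (fun ji : 'I_3 * I => let k := enum_rank ji.2 in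
  if ji.1 == 0 then lshift (#|I| + #|I|) k
  else if ji.1 == 1 then rshift #|I| (lshift #|I| k)
  else rshift #|I| (rshift #|I| k)) dop.
apply: gdef_ext => a; split=> [[Da opa]|[x [y [z [Dx Dy Dz]]]]].
  exists [tuple a (lshift _ i) | i < #|I|].
  exists [tuple a (rshift _ (lshift _ i)) | i < #|I|].
  exists [tuple a (rshift _ (rshift _ i)) | i < #|I|].
  rewrite !fam_mk; split=> //; try by [exact: (Da 0)|exact: (Da 1)|exact: (Da 2%:R)].
  apply/tuple_cat_inv; split=> //; apply/esym/tuple_cat_inv; split=> //.
move=> /tuple_cat_inv[ex /esym/tuple_cat_inv[ey ez]] e.
move: Dx Dy Dz e; rewrite ex ey ez !fam_mk => Dx Dy Dz e; split=> // v.
by case: v => [[|[|[|v]]]].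
Qed.

Lemma interp_e_interpretable : e_interpretable R G.
Proof.
exists #|I|, (fun x => D (fam x)), (fun x => phi (fam x)); split.
- apply: gdef_e_definable.
  have := gdef_comp (fun i => enum_rank i) (interp_dom HI).
  by apply: gdef_ext => a; rewrite fam_mk.
- move=> r; have [a Da ar] := interp_surj HI (r := r) Logic.I.
  exists [tuple a (enum_val j) | j < #|I|]; rewrite fam_mk.
    by rewrite (_ : _ \o _ = a) //; apply/funext => i /=; rewrite enum_rankK.
  by rewrite (_ : _ \o _ = a) //; apply/funext => i /=; rewrite enum_rankK.
- apply: gdef_e_definable.
  have := gdef_comp (fun ji : 'I_2 * I => let k := enum_rank ji.2 in
    if ji.1 == 0 then lshift #|I| k else rshift #|I| k) (interp_eq HI).
  apply: gdef_ext => a; split=> [[Da ea]|[x [y [Dx Dy]]]].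
    exists [tuple a (lshift _ i) | i < #|I|], [tuple a (rshift _ i) | i < #|I|].
    rewrite !fam_mk; split=> //; try by [exact: (Da 0)|exact: (Da 1)].
    exact/tuple_cat_inv.
  move=> /tuple_cat_inv[ex ey] e; move: Dx Dy e; rewrite ex ey !fam_mk.
  by move=> Dx Dy e; split=> // -[[|[|v]]].
- exact: ternary_e_definable (interp_add HI).
- exact: ternary_e_definable (interp_mul HI).
Qed.

End ToTuples.

(** * Translation of systems of ring equations *)

(** [HN] stands for a node of the syntax tree, [HA] and [HB] for its children, [HV] for the ring
    variable at a leaf. *)
Inductive hole := HN | HA | HB | HV.

Definition hole_id h : nat :=
  match h with HN => 0 | HA => 1 | HB => 2 | HV => 3 end.

Lemma hole_idK : cancel hole_id
  (fun n => match n with 0 => HN | 1 => HA | 2 => HB | _ => HV end).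
Proof. by case. Qed.

HB.instance Definition _ := Equality.copy hole (can_type hole_idK).

(* A template is a group system in variables (h, i), the i-th component of the
   tuple standing in hole h, and in numbered existential variables. *)
Definition tvar := (hole * nat + nat)%type.

Definition tvar_val (G : Type) (x : hole -> nat -> G) (y : nat -> G) (v : tvar) : G :=
  match v with inl hi => x hi.1 hi.2 | inr j => y j end.

Section Translation.
Variables (r s : nat).
Definition template := gsystem tvar 'I_s.

(* Nodes of ring terms are named by numbers written in unary. A group variable
   consists of an index in unary, two bits telling node components, components
   of a ring variable, and existential variables of a node apart, and a name. *)
Definition var_prefix (v : tvar) : seq bool :=
  match v with
  | inl (h, i) => nseq i true ++ [:: false; h == HV; false]
  | inr j => nseq j true ++ [:: false; false; true]
  end.

Definition var_hole (v : tvar) : hole := if v is inl (h, _) then h else HN.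

Definition var_name (env : hole -> seq bool) (v : tvar) : seq bool :=
  var_prefix v ++ env (var_hole v).

Definition tinst (env : hole -> seq bool) (T : template) : gsystem (seq bool) 'I_s :=
  gsys_subst (fun v => GVar _ (var_name env v)) (fun c => GCst _ c) T.

Definition henv (n a b : nat) (v : seq bool) (h : hole) : seq bool :=
  match h with HN => nseq n true | HA => nseq a true | HB => nseq b true
             | HV => v end.

Variables (tVar tAdd tMul tOpp tZero tOne tEq : template) (tCst : 'I_r -> template).

(** The number of names spent on proper subterms; the root is named from outside. *)
Fixpoint fresh (t : rterm (seq bool) 'I_r) : nat :=
  match t with
  | RAdd t1 t2 | RMul t1 t2 => 2 + fresh t1 + fresh t2
  | ROpp t1 => 1 + fresh t1
  | _ => 0
  end.

(* [tr t n k] forces node n to have the value of t, using the names k, k+1, ... *)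
Fixpoint tr (t : rterm (seq bool) 'I_r) (n k : nat) : gsystem (seq bool) 'I_s :=
  match t with
  (* The stack program reads a name onto a stack, which reverses it. Node 0 fills the holes that a
     leaf leaves open; the nodes proper are numbered from 1. *)
  | RVar v => tinst (henv n 0 0 (rev v)) tVar
  | RCst c => tinst (henv n 0 0 [::]) (tCst c)
  | RZero => tinst (henv n 0 0 [::]) tZero
  | ROne => tinst (henv n 0 0 [::]) tOne
  | RAdd t1 t2 => tinst (henv n k k.+1 [::]) tAdd ++
      (tr t1 k k.+2 ++ tr t2 k.+1 (k.+2 + fresh t1))
  | RMul t1 t2 => tinst (henv n k k.+1 [::]) tMul ++
      (tr t1 k k.+2 ++ tr t2 k.+1 (k.+2 + fresh t1))
  | ROpp t1 => tinst (henv n k 0 [::]) tOpp ++ tr t1 k k.+1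
  end.

Definition tr_eq (e : rterm (seq bool) 'I_r * rterm (seq bool) 'I_r) (k : nat) :=
  tinst (henv k k.+1 k.+2 [::]) tEq ++
  (tr e.1 k.+1 k.+3 ++ tr e.2 k.+2 (k.+3 + fresh e.1)).

Definition fresh_eq (e : rterm (seq bool) 'I_r * rterm (seq bool) 'I_r) :=
  3 + fresh e.1 + fresh e.2.

Fixpoint tr_sys (S : rsystem (seq bool) 'I_r) (k : nat) : gsystem (seq bool) 'I_s :=
  if S is e :: S' then tr_eq e k ++ tr_sys S' (k + fresh_eq e) else [::].

Variables (G : groupType) (R : pzRingType) (g : 'I_s -> G) (o : 'I_r -> R).
Variables (D : (nat -> G) -> Prop) (phi : (nat -> G) -> R).
Hypothesis surj : forall c : R, exists a, D a /\ phi a = c.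

Definition tholds (T : template) (x : hole -> nat -> G) : Prop :=
  exists y, gsatisfies g (tvar_val x y) T.

Hypothesis hVar : forall x,
  tholds tVar x <-> [/\ D (x HN), D (x HV) & phi (x HN) = phi (x HV)].
Hypothesis hCst : forall c x, tholds (tCst c) x <-> D (x HN) /\ phi (x HN) = o c.
Hypothesis hZero : forall x, tholds tZero x <-> D (x HN) /\ phi (x HN) = 0%R.
Hypothesis hOne : forall x, tholds tOne x <-> D (x HN) /\ phi (x HN) = 1%R.
Hypothesis hAdd : forall x, tholds tAdd x <->
  [/\ D (x HN), D (x HA), D (x HB) & phi (x HN) = phi (x HA) + phi (x HB)]%R.
Hypothesis hMul : forall x, tholds tMul x <->
  [/\ D (x HN), D (x HA), D (x HB) & phi (x HN) = phi (x HA) * phi (x HB)]%R.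
Hypothesis hOpp : forall x, tholds tOpp x <->
  [/\ D (x HN), D (x HA) & phi (x HN) = - phi (x HA)]%R.
Hypothesis hEq : forall x, tholds tEq x <->
  [/\ D (x HA), D (x HB) & phi (x HA) = phi (x HB)].

Lemma tinst_sat rho env T :
  gsatisfies g rho (tinst env T) =
  gsatisfies g (fun v => rho (var_name env v)) T.
Proof. by rewrite /tinst gsatisfies_subst. Qed.

Lemma tinst_holds rho env T : gsatisfies g rho (tinst env T) ->
  tholds T (fun h i => rho (var_name env (inl (h, i)))).
Proof.
rewrite tinst_sat => H; exists (fun j => rho (var_name env (inr j))).
by move: H; rewrite (@eq_gsatisfies _ _ _ g g _ (tvar_val
  (fun h i => rho (var_name env (inl (h, i)))) (fun j => rho (var_name env (inr j)))))
  // => -[[]|].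
Qed.

Section Sound.
Variable rho : seq bool -> G.
Let xn n (i : nat) := rho (nseq i true ++ [:: false; false; false] ++ nseq n true).
Let xv (v : seq bool) i := rho (nseq i true ++ [:: false; true; false] ++ rev v).

Lemma tr_sound t n k : gsatisfies g rho (tr t n k) ->
  D (xn n) /\ phi (xn n) = reval o (fun v => phi (xv v)) t.
Proof.
have E1 n0 a b v : (fun i => rho (var_name (henv n0 a b v) (inl (HN, i)))) = xn n0.
  by apply/funext => i; rewrite /var_name /= -catA.
have E2 n0 a b v : (fun i => rho (var_name (henv n0 a b v) (inl (HA, i)))) = xn a.
  by apply/funext => i; rewrite /var_name /= -catA.
have E3 n0 a b v : (fun i => rho (var_name (henv n0 a b v) (inl (HB, i)))) = xn b.
  by apply/funext => i; rewrite /var_name /= -catA.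
have E4 n0 a b v :
    (fun i => rho (var_name (henv n0 a b (rev v)) (inl (HV, i)))) = xv v.
  by apply/funext => i; rewrite /var_name /= -catA.
elim: t n k => [v|c|||t1 IH1 t2 IH2|t1 IH1 t2 IH2|t1 IH1] n k /=.
- by move=> /tinst_holds /hVar; rewrite E1 E4 => -[].
- by move=> /tinst_holds /hCst; rewrite E1.
- by move=> /tinst_holds /hZero; rewrite E1.
- by move=> /tinst_holds /hOne; rewrite E1.
- rewrite /gsatisfies !all_cat => /and3P[].
  move=> /tinst_holds /hAdd; rewrite E1 E2 E3 => -[Dn _ _ ->].
  by move=> /IH1[_ ->] /IH2[_ ->].
- rewrite /gsatisfies !all_cat => /and3P[].
  move=> /tinst_holds /hMul; rewrite E1 E2 E3 => -[Dn _ _ ->].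
  by move=> /IH1[_ ->] /IH2[_ ->].
- rewrite /gsatisfies !all_cat => /andP[].
  move=> /tinst_holds /hOpp; rewrite E1 E2 => -[Dn _ ->].
  by move=> /IH1[_ ->].
Qed.

Lemma tr_sys_sound S k : gsatisfies g rho (tr_sys S k) ->
  rsatisfies o (fun v => phi (xv v)) S.
Proof.
elim: S k => //= e S IH k; rewrite /tr_eq /gsatisfies !all_cat.
move=> /andP[/and3P[/tinst_holds /hEq[_ _ e12] /tr_sound[_ e1] /tr_sound[_ e2]]].
move=> /IH ->; rewrite andbT -e1 -e2; apply/eqP; move: e12.
by congr (phi _ = phi _); apply/funext => i; rewrite /var_name /= -catA.
Qed.
End Sound.

Section Complete.
Variable rho : seq bool -> R.

Definition rep (c : R) : nat -> G := projT1 (cid (surj c)).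
Lemma rep_dom c : D (rep c). Proof. by rewrite /rep; case: cid => a []. Qed.
Lemma rep_val c : phi (rep c) = c. Proof. by rewrite /rep; case: cid => a []. Qed.

(** Decodes what [var_name] produces: the index before the first [false], two bits for the kind,
    then the name. Strings too short to be decoded get the value 1. *)
Definition name_val (xn yn : nat -> nat -> G) (w : seq bool) : G :=
  let i := index false w in
  match drop i.+1 w with
  | true :: _ :: c => rep (rho (rev c)) i
  | false :: false :: c => xn (size c) i
  | false :: true :: c => yn (size c) i
  | _ => 1%g
  end.

Lemma index_nseq_false i (w : seq bool) : index false (nseq i true ++ false :: w) = i.
Proof. by elim: i => //= i ->. Qed.

Lemma drop_nseq_false i (w : seq bool) : drop i.+1 (nseq i true ++ false :: w) = w.
Proof. by elim: i => //=; rewrite drop0. Qed.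

Lemma name_val_x xn yn n a b v h i :
  name_val xn yn (var_name (henv n a b (rev v)) (inl (h, i))) =
  match h with HN => xn n | HA => xn a | HB => xn b | HV => rep (rho v) end i.
Proof.
rewrite /name_val /var_name /= -catA /= index_nseq_false drop_nseq_false.
by case: h => /=; rewrite ?size_nseq ?revK.
Qed.

Lemma name_val_y xn yn n a b v j :
  name_val xn yn (var_name (henv n a b v) (inr j)) = yn n j.
Proof.
by rewrite /name_val /var_name /= -catA /= index_nseq_false drop_nseq_false size_nseq.
Qed.

Definition sat xn yn (S : gsystem (seq bool) 'I_s) := gsatisfies g (name_val xn yn) S.

(** The witness [y] depends only on the values in the holes, so it is chosen before the valuation,
    which may then vary at all other nodes. *)
Lemma tinst_complete (x : hole -> nat -> G) v T :
  x HV = rep (rho v) -> tholds T x ->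
  exists y, forall xn yn n a b, yn n = y ->
    xn n = x HN -> xn a = x HA -> xn b = x HB ->
    sat xn yn (tinst (henv n a b (rev v)) T).
Proof.
move=> xV [y H]; exists y => xn yn n a b ey en ea eb.
rewrite /sat tinst_sat; move: H.
rewrite (@eq_gsatisfies _ _ _ g g _
  (fun w => name_val xn yn (var_name (henv n a b (rev v)) w))) //.
case=> [[h i]|j]; rewrite ?name_val_x ?name_val_y ?ey //=.
by case: h; rewrite ?xV ?en ?ea ?eb.
Qed.

Definition upd (T : Type) (f : nat -> T) n z j := if j == n then z else f j.

Lemma upd_same T (f : nat -> T) n z : upd f n z n = z.
Proof. by rewrite /upd eqxx. Qed.

Lemma upd_other T (f : nat -> T) n z j : j != n -> upd f n z j = f j.
Proof. by rewrite /upd => /negPf ->. Qed.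

(** Node [n] keeps its value, but its existential variables may be changed, as they are chosen only
    when its template is treated. *)
Definition extends (xn yn xn' yn' : nat -> nat -> G) (n k : nat) : Prop :=
  (forall j, j < k -> xn' j = xn j) /\ (forall j, j < k -> j != n -> yn' j = yn j).

(** Satisfaction by every valuation that agrees at node 0, at node [n] and at the nodes from [k] to
    below [l]. This stability lets sibling subterms be completed one after the other. *)
Definition forces (S : gsystem (seq bool) 'I_s) (xn yn : nat -> nat -> G)
    (n k l : nat) : Prop :=
  forall xn' yn', (forall j, j < l -> [|| j == 0, j == n | k <= j] ->
    xn' j = xn j /\ yn' j = yn j) -> sat xn' yn' S.

Lemma leaf_complete xn yn n k T v :
  tholds T (fun h => match h with HN => xn n | HA | HB => xn 0 | HV => rep (rho v) end) ->
  0 < n < k -> exists xn' yn', extends xn yn xn' yn' n k /\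
    forces (tinst (henv n 0 0 (rev v)) T) xn' yn' n k k.
Proof.
move=> /(tinst_complete erefl)[y Hy] /andP[n0 nk].
exists xn, (upd yn n y); split; first by split=> // j _; apply: upd_other.
move=> xn' yn' H; have k0 : 0 < k by apply: leq_trans nk.
have [xe ye] := H n nk ltac:(by rewrite eqxx orbT).
have [xe0 _] := H 0 k0 isT.
by apply: Hy; rewrite ?xe0 ?xe ?ye ?upd_same.
Qed.

Definition completes t : Prop := forall k xn yn n, 0 < n < k ->
  xn n = rep (reval o rho t) ->
  exists xn' yn', extends xn yn xn' yn' n k /\
    forces (tr t n k) xn' yn' n k (k + fresh t).

(** The children receive chosen codes of their values, and the two subterms are then completed on
    disjoint ranges of nodes. The template is arbitrary so that the equations of a system are
    covered along with sums and products. *)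
Lemma binary_complete t1 t2 (T : template) x (k1 k2 n0 : nat) xn0 yn0 :
  completes t1 -> completes t2 ->
  0 < k1 -> k2 = k1.+1 -> k1 != n0 -> 0 < n0 < k2.+1 -> k2 != n0 ->
  xn0 n0 = x ->
  tholds T (fun h => match h with HN => x | HA => rep (reval o rho t1)
    | HB => rep (reval o rho t2) | HV => rep (rho [::]) end) ->
  exists xn' yn', extends xn0 yn0 xn' yn' n0 k1 /\
    forces (tinst (henv n0 k1 k2 [::]) T ++
       (tr t1 k1 k2.+1 ++ tr t2 k2 (k2.+1 + fresh t1)))
       xn' yn' n0 k1 (k2.+1 + fresh t1 + fresh t2).
Proof.
move=> IH1 IH2 k10 ek2 k1n0 /andP[n0_gt0 n0k2] k2n0 xn0E.
move=> /(tinst_complete erefl)[y Hy].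
pose xa := upd (upd xn0 k1 (rep (reval o rho t1))) k2 (rep (reval o rho t2)).
have k12 : k1 < k2 by rewrite ek2.
have [|xb [yb [[exb eyb] fb]]] :=
    IH1 k2.+1 xa (upd yn0 n0 y) k1 ltac:(by rewrite k10 ltnW).
  by rewrite /xa upd_other ?upd_same // ltn_eqF.
have [||xc [yc [[exc eyc] fc]]] := IH2 (k2.+1 + fresh t1) xb yb k2.
- by rewrite (ltn_trans k10 k12) addSn ltnS leq_addr.
- by rewrite exb // /xa upd_same.
have lt1 j : j < k2.+1 -> j < k2.+1 + fresh t1.
  by move=> jk; apply: leq_trans jk _; rewrite leq_addr.
have lt2 j : j < k2.+1 + fresh t1 -> j < k2.+1 + fresh t1 + fresh t2.
  by move=> jk; apply: leq_trans jk _; rewrite leq_addr.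
have xcE j : j < k2.+1 -> xc j = xa j.
  by move=> jk; rewrite exc ?exb // lt1.
exists xc, yc; split.
  split=> j jk.
    have jk2 : j < k2.+1 by rewrite ltnW // ltnS (ltn_trans jk).
    by rewrite xcE // /xa !upd_other // ltn_eqF // (ltn_trans jk).
  move=> jn; have jk2 : j < k2.+1 by rewrite ltnW // ltnS (ltn_trans jk).
  rewrite eyc ?lt1 //; last by rewrite ltn_eqF // (ltn_trans jk).
  by rewrite eyb // ?upd_other // ltn_eqF.
move=> x'' y'' H; rewrite /sat /gsatisfies !all_cat; apply/and3P; split.
- have [e1 _] := H k1 (lt2 _ (lt1 _ (leqW k12))) ltac:(by rewrite leqnn !orbT).
  have [e2 _] := H k2 (lt2 _ (lt1 _ (ltnSn _))) ltac:(by rewrite (ltnW k12) !orbT).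
  have [e3 e4] := H n0 (lt2 _ (lt1 _ n0k2)) ltac:(by rewrite eqxx !orbT).
  apply: (Hy x'' y''); rewrite ?e1 ?e2 ?e3 ?e4 ?xcE ?ltnS ?(ltnW k12) //.
  + rewrite eyc ?lt1 // ?(eq_sym n0) // eyb // ?(eq_sym n0) //; exact: upd_same.
  + by rewrite /xa !upd_other // eq_sym.
  + by rewrite /xa upd_other ?upd_same // ltn_eqF.
  + by rewrite /xa upd_same.
- apply: fb => j jl /or3P jc.
  have jk1 : [|| j == 0, j == n0 | k1 <= j].
    by case: jc => [->|/eqP ->|/ltnW/(leq_trans (ltnW k12)) ->]; rewrite ?leqnn ?orbT.
  have [-> ->] := H j (lt2 _ jl) jk1.
  rewrite exc // eyc //; case: jc => [/eqP->|/eqP->|].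
  + by rewrite ltn_eqF // (ltn_trans k10 k12).
  + by rewrite ltn_eqF.
  + by move=> kj; rewrite gtn_eqF.
- apply: fc => j jl jc; apply: H => //.
  case/or3P: jc => [->//|/eqP->|kj]; first by rewrite (ltnW k12) !orbT.
  apply/orP; right; apply/orP; right; apply: leq_trans kj.
  by rewrite (leq_trans (ltnW k12)) // ltnW // lt1.
Qed.

Lemma unary_complete t (T : template) x (k n0 : nat) xn0 yn0 :
  completes t -> 0 < n0 < k -> xn0 n0 = x ->
  tholds T (fun h => match h with HN => x | HA => rep (reval o rho t)
    | HB => xn0 0 | HV => rep (rho [::]) end) ->
  exists xn' yn', extends xn0 yn0 xn' yn' n0 k /\
    forces (tinst (henv n0 k 0 [::]) T ++ tr t k k.+1)
       xn' yn' n0 k (k.+1 + fresh t).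
Proof.
move=> IH /andP[n0_gt0 n0k] xn0E /(tinst_complete erefl)[y Hy].
pose xa := upd xn0 k (rep (reval o rho t)).
have k0 : 0 < k by apply: ltn_trans n0k.
have [|xb [yb [[exb eyb] fb]]] := IH k.+1 xa (upd yn0 n0 y) k ltac:(by rewrite k0 /=).
  by rewrite /xa upd_same.
have lt1 j : j < k.+1 -> j < k.+1 + fresh t.
  by move=> jk; apply: leq_trans jk _; rewrite leq_addr.
exists xb, yb; split.
  split=> j jk; first by rewrite exb ?(leqW jk) // /xa upd_other // ltn_eqF.
  by move=> jn; rewrite eyb ?upd_other // ?ltn_eqF // leqW.
move=> x'' y'' H; rewrite /sat /gsatisfies !all_cat; apply/andP; split.
- have [e1 _] := H k (lt1 _ (ltnSn _)) ltac:(by rewrite leqnn !orbT).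
  have [e2 _] := H 0 (lt1 _ (leqW k0)) isT.
  have [e3 e4] := H n0 (lt1 _ (leqW n0k)) ltac:(by rewrite eqxx !orbT).
  apply: (Hy x'' y''); rewrite ?e1 ?e2 ?e3 ?e4 ?exb // ?(leqW n0k) //.
  + by rewrite eyb ?(leqW n0k) ?(ltn_eqF n0k) // upd_same.
  + by rewrite /xa upd_other // ltn_eqF.
  + by rewrite /xa upd_same.
  + by rewrite /xa upd_other // ltn_eqF.
- apply: fb => j jl jc; apply: H => //.
  by case/or3P: jc => [->//|/eqP->|/ltnW->]; rewrite ?leqnn !orbT.
Qed.

Lemma tr_complete t : completes t.
Proof.
elim: t => [v|c|||t1 IH1 t2 IH2|t1 IH1 t2 IH2|t1 IH1] k xn yn n nk xnE /=.
- rewrite addn0; apply: leaf_complete => //; apply/hVar.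
  by rewrite xnE !rep_val; split=> //; apply: rep_dom.
- rewrite addn0; apply: (@leaf_complete _ _ _ _ _ [::]) => //; apply/hCst.
  by rewrite xnE rep_val; split=> //; apply: rep_dom.
- rewrite addn0; apply: (@leaf_complete _ _ _ _ _ [::]) => //; apply/hZero.
  by rewrite xnE rep_val; split=> //; apply: rep_dom.
- rewrite addn0; apply: (@leaf_complete _ _ _ _ _ [::]) => //; apply/hOne.
  by rewrite xnE rep_val; split=> //; apply: rep_dom.
- have /andP[n0 nk'] := nk.
  rewrite (_ : k + (2 + _ + _) = k.+2 + fresh t1 + fresh t2); last first.
    by rewrite !addnA addn2.
  apply: (binary_complete (x := xn n)) => //; rewrite ?gtn_eqF //.
  + exact: ltn_trans nk'.
  + by rewrite n0 ltnW // ltnW.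
  + exact: ltnW.
  + by apply/hAdd; rewrite xnE !rep_val; split=> //; apply: rep_dom.
- have /andP[n0 nk'] := nk.
  rewrite (_ : k + (2 + _ + _) = k.+2 + fresh t1 + fresh t2); last first.
    by rewrite !addnA addn2.
  apply: (binary_complete (x := xn n)) => //; rewrite ?gtn_eqF //.
  + exact: ltn_trans nk'.
  + by rewrite n0 ltnW // ltnW.
  + exact: ltnW.
  + by apply/hMul; rewrite xnE !rep_val; split=> //; apply: rep_dom.
- rewrite addnA addn1; apply: (unary_complete (x := xn n)) => //.
  by apply/hOpp; rewrite xnE !rep_val; split=> //; apply: rep_dom.
Qed.

Lemma tr_sys_complete S k xn yn : 0 < k -> rsatisfies o rho S ->
  exists xn' yn', (forall j, j < k -> xn' j = xn j /\ yn' j = yn j) /\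
    forall xn'' yn'', (forall j, xn'' j = xn' j /\ yn'' j = yn' j) ->
      sat xn'' yn'' (tr_sys S k).
Proof.
elim: S k xn yn => [|e S IH] k xn yn k0 /=; first by exists xn, yn.
move=> /andP[/eqP e12 HS].
have [|xa [ya [[xaE yaE] fa]]] := @binary_complete e.1 e.2 tEq (xn k) k.+1 k.+2 k xn yn
    (@tr_complete e.1) (@tr_complete e.2) isT erefl ltac:(by rewrite gtn_eqF)
    ltac:(by rewrite k0 ltnW) ltac:(by rewrite gtn_eqF // ltnW) erefl.
  by apply/hEq; rewrite !rep_val; split=> //; apply: rep_dom.
have [|xb [yb [xyb fb]]] := IH (k + fresh_eq e) xa ya _ HS.
  by rewrite ltn_addr.
exists xb, yb; split=> [j jk|x'' y'' H].
  have [-> ->] := xyb j ltac:(by rewrite ltn_addr).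
  by rewrite xaE ?yaE ?ltn_eqF // ltnW.
rewrite /sat /gsatisfies all_cat; apply/andP; split; last exact: fb H.
apply: fa => j jl _; have [-> ->] := H j; apply: xyb.
by move: jl; rewrite /fresh_eq !addnA addn3.
Qed.

End Complete.

Lemma tr_sys_solvable S : rsolvable o S <-> gsolvable g (tr_sys S 1).
Proof.
split=> [[rho H]|[rho /tr_sys_sound H]]; last first.
  by exists (fun v => phi (fun i => rho (nseq i true ++ [:: false; true; false] ++ rev v))).
have [xn [yn [_ Hs]]] :=
  @tr_sys_complete rho S 1 (fun _ _ => 1%g) (fun _ _ => 1%g) isT H.
by exists (name_val rho xn yn); apply: Hs.
Qed.

End Translation.

(** * Stack programs *)

Section Machine.

(** Only upper bounds on running times are tracked, so that runs compose without exact counts. *)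
Definition runs (p : prog) (s s' : store) (T : nat) : Prop :=
  exists2 t, exec p s t s' & t <= T.

Lemma runs_to p s s1 s2 T T2 : runs p s s1 T -> s1 = s2 -> T <= T2 -> runs p s s2 T2.
Proof. by case=> t H tT <- TT2; exists t => //; apply: leq_trans TT2. Qed.

Lemma runs_seq p q s1 s2 s3 T1 T2 :
  runs p s1 s2 T1 -> runs q s2 s3 T2 -> runs (Seq p q) s1 s3 (T1 + T2).
Proof.
case=> t1 H1 l1 [t2 H2 l2]; exists (t1 + t2); last exact: leq_add.
exact: ExecSeq H1 H2.
Qed.

Lemma runs_skip s : runs Skip s s 1.
Proof. by exists 1 => //; constructor. Qed.

Lemma runs_push s i b : runs (Push i b) s (set_stack s i (b :: s i)) 1.
Proof. by exists 1 => //; constructor. Qed.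

Lemma runs_pop s i : runs (Pop i) s (set_stack s i (behead (s i))) 1.
Proof. by exists 1 => //; constructor. Qed.

Lemma runs_iftop i b p q s s' T : head false (s i) = b ->
  runs (if b then p else q) s s' T -> runs (IfTop i p q) s s' T.+1.
Proof. by case: b => e [t H tT]; exists t.+1 => //; constructor. Qed.

Lemma runs_stop i p s : s i = [::] -> runs (WhileNonempty i p) s s 1.
Proof. by move=> e; exists 1 => //; constructor. Qed.

Lemma runs_step i p s1 s2 s3 T1 T2 : s1 i <> [::] ->
  runs p s1 s2 T1 -> runs (WhileNonempty i p) s2 s3 T2 ->
  runs (WhileNonempty i p) s1 s3 (T1 + T2).+1.
Proof.
move=> e [t1 H1 l1] [t2 H2 l2]; exists (t1 + t2).+1; last by rewrite ltnS leq_add.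
exact: ExecWhileStep H1 H2.
Qed.

(** The output is no longer than the running time; this bounds the cost of its final reversal. *)
Lemma exec_size p s t s' : exec p s t s' -> forall i, size (s' i) <= size (s i) + t.
Proof.
elim=> {p s t s'} //.
- by move=> s i; rewrite leq_addr.
- move=> s i b j; rewrite /set_stack; case: eqP => [->|_] /=; lia.
- move=> s i j; rewrite /set_stack; case: eqP => [->|_]; rewrite ?size_behead; lia.
- move=> p q s1 s2 s3 t1 t2 _ H1 _ H2 i; have := H1 i; have := H2 i; lia.
- move=> i p q s s' t _ _ H j; have := H j; lia.
- move=> i p q s s' t _ _ H j; have := H j; lia.
- by move=> i p s _ j; rewrite leq_addr.
- move=> i p s1 s2 s3 t1 t2 _ _ H1 _ H2 j; have := H1 j; have := H2 j; lia.
Qed.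

Ltac store_eq := apply/funext => ?; rewrite /set_stack;
  repeat (case: eqP => ? //; subst); rewrite ?eqxx; try congruence.

Lemma set_stack_same s i w : set_stack s i w i = w.
Proof. by rewrite /set_stack eqxx. Qed.

Lemma set_stack_other s i j w : j != i -> set_stack s i w j = s j.
Proof. by rewrite /set_stack => /negPf ->. Qed.

Lemma set_stack_id s i w : s i = w -> set_stack s i w = s.
Proof. by move=> e; store_eq. Qed.

Lemma set_stackK s i w w' : set_stack (set_stack s i w) i w' = set_stack s i w'.
Proof. by store_eq. Qed.

Lemma set_stackC s i j w w' : i != j ->
  set_stack (set_stack s i w) j w' = set_stack (set_stack s j w') i w.
Proof. by move/eqP => e; store_eq. Qed.

Ltac get := repeat first [rewrite set_stack_same
  | rewrite set_stack_other; [|by rewrite // eq_sym]].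

Definition read (i : nat) (p q : prog) : prog :=
  IfTop i (Seq (Pop i) p) (Seq (Pop i) q).

Lemma runs_read i (b : bool) w p q s s' T : s i = b :: w ->
  runs (if b then p else q) (set_stack s i w) s' T -> runs (read i p q) s s' T.+2.
Proof.
move=> e H; apply: (@runs_iftop i b); first by rewrite e.
have {}H : runs (Seq (Pop i) (if b then p else q)) s s' T.+1.
  by rewrite -add1n; apply: runs_seq (runs_pop s i) _; rewrite e.
by case: b e H.
Qed.

Definition clear i := WhileNonempty i (Pop i).

Lemma runs_clear s i : runs (clear i) s (set_stack s i [::]) (2 * size (s i) + 1).
Proof.
move e: (s i) => w; elim: w s e => [|b w IH] s e.
  by apply: runs_to (runs_stop (Pop i) e) _ _ => //; rewrite set_stack_id.
apply: (@runs_to _ _ _ _ (1 + (2 * size w + 1)).+1); last by rewrite /=; lia.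
  apply: (@runs_step _ _ _ (set_stack s i w)); first by rewrite e.
    by have := runs_pop s i; rewrite e.
  exact/IH/set_stack_same.
by rewrite set_stackK.
Qed.

Definition mv i j := WhileNonempty i (read i (Push j true) (Push j false)).

Lemma runs_mv s i j : i != j ->
  runs (mv i j) s (set_stack (set_stack s i [::]) j (rev (s i) ++ s j))
    (4 * size (s i) + 1).
Proof.
move=> ij; move e: (s i) => w; elim: w s e => [|b w IH] s e.
  apply: runs_to (runs_stop (read i (Push j true) (Push j false)) e) _ _ => //.
  by rewrite [set_stack s i _]set_stack_id // set_stack_id.
pose s1 := set_stack (set_stack s i w) j (b :: s j).
have ji : j != i by rewrite eq_sym.
apply: (@runs_to _ _ _ _ (3 + (4 * size w + 1)).+1); last by rewrite /=; lia.
  apply: (@runs_step _ _ _ s1); first by rewrite e.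
    apply: runs_read e _.
    have := runs_push (set_stack s i w) j b; rewrite set_stack_other //.
    by case: b @s1 => s1.
  by apply: IH; rewrite /s1; get.
rewrite /s1 set_stackC // set_stackK set_stackC // !set_stackK.
by rewrite set_stack_same rev_cons cat_rcons set_stackC.
Qed.

(** The body of [enc_var], without the end mark. *)
Definition dbl (w : seq bool) := flatten [seq [:: true; b] | b <- w].

(* Appends the doubled content of stack i to the output, restoring stack i from
   the scratch stack 8. *)
Definition copy i := Seq
  (WhileNonempty i (read i
     (Seq (Push 8 true) (Seq (Push 1 true) (Push 1 true)))
     (Seq (Push 8 false) (Seq (Push 1 true) (Push 1 false)))))
  (mv 8 i).

Lemma runs_copy s i : i != 1 -> i != 8 -> s 8 = [::] ->
  runs (copy i) s (set_stack s 1 (rev (dbl (s i)) ++ s 1)) (10 * size (s i) + 2).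
Proof.
move=> i1 i8 s8; rewrite /copy; set body := read _ _ _.
have H w : forall s, s i = w -> runs (WhileNonempty i body) s
   (set_stack (set_stack (set_stack s i [::]) 8 (rev w ++ s 8)) 1
      (rev (dbl w) ++ s 1)) (6 * size w + 1).
  elim: w => [|b w IH] {s8} s e.
    apply: runs_to (runs_stop (body) e) _ _ => //=.
    by rewrite [set_stack s i _]set_stack_id // [set_stack s 8 _]set_stack_id //
      set_stack_id.
  pose s1 := set_stack (set_stack (set_stack s i w) 8 (b :: s 8)) 1
    [:: b, true & s 1].
  apply: (@runs_to _ _ _ _ (5 + (6 * size w + 1)).+1); last by rewrite /=; lia.
    apply: (@runs_step _ _ _ s1); first by rewrite e.
      apply: runs_read e _.
      have : runs (Seq (Push 8 b) (Seq (Push 1 true) (Push 1 b))) (set_stack s i w) s1 3.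
        apply: (@runs_to _ _ _ _ (1 + (1 + 1))); last by [].
          apply: runs_seq; first exact: runs_push.
          by apply: runs_seq; exact: runs_push.
        by rewrite /s1; store_eq.
      by case: b @s1.
    by apply: IH; rewrite /s1; get.
  have -> : s1 8 = b :: s 8 by rewrite /s1 /set_stack eqxx.
  have -> : s1 1 = [:: b, true & s 1] by rewrite /s1 /set_stack eqxx.
  by rewrite /= !rev_cons !cat_rcons /s1; store_eq.
apply: (@runs_to _ _ _ _ ((6 * size (s i) + 1) + (4 * size (s i) + 1))); last by lia.
  apply: runs_seq; first exact: H.
  have := @runs_mv (set_stack (set_stack (set_stack s i [::]) 8 (rev (s i) ++ s 8)) 1
      (rev (dbl (s i)) ++ s 1)) 8 i.
  by rewrite eq_sym => /(_ i8) /runs_to; apply; rewrite ?s8 ?cats0 //=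
    set_stack_other // set_stack_same size_rev.
get; rewrite revK cats0.
by store_eq.
Qed.

(* Puts the counter, stack 3, into stack i and increments it. *)
Definition alloc i := Seq (clear i) (Seq
  (WhileNonempty 3 (Seq (Pop 3) (Seq (Push 8 true) (Push i true))))
  (Seq (mv 8 3) (Push 3 true))).

Lemma rev_nseq (T : Type) n (x : T) : rev (nseq n x) = nseq n x.
Proof.
elim: n => //= n IH; rewrite rev_cons IH -cats1.
by elim: n {IH} => //= n ->.
Qed.

Lemma nseq_cons (T : Type) n (x : T) w : nseq n x ++ x :: w = x :: nseq n x ++ w.
Proof. by elim: n => //= n ->. Qed.

Lemma runs_alloc s i k : i != 3 -> i != 8 -> s 8 = [::] -> s 3 = nseq k true ->
  runs (alloc i) s (set_stack (set_stack s i (nseq k true)) 3 (nseq k.+1 true))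
    (2 * size (s i) + 8 * k + 4).
Proof.
move=> i3 i8 s8 s3; rewrite /alloc; set body := Seq (Pop 3) _.
have H : forall s, s 3 = nseq k true -> runs (WhileNonempty 3 body) s
   (set_stack (set_stack (set_stack s 3 [::]) 8 (nseq k true ++ s 8)) i
      (nseq k true ++ s i)) (4 * k + 1).
  elim: k {s8 s3} => [|k IH] {}s e.
    apply: runs_to (runs_stop (body) e) _ _ => //=.
    by rewrite [set_stack s 3 _]set_stack_id // [set_stack s 8 _]set_stack_id //
      set_stack_id.
  pose s1 := set_stack (set_stack (set_stack s 3 (nseq k true)) 8 (true :: s 8)) i
    (true :: s i).
  apply: (@runs_to _ _ _ _ (3 + (4 * k + 1)).+1); last by lia.
    apply: (@runs_step _ _ _ s1); first by rewrite e.
      apply: (@runs_to _ _ _ _ (1 + (1 + 1))); last by [].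
        apply: runs_seq; first exact: runs_pop.
        by apply: runs_seq; exact: runs_push.
      by rewrite /s1 e; store_eq.
    by apply: IH; rewrite /s1; get.
  have -> : s1 8 = true :: s 8 by rewrite /s1 set_stack_other ?set_stack_same // eq_sym.
  have -> : s1 i = true :: s i by rewrite /s1 set_stack_same.
  by rewrite !nseq_cons /s1; store_eq.
apply: (@runs_to _ _ _ _ ((2 * size (s i) + 1) + ((4 * k + 1) + ((4 * k + 1) + 1))));
  last by lia.
  apply: runs_seq; first exact: runs_clear.
  apply: runs_seq; first by apply: H; rewrite set_stack_other // eq_sym.
  apply: runs_seq; last exact: runs_push.
  apply: runs_to; first exact: runs_mv.
    by [].
  rewrite set_stack_other; last by rewrite eq_sym.
  by rewrite set_stack_same size_cat size_nseq set_stack_other ?s8 ?addn0 // eq_sym.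
get; rewrite ?s8 ?cats0 ?rev_nseq.
by store_eq.
Qed.

(* Moves the number in stack i to the stack 2 of pending targets. *)
Definition pushp i := Seq (Push 2 false) (WhileNonempty i (Seq (Pop i) (Push 2 true))).

Lemma runs_pushp s i k : i != 2 -> s i = nseq k true ->
  runs (pushp i) s (set_stack (set_stack s i [::]) 2 (nseq k true ++ false :: s 2))
    (3 * k + 2).
Proof.
move=> i2 si; rewrite /pushp; set body := Seq (Pop i) _.
have H : forall s, s i = nseq k true -> runs (WhileNonempty i body) s
   (set_stack (set_stack s i [::]) 2 (nseq k true ++ s 2)) (3 * k + 1).
  elim: k {si} => [|k IH] {}s e.
    apply: runs_to (runs_stop (body) e) _ _ => //=.
    by rewrite [set_stack s i _]set_stack_id // set_stack_id.
  pose s1 := set_stack (set_stack s i (nseq k true)) 2 (true :: s 2).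
  apply: (@runs_to _ _ _ _ (2 + (3 * k + 1)).+1); last by lia.
    apply: (@runs_step _ _ _ s1); first by rewrite e.
      apply: (@runs_to _ _ _ _ (1 + 1)); last by [].
        by apply: runs_seq; [exact: runs_pop|exact: runs_push].
      by rewrite /s1 e /=; store_eq.
    by apply: IH; rewrite /s1; get.
  have -> : s1 2 = true :: s 2 by rewrite /s1 set_stack_same.
  by rewrite !nseq_cons /s1; store_eq.
apply: (@runs_to _ _ _ _ (1 + (3 * k + 1))); last by lia.
  apply: runs_seq; first exact: runs_push.
  by apply: H; rewrite set_stack_other.
by rewrite set_stack_same; store_eq.
Qed.

(* Stack 9 is the loop flag of the next two programs. *)
Definition popn := Seq (clear 4) (Seq (Push 9 true)
  (WhileNonempty 9 (read 2 (Push 4 true) (Pop 9)))).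

Lemma runs_popn s n w : s 2 = nseq n true ++ false :: w -> s 9 = [::] ->
  runs popn s (set_stack (set_stack s 2 w) 4 (nseq n true))
    (2 * size (s 4) + 4 * n + 8).
Proof.
move=> s2 s9; rewrite /popn; set body := read 2 _ _.
have H : forall s, s 2 = nseq n true ++ false :: w -> s 9 = [:: true] ->
    runs (WhileNonempty 9 body) s
   (set_stack (set_stack (set_stack s 2 w) 9 [::]) 4 (nseq n true ++ s 4)) (4 * n + 5).
  elim: n {s2 s9} => [|n IH] {}s e e9.
    apply: (@runs_to _ _ _ _ (3 + 1).+1); last by [].
      apply: (@runs_step _ _ _ (set_stack (set_stack s 2 w) 9 [::])); first by rewrite e9.
        by apply: runs_read e _; apply: runs_to; [exact: runs_pop|rewrite set_stack_other ?e9|].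
      exact/runs_stop/set_stack_same.
    by store_eq.
  pose s1 := set_stack (set_stack s 2 (nseq n true ++ false :: w)) 4 (true :: s 4).
  apply: (@runs_to _ _ _ _ (3 + (4 * n + 5)).+1); last by lia.
    apply: (@runs_step _ _ _ s1); first by rewrite e9.
      by apply: runs_read e _; apply: runs_to; [exact: runs_push|rewrite set_stack_other|].
    by apply: IH; rewrite /s1; get.
  have -> : s1 4 = true :: s 4 by rewrite /s1 set_stack_same.
  by rewrite !nseq_cons /s1; store_eq.
apply: (@runs_to _ _ _ _ ((2 * size (s 4) + 1) + (1 + (4 * n + 5)))); last by lia.
  apply: runs_seq; first exact: runs_clear.
  apply: runs_seq; first exact: runs_push.
  by apply: H; get; rewrite ?s9.
by get; rewrite cats0; store_eq.
Qed.

Definition readv := Seq (clear 7) (Seq (Push 9 true)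
  (WhileNonempty 9 (read 0 (read 0 (Push 7 true) (Push 7 false)) (Pop 9)))).

Lemma runs_readv s v w : s 0 = enc_var v ++ w -> s 9 = [::] ->
  runs readv s (set_stack (set_stack s 0 w) 7 (rev v))
    (2 * size (s 7) + 6 * size v + 8).
Proof.
rewrite /enc_var -catA /= -/(dbl v) => s0 s9; rewrite /readv; set body := read 0 _ _.
have H : forall s, s 0 = dbl v ++ false :: w -> s 9 = [:: true] ->
    runs (WhileNonempty 9 body) s
   (set_stack (set_stack (set_stack s 0 w) 9 [::]) 7 (rev v ++ s 7)) (6 * size v + 5).
  elim: v {s0 s9} => [|b v IH] {}s e e9.
    apply: (@runs_to _ _ _ _ (3 + 1).+1); last by [].
      apply: (@runs_step _ _ _ (set_stack (set_stack s 0 w) 9 [::])); first by rewrite e9.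
        by apply: runs_read e _; apply: runs_to; [exact: runs_pop|rewrite set_stack_other ?e9|].
      exact/runs_stop/set_stack_same.
    by store_eq.
  pose s1 := set_stack (set_stack s 0 (dbl v ++ false :: w)) 7 (b :: s 7).
  apply: (@runs_to _ _ _ _ (5 + (6 * size v + 5)).+1); last by rewrite /=; lia.
    apply: (@runs_step _ _ _ s1); first by rewrite e9.
      apply: runs_read e _; apply: runs_read; first by rewrite set_stack_same.
      have -> : (if b then Push 7 true else Push 7 false) = Push 7 b by case: (b).
      by apply: runs_to; [exact: runs_push|rewrite /s1; store_eq|].
    by apply: IH; rewrite /s1; get.
  have -> : s1 7 = b :: s 7 by rewrite /s1 set_stack_same.
  by rewrite rev_cons cat_rcons /s1; store_eq.
apply: (@runs_to _ _ _ _ ((2 * size (s 7) + 1) + (1 + (6 * size v + 5)))); last by lia.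
  apply: runs_seq; first exact: runs_clear.
  apply: runs_seq; first exact: runs_push.
  by apply: H; get; rewrite ?s9.
by get; rewrite cats0; store_eq.
Qed.

End Machine.

(** * Writing an instance of a template to the output *)

Section Emission.
Variables (s : nat).

(** The code of an instance consists of fixed bits, compiled into the program, and of places where
    the content of a hole is copied. *)
Definition item := (bool + hole)%type.

Definition item_val (env : hole -> seq bool) (x : item) : seq bool :=
  match x with inl b => [:: b] | inr h => dbl (env h) end.

Definition items_val env (l : seq item) := flatten [seq item_val env x | x <- l].

(** A group variable ends with the content of its hole, so its code is a fixed prefix, one copy and
    an end mark. *)
Fixpoint gterm_items (t : gterm tvar 'I_s) : seq item :=
  match t with
  | GVar v => [seq inl b | b <- [:: false; false; false] ++ dbl (var_prefix v)] ++
      [:: inr (var_hole v); inl false]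
  | GCst i => [seq inl b | b <- [:: false; false; true] ++ enc_cst i]
  | GOne => [seq inl b | b <- [:: false; true; false]]
  | GMul t1 t2 => [seq inl b | b <- [:: true; false; false]] ++
      (gterm_items t1 ++ gterm_items t2)
  | GInv t1 => [seq inl b | b <- [:: true; true; false]] ++ gterm_items t1
  end.

Lemma items_val_cat env l1 l2 :
  items_val env (l1 ++ l2) = items_val env l1 ++ items_val env l2.
Proof. by rewrite /items_val map_cat flatten_cat. Qed.

Lemma items_val_bits env w : items_val env [seq inl b | b <- w] = w.
Proof. by elim: w => //= b w IH; rewrite /items_val /= -[in RHS]IH. Qed.

Lemma dbl_cat w1 w2 : dbl (w1 ++ w2) = dbl w1 ++ dbl w2.
Proof. by rewrite /dbl map_cat flatten_cat. Qed.

Lemma gterm_itemsP env t : items_val env (gterm_items t) =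
  enc_gterm (gsubst (fun v => GVar _ (var_name env v)) (fun c => GCst _ c) t).
Proof.
elim: t => [v|i||t1 IH1 t2 IH2|t1 IH1];
  rewrite /gterm_items -/gterm_items ?items_val_cat ?items_val_bits ?IH1 ?IH2 //.
by rewrite /= /enc_var /var_name -/(dbl _) dbl_cat -catA.
Qed.

Definition eqs_items (T : template s) : seq item :=
  flatten [seq inl true :: gterm_items e.1 ++ gterm_items e.2 | e <- T].

Definition enc_eqs (S : gsystem (seq bool) 'I_s) : seq bool :=
  flatten [seq true :: enc_gterm e.1 ++ enc_gterm e.2 | e <- S].

Lemma enc_eqs_cat S S' : enc_eqs (S ++ S') = enc_eqs S ++ enc_eqs S'.
Proof. by rewrite /enc_eqs map_cat flatten_cat. Qed.

Lemma eqs_itemsP env T : items_val env (eqs_items T) = enc_eqs (tinst env T).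
Proof.
elim: T => //= e T IH.
have cE x l : items_val env (x :: l) = item_val env x ++ items_val env l by [].
by rewrite /eqs_items /= -/(eqs_items T) cE !items_val_cat IH !gterm_itemsP.
Qed.

Definition emit_item (x : item) : prog :=
  match x with inl b => Push 1 b | inr h => copy (4 + hole_id h) end.

Fixpoint emit (l : seq item) : prog :=
  if l is x :: l' then Seq (emit_item x) (emit l') else Skip.

Lemma runs_emit env B l (st : store) : st 8 = [::] ->
  (forall h, st (4 + hole_id h) = env h) -> (forall h, size (env h) <= B) ->
  runs (emit l) st (set_stack st 1 (rev (items_val env l) ++ st 1))
    ((10 * B + 2) * size l + 1).
Proof.
move=> st8 stE szB; elim: l st st8 stE => [|x l IH] st st8 stE /=.
  by apply: runs_to (runs_skip st) _ _; [rewrite set_stack_id|rewrite muln0].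
pose st1 := set_stack st 1 (rev (item_val env x) ++ st 1).
apply: (@runs_to _ _ _ _ ((10 * B + 2) + ((10 * B + 2) * size l + 1))); last by lia.
  apply: (@runs_seq _ _ _ st1).
    case: x @st1 => [b|h] /=.
      by apply: runs_to; [exact: runs_push| |lia].
    have H := @runs_copy st (4 + hole_id h) isT ltac:(by case: (h)) st8; rewrite stE in H.
    apply: runs_to H _ _ => //.
    by have := szB h; lia.
  apply: IH => [|h]; first by rewrite /st1 set_stack_other.
  by rewrite /st1 set_stack_other.
rewrite /st1 set_stackK set_stack_same /items_val /= -/(items_val env l).
by rewrite rev_cat catA.
Qed.

End Emission.

(** * The translation as a stack program, and its running time *)

Section Program.
Variables (r s : nat).
Variables (tVar tAdd tMul tOpp tZero tOne tEq : template s) (tCst : 'I_r -> template s).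

Fixpoint readc (ps : seq prog) : prog :=
  if ps is p :: ps' then read 0 (readc ps') p else Skip.

Lemma runs_readc ps i w st st' T : st 0 = nseq i true ++ false :: w ->
  i < size ps -> runs (nth Skip ps i) (set_stack st 0 w) st' T ->
  runs (readc ps) st st' (T + 2 * i.+1).
Proof.
elim: ps i st => [|p ps IH] // [|i] st e; rewrite ?ltnS => H Hr /=.
  by apply: runs_to; [exact: runs_read e Hr| |lia].
apply: runs_to; first apply: runs_read e _.
- apply: IH H _; first by rewrite set_stack_same.
  by rewrite set_stackK.
- by [].
- by lia.
Qed.

Definition emitT (T : template s) := emit (eqs_items T).

(** The second child is pushed before the first, so the first is on top when its code, which comes
    first in prefix order, is read. *)
Definition binary_prog T := Seq (alloc 5) (Seq (alloc 6) (Seq (emitT T)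
  (Seq (pushp 6) (pushp 5)))).

(** A decision tree on the three bits that open the code of a ring term; three ones open no code. *)
Definition dispatch : prog :=
  read 0
    (read 0
      (read 0 Skip (Seq (alloc 5) (Seq (emitT tOpp) (pushp 5))))
      (read 0 (binary_prog tMul) (binary_prog tAdd)))
    (read 0
      (read 0 (emitT tOne) (emitT tZero))
      (read 0 (readc [seq emitT (tCst i) | i <- enum 'I_r])
              (Seq readv (emitT tVar)))).

Definition node : prog :=
  Seq popn (Seq (clear 5) (Seq (clear 6) (Seq (clear 7) dispatch))).

Definition top : prog :=
  read 0
    (Seq (alloc 4) (Seq (alloc 5) (Seq (alloc 6) (Seq (clear 7) (Seq (emitT tEq)
       (Seq (pushp 6) (pushp 5)))))))
    (Push 1 false).

(** Pending targets are positive numbers in unary, each ended by [false]. Hence the top bit of stack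
    2 is [true] exactly when a target is pending; otherwise a new equation or the end of the system
    is read. *)
Definition body := IfTop 2 node top.
Definition main := WhileNonempty 0 body.
(** The counter starts at 1 because node 0 is the dummy; the output is written backwards and
    reversed at the end. *)
Definition translator := Seq (Push 3 true) (Seq main (mv 1 0)).

(* Stacks: 0 input, 1 reversed output, 2 pending targets, 3 counter,
   4 to 7 the contents of the holes; scratch stacks are empty. *)
Definition mk (inp out pend cnt n a b v : seq bool) : store :=
  nth [::] [:: inp; out; pend; cnt; n; a; b; v].

(** Stacks 4 to 7 hold leftovers of the previous node; [B] bounds them and with them the cost of
    clearing. *)
Definition ok (st : store) inp out pend k B : Prop :=
  exists n a b v, st = mk inp out pend (nseq k true) n a b v /\
    [/\ size n <= B, size a <= B, size b <= B & size v <= B].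

Definition tsizes : seq nat :=
  [seq size (eqs_items T) | T <- [:: tVar; tAdd; tMul; tOpp; tZero; tOne; tEq]] ++
  [seq size (eqs_items (tCst i)) | i <- enum 'I_r].

Definition tsize : nat := \max_(n <- tsizes) n.

(** A generous bound for one pass of the main loop: the emission of a template, a bounded number of
    unary copies, and the reading of the index of a generator. *)
Definition cost B := (10 * B + 2) * tsize + 60 * B + 60 + 2 * r.

(** Stated for an arbitrary continuation, so that passes can be chained without cutting a run of
    [main] into pieces. *)
Definition loops (st st' : store) (T : nat) : Prop :=
  forall st'' T', runs main st' st'' T' -> runs main st st'' (T + T').

Lemma loops_trans st1 st2 st3 T1 T2 :
  loops st1 st2 T1 -> loops st2 st3 T2 -> loops st1 st3 (T1 + T2).
Proof. by move=> H1 H2 st T /H2 /H1; rewrite addnA. Qed.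

Lemma loops_leq st1 st2 T1 T2 : loops st1 st2 T1 -> T1 <= T2 -> loops st1 st2 T2.
Proof.
move=> H T12 st T' /H[t Ht tT]; exists t => //.
by apply: leq_trans tT _; rewrite leq_add2r.
Qed.

Lemma loops_body st st' T : st 0 <> [::] -> runs body st st' T -> loops st st' T.+1.
Proof. by move=> e H st'' T' H'; apply: runs_step e H H'. Qed.

Ltac mk_eq := apply/funext => -[|[|[|[|[|[|[|[|[|[|?]]]]]]]]]] //=;
  rewrite /set_stack /= ?nth_nil //.

Lemma set_mk inp out pend cnt n a b v i w :
  set_stack (mk inp out pend cnt n a b v) i w =
  match i with
  | 0 => mk w out pend cnt n a b v
  | 1 => mk inp w pend cnt n a b v
  | 2 => mk inp out w cnt n a b v
  | 3 => mk inp out pend w n a b v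
  | 4 => mk inp out pend cnt w a b v
  | 5 => mk inp out pend cnt n w b v
  | 6 => mk inp out pend cnt n a w v
  | 7 => mk inp out pend cnt n a b w
  | _ => set_stack (mk inp out pend cnt n a b v) i w
  end.
Proof.
by move: i => [|[|[|[|[|[|[|[|i]]]]]]]] //; mk_eq.
Qed.

Lemma runs_emitT (T : template s) (env : hole -> seq bool) B inp out pend cnt :
  (forall h, size (env h) <= B) -> size (eqs_items T) <= tsize ->
  runs (emitT T) (mk inp out pend cnt (env HN) (env HA) (env HB) (env HV))
    (mk inp (rev (enc_eqs (tinst env T)) ++ out) pend cnt
       (env HN) (env HA) (env HB) (env HV)) ((10 * B + 2) * tsize + 1).
Proof.
move=> szB szT; apply: runs_to.
- by apply: (runs_emit (env := env) (eqs_items T)) szB => // -[].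
- by rewrite set_mk eqs_itemsP.
- by rewrite leq_add2r leq_mul2l szT orbT.
Qed.

Lemma tsizeP n : n \in tsizes -> n <= tsize.
Proof.
rewrite /tsize; elim: tsizes => // m l IH; rewrite inE big_cons leq_max.
by case/predU1P=> [->|/IH ->]; rewrite ?leqnn ?orbT.
Qed.

Lemma size_hole B n a b v : n <= B -> a <= B -> b <= B -> size v <= B ->
  forall h, size (henv n a b v h) <= B.
Proof. by move=> nB aB bB vB []/=; rewrite ?size_nseq. Qed.

Notation ring_term := (rterm (seq bool) 'I_r).
Notation TR := (tr tVar tAdd tMul tOpp tZero tOne tCst).

Lemma ok_mk inp out pend k B n a b v :
  size n <= B -> size a <= B -> size b <= B -> size v <= B ->
  ok (mk inp out pend (nseq k true) n a b v) inp out pend k B.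
Proof. by move=> *; exists n, a, b, v. Qed.

Lemma runs_mk p inp out pend cnt n a b v st' st'' T T' :
  runs p (mk inp out pend cnt n a b v) st' T -> st' = st'' -> T <= T' ->
  runs p (mk inp out pend cnt n a b v) st'' T'.
Proof. exact: runs_to. Qed.

Lemma runs_node inp out pend k B n st st' T :
  ok st inp out (nseq n true ++ false :: pend) k B -> 0 < n <= B ->
  runs dispatch (mk inp out pend (nseq k true) (nseq n true) [::] [::] [::]) st' T ->
  runs body st st' (T + 14 * B + 14).
Proof.
case=> n0 [a0 [b0 [v0 [-> [sn sa sb sv]]]]] /andP[n_gt0 nB] H.
apply: (@runs_to _ _ _ _ ((2 * B + 4 * B + 8) + ((2 * B + 1) + ((2 * B + 1) +
  ((2 * B + 1) + T)))).+1); last by lia.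
  apply: (@runs_iftop _ true); first by case: n n_gt0 {nB H}.
  apply: runs_seq.
    apply: runs_mk; [exact: (runs_popn (n := n) (w := pend))|by rewrite !set_mk|].
    by rewrite /mk /=; lia.
  apply: runs_seq.
    by apply: runs_mk; [exact: runs_clear|rewrite !set_mk|rewrite /mk /=; lia].
  apply: runs_seq.
    by apply: runs_mk; [exact: runs_clear|rewrite !set_mk|rewrite /mk /=; lia].
  apply: runs_seq.
    by apply: runs_mk; [exact: runs_clear|rewrite !set_mk|rewrite /mk /=; lia].
  exact: H.
by [].
Qed.

Lemma runs_binary (T : template s) inp out pend k n B :
  n <= B -> k.+2 <= B -> size (eqs_items T) <= tsize ->
  exists2 st', ok st' inp (rev (enc_eqs (tinst (henv n k k.+1 [::]) T)) ++ out)
      (nseq k true ++ false :: nseq k.+1 true ++ false :: pend) k.+2 B &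
    runs (binary_prog T) (mk inp out pend (nseq k true) (nseq n true) [::] [::] [::]) st'
      ((10 * B + 2) * tsize + 22 * B + 20).
Proof.
move=> nB kB sT; set out' := rev _ ++ out.
exists (mk inp out' (nseq k true ++ false :: nseq k.+1 true ++ false :: pend)
  (nseq k.+2 true) (nseq n true) [::] [::] [::]).
  by apply: ok_mk => //; rewrite size_nseq.
apply: (@runs_to _ _ _ _ ((8 * k + 4) + ((8 * k.+1 + 4) + (((10 * B + 2) * tsize + 1) +
   ((3 * k.+1 + 2) + (3 * k + 2)))))); last by lia.
  apply: runs_seq.
    by apply: runs_mk; [exact: (runs_alloc (k := k))|rewrite !set_mk|].
  apply: runs_seq.
    by apply: runs_mk; [exact: (runs_alloc (k := k.+1))|rewrite !set_mk|].
  apply: runs_seq.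
    apply: (runs_emitT (env := henv n k k.+1 [::])) => //.
    by apply: size_hole => //; lia.
  apply: runs_seq.
    by apply: runs_mk; [exact: (runs_pushp (k := k.+1))|rewrite !set_mk|].
  by apply: runs_mk; [exact: (runs_pushp (k := k))|rewrite !set_mk|].
by [].
Qed.

Lemma loops_binary (T : template s) b inp out pend k n B st :
  ok st ([:: true; false; b] ++ inp) out (nseq n true ++ false :: pend) k B ->
  0 < n <= B -> k.+2 <= B -> T = (if b then tMul else tAdd) ->
  exists2 st', ok st' inp (rev (enc_eqs (tinst (henv n k k.+1 [::]) T)) ++ out)
      (nseq k true ++ false :: nseq k.+1 true ++ false :: pend) k.+2 B &
    loops st st' (cost B).
Proof.
move=> st_ok nB kB TE.
have [||st' st'_ok H] := @runs_binary T inp out pend k n B _ kB.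
- by case/andP: nB.
- by rewrite TE; apply: tsizeP; rewrite mem_cat; case: b {st_ok TE};
    rewrite /= !inE !eqxx ?orbT.
exists st' => //.
apply: (@loops_leq _ _ ((10 * B + 2) * tsize + 22 * B + 20 + 6 + 14 * B + 14).+1);
  last by rewrite /cost; lia.
apply: loops_body; first by case: st_ok => ? [? [? [? [-> _]]]].
apply: runs_node st_ok nB _.
rewrite (_ : _ + 6 = ((10 * B + 2) * tsize + 22 * B + 20).+2.+4); last by lia.
do 2 (apply: runs_read; [by []|rewrite set_mk]).
apply: (@runs_read _ b); [by []|rewrite set_mk].
by rewrite -(fun_if binary_prog) -TE.
Qed.

Lemma runs_emitT_ok (T : template s) inp out pend k n v B :
  n <= B -> size v <= B -> size (eqs_items T) <= tsize ->
  exists2 st', ok st' inp (rev (enc_eqs (tinst (henv n 0 0 v) T)) ++ out) pend k B &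
    runs (emitT T) (mk inp out pend (nseq k true) (nseq n true) [::] [::] v) st'
      ((10 * B + 2) * tsize + 1).
Proof.
move=> nB vB sT.
exists (mk inp (rev (enc_eqs (tinst (henv n 0 0 v) T)) ++ out) pend (nseq k true)
  (nseq n true) [::] [::] v); first by apply: ok_mk; rewrite ?size_nseq.
apply: (runs_emitT (env := henv n 0 0 v)) => //.
exact: size_hole.
Qed.

Lemma loops_node inp inp' out out' pend pend' k k' n B T (st : store) :
  ok st inp out (nseq n true ++ false :: pend) k B -> 0 < n <= B -> inp <> [::] ->
  (exists2 st', ok st' inp' out' pend' k' B &
     runs dispatch (mk inp out pend (nseq k true) (nseq n true) [::] [::] [::]) st' T) ->
  T + 14 * B + 15 <= cost B ->
  exists2 st', ok st' inp' out' pend' k' B & loops st st' (cost B).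
Proof.
move=> st_ok nB inp0 [st' st'_ok H] TC; exists st' => //.
apply: (@loops_leq _ _ (T + 14 * B + 14).+1); last by lia.
apply: loops_body; first by case: (st_ok) => ? [? [? [? [-> _]]]].
exact: runs_node st_ok nB H.
Qed.

Ltac in_tsizes := apply: tsizeP; rewrite mem_cat /= !inE ?eqxx ?orbT.

(** Each node costs one pass and consumes at least one bit of input, so the length of the code
    bounds the number of passes. *)
Lemma loops_term (t : ring_term) st inp out pend k n B :
  ok st (enc_rterm t ++ inp) out (nseq n true ++ false :: pend) k B ->
  0 < n <= B -> 0 < k -> k + fresh t <= B -> size (enc_rterm t) <= B ->
  exists2 st', ok st' inp (rev (enc_eqs (TR t n k)) ++ out) pend (k + fresh t) B &
    loops st st' (size (enc_rterm t) * cost B).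
Proof.
have leaf st0 st1 c m : 0 < m -> c <= cost B -> loops st0 st1 c ->
    loops st0 st1 (m * cost B).
  move=> m0 cc /loops_leq; apply; apply: leq_trans cc _.
  by rewrite leq_pmull.
elim: t st inp out pend k n => [v|c|||t1 IH1 t2 IH2|t1 IH1 t2 IH2|t1 IH1]
  st inp out pend k n st_ok nB k0 kB szB; have /andP[n0 nB'] := nB.
- have vB : size v <= B.
    apply: leq_trans szB; rewrite /= /enc_var size_cat /= -/(dbl v).
    suff : size v <= size (dbl v) by lia.
    by elim: (v) => //= b w; rewrite /dbl /=; lia.
  rewrite /= addn0.
  have [st' ok' L'] : exists2 st', ok st' inp (rev (enc_eqs (TR (RVar _ v) n k)) ++ out)
      pend k B & loops st st' (cost B).
    apply: (loops_node st_ok nB (T := (8 * B + 8 + ((10 * B + 2) * tsize + 1)).+2.+4)) => //;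
      last by rewrite /cost; lia.
    have [|||st' ok' H] := @runs_emitT_ok tVar inp out pend k n (rev v) B.
    + by [].
    + by rewrite size_rev.
    + by in_tsizes.
    exists st' => //.
    do 3 (apply: runs_read; [by []|rewrite set_mk]).
    apply: runs_seq; last exact: H.
    by apply: runs_mk; [exact: (runs_readv (v := v) (w := inp))|rewrite !set_mk|
      rewrite /=; lia].
  by exists st' => //; apply: leaf L'.
- rewrite /= addn0.
  have [st' ok' L'] : exists2 st', ok st' inp (rev (enc_eqs (TR (RCst _ c) n k)) ++ out)
      pend k B & loops st st' (cost B).
    apply: (loops_node st_ok nB
      (T := ((10 * B + 2) * tsize + 1 + 2 * c.+1).+2.+4)) => //;
      last by rewrite /cost; have := ltn_ord c; lia.
    have [|||st' ok' H] := @runs_emitT_ok (tCst c) inp out pend k n [::] B.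
    + by [].
    + by [].
    + by apply: tsizeP; rewrite mem_cat (map_f (fun i => size (eqs_items (tCst i))))
        ?orbT ?mem_enum.
    exists st' => //.
    do 3 (apply: runs_read; [by []|rewrite set_mk]).
    apply: (runs_readc (w := inp)).
    + by rewrite -[LHS]/((nseq c true ++ [:: false]) ++ inp) -catA.
    + by rewrite size_map size_enum_ord.
    + by rewrite (nth_map c) ?size_enum_ord // nth_ord_enum set_mk.
  by exists st' => //; apply: leaf L'.
- rewrite /= addn0.
  have [st' ok' L'] : exists2 st', ok st' inp (rev (enc_eqs (TR (RZero _ _) n k)) ++ out)
      pend k B & loops st st' (cost B).
    apply: (loops_node st_ok nB (T := ((10 * B + 2) * tsize + 1).+2.+4)) => //;
      last by rewrite /cost; lia.
    have [|||st' ok' H] := @runs_emitT_ok tZero inp out pend k n [::] B => //.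
      by in_tsizes.
    exists st' => //.
    by do 3 (apply: runs_read; [by []|rewrite set_mk]).
  by exists st' => //; apply: leaf L'.
- rewrite /= addn0.
  have [st' ok' L'] : exists2 st', ok st' inp (rev (enc_eqs (TR (ROne _ _) n k)) ++ out)
      pend k B & loops st st' (cost B).
    apply: (loops_node st_ok nB (T := ((10 * B + 2) * tsize + 1).+2.+4)) => //;
      last by rewrite /cost; lia.
    have [|||st' ok' H] := @runs_emitT_ok tOne inp out pend k n [::] B => //.
      by in_tsizes.
    exists st' => //.
    by do 3 (apply: runs_read; [by []|rewrite set_mk]).
  by exists st' => //; apply: leaf L'.
- move: st_ok kB szB; rewrite /= !size_cat => st_ok kB szB.
  have [||st1 ok1 L1] := @loops_binary tAdd false (enc_rterm t1 ++ enc_rterm t2 ++ inp)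
     out pend k n B st _ nB _ erefl.
  + by move: st_ok; rewrite -!catA.
  + by lia.
  have [||||st2 ok2 L2] := IH1 _ _ _ _ _ _ ok1; try lia.
  have [||||st3 ok3 L3] := IH2 _ _ _ _ _ _ ok2; try lia.
  exists st3.
    move: ok3; rewrite /= !enc_eqs_cat !rev_cat !catA.
    by rewrite (_ : k + (2 + _ + _) = k.+2 + fresh t1 + fresh t2) //; lia.
  apply: loops_leq (loops_trans L1 (loops_trans L2 L3)) _; lia.
- move: st_ok kB szB; rewrite /= !size_cat => st_ok kB szB.
  have [||st1 ok1 L1] := @loops_binary tMul true (enc_rterm t1 ++ enc_rterm t2 ++ inp)
     out pend k n B st _ nB _ erefl.
  + by move: st_ok; rewrite -!catA.
  + by lia.
  have [||||st2 ok2 L2] := IH1 _ _ _ _ _ _ ok1; try lia.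
  have [||||st3 ok3 L3] := IH2 _ _ _ _ _ _ ok2; try lia.
  exists st3.
    move: ok3; rewrite /= !enc_eqs_cat !rev_cat !catA.
    by rewrite (_ : k + (2 + _ + _) = k.+2 + fresh t1 + fresh t2) //; lia.
  apply: loops_leq (loops_trans L1 (loops_trans L2 L3)) _; lia.
- move: st_ok kB szB; rewrite /= => st_ok kB szB.
  have [st1 ok1 L1] : exists2 st', ok st' (enc_rterm t1 ++ inp)
      (rev (enc_eqs (tinst (henv n k 0 [::]) tOpp)) ++ out)
      (nseq k true ++ false :: pend) k.+1 B & loops st st' (cost B).
    apply: (loops_node st_ok nB (T := (8 * k + 4 + (((10 * B + 2) * tsize + 1) +
       (3 * k + 2))).+2.+4)) => //; last by rewrite /cost; lia.
    exists (mk (enc_rterm t1 ++ inp) (rev (enc_eqs (tinst (henv n k 0 [::]) tOpp)) ++ out)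
      (nseq k true ++ false :: pend) (nseq k.+1 true) (nseq n true) [::] [::] [::]).
      by apply: ok_mk; rewrite ?size_nseq.
    do 3 (apply: runs_read; [by []|rewrite set_mk]).
    apply: runs_seq.
      by apply: runs_mk; [exact: (runs_alloc (k := k))|rewrite !set_mk|].
    apply: runs_seq.
      apply: (runs_emitT (env := henv n k 0 [::])).
        by apply: size_hole => //; lia.
      by in_tsizes.
    by apply: runs_mk; [exact: (runs_pushp (k := k))|rewrite !set_mk|].
  have [||||st2 ok2 L2] := IH1 _ _ _ _ _ _ ok1; try lia.
  exists st2.
    move: ok2; rewrite /= !enc_eqs_cat !rev_cat !catA.
    by rewrite (_ : k + (1 + _) = k.+1 + fresh t1) //; lia.
  apply: loops_leq (loops_trans L1 L2) _; lia.
Qed.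

Notation TRS := (tr_sys tVar tAdd tMul tOpp tZero tOne tEq tCst).
Notation TRE := (tr_eq tVar tAdd tMul tOpp tZero tOne tEq tCst).

Lemma loops_top inp inp' out out' pend' k k' B w T (st : store) :
  ok st inp out [::] k B -> inp <> [::] ->
  (forall n a b v, size n <= B -> size a <= B -> size b <= B -> size v <= B ->
   exists2 st', ok st' inp' out' pend' k' B &
     runs top (mk inp out [::] (nseq k true) n a b v) st' T) ->
  T.+2 <= w -> exists2 st', ok st' inp' out' pend' k' B & loops st st' w.
Proof.
move=> [n [a [b [v [-> [sn sa sb sv]]]]]] inp0 H Tw.
have [st' ok' Hr] := H n a b v sn sa sb sv; exists st' => //.
apply: (loops_leq (T1 := T.+2)) => //; apply: loops_body => //.
exact: (@runs_iftop _ false).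
Qed.

(** No more names are created than bits are read, so the unary numbers on the stacks stay within the
    length of the input up to a constant. *)
Lemma fresh_size (t : ring_term) : fresh t + 3 <= size (enc_rterm t).
Proof. by elim: t => //= [t1 IH1 t2 IH2|t1 IH1 t2 IH2|t1 IH1]; rewrite ?size_cat; lia. Qed.

Lemma loops_eq (e : ring_term * ring_term) st inp out k B :
  ok st ((true :: enc_rterm e.1 ++ enc_rterm e.2) ++ inp) out [::] k B ->
  0 < k -> k + fresh_eq e <= B -> size (enc_rterm e.1 ++ enc_rterm e.2) < B ->
  exists2 st', ok st' inp (rev (enc_eqs (TRE e k)) ++ out) [::] (k + fresh_eq e) B &
    loops st st' ((size (enc_rterm e.1 ++ enc_rterm e.2)).+1 * cost B).
Proof.
rewrite /fresh_eq size_cat => st_ok k0 kB szB.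
have [st1 ok1 L1] : exists2 st',
    ok st' (enc_rterm e.1 ++ enc_rterm e.2 ++ inp)
      (rev (enc_eqs (tinst (henv k k.+1 k.+2 [::]) tEq)) ++ out)
      (nseq k.+1 true ++ false :: nseq k.+2 true ++ false :: [::]) k.+3 B &
    loops st st' (cost B).
  apply: (loops_top st_ok (T := ((2 * B + 8 * k + 4) + ((2 * B + 8 * k.+1 + 4) +
     ((2 * B + 8 * k.+2 + 4) + ((2 * B + 1) + (((10 * B + 2) * tsize + 1) +
     ((3 * k.+2 + 2) + (3 * k.+1 + 2))))))).+2)) => //; last by rewrite /cost; lia.
  move=> n a b v sn sa sb sv.
  exists (mk (enc_rterm e.1 ++ enc_rterm e.2 ++ inp)
     (rev (enc_eqs (tinst (henv k k.+1 k.+2 [::]) tEq)) ++ out)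
     (nseq k.+1 true ++ false :: nseq k.+2 true ++ false :: [::]) (nseq k.+3 true)
     (nseq k true) [::] [::] [::]).
    by apply: ok_mk; rewrite ?size_nseq //; lia.
  apply: (@runs_read _ true (enc_rterm e.1 ++ enc_rterm e.2 ++ inp)).
    by rewrite catA.
  rewrite set_mk.
  apply: runs_seq.
    by apply: runs_mk; [exact: (runs_alloc (k := k))|rewrite !set_mk|rewrite /mk /=; lia].
  apply: runs_seq.
    by apply: runs_mk; [exact: (runs_alloc (k := k.+1))|rewrite !set_mk|rewrite /mk /=; lia].
  apply: runs_seq.
    by apply: runs_mk; [exact: (runs_alloc (k := k.+2))|rewrite !set_mk|rewrite /mk /=; lia].
  apply: runs_seq.
    by apply: runs_mk; [exact: runs_clear|rewrite !set_mk|rewrite /mk /=; lia].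
  apply: runs_seq.
    apply: (runs_emitT (env := henv k k.+1 k.+2 [::])).
      by apply: size_hole => //; lia.
    by in_tsizes.
  apply: runs_seq.
    by apply: runs_mk; [exact: (runs_pushp (k := k.+2))|rewrite !set_mk|].
  by apply: runs_mk; [exact: (runs_pushp (k := k.+1))|rewrite !set_mk|].
have [||||st2 ok2 L2] := loops_term ok1; try lia.
have [||||st3 ok3 L3] := loops_term ok2; try lia.
exists st3.
  move: ok3; rewrite /tr_eq !enc_eqs_cat !rev_cat !catA.
  by rewrite (_ : k + (3 + _ + _) = k.+3 + fresh e.1 + fresh e.2) //; lia.
apply: loops_leq (loops_trans L1 (loops_trans L2 L3)) _; lia.
Qed.

Definition enc_req (S : rsystem (seq bool) 'I_r) : seq bool :=
  flatten [seq true :: enc_rterm e.1 ++ enc_rterm e.2 | e <- S].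

Lemma loops_sys (S : rsystem (seq bool) 'I_r) st inp out k B :
  ok st (enc_req S ++ inp) out [::] k B -> 0 < k -> k + size (enc_req S) <= B ->
  exists2 st', exists k', ok st' inp (rev (enc_eqs (TRS S k)) ++ out) [::] k' B &
    loops st st' (size (enc_req S) * cost B).
Proof.
elim: S st out k => [|e S IH] st out k st_ok k0 kB.
  by exists st; [exists k|].
have {}st_ok : ok st ((true :: enc_rterm e.1 ++ enc_rterm e.2) ++ (enc_req S ++ inp))
    out [::] k B by move: st_ok; rewrite /enc_req /= -!catA.
move: kB; rewrite /enc_req /= -/(enc_req S) !size_cat => kB.
have s1 := fresh_size e.1; have s2 := fresh_size e.2.
have [|||st1 ok1 L1] := loops_eq st_ok; rewrite /fresh_eq ?size_cat; try lia.
have [||st2 [k' ok2] L2] := IH _ _ _ ok1; rewrite /fresh_eq; try lia.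
exists st2; first by exists k'; move: ok2; rewrite enc_eqs_cat rev_cat catA.
move: L1; rewrite size_cat => L1.
apply: loops_leq (loops_trans L1 L2) _; lia.
Qed.

Lemma translator_poly :
  poly_time (enc_system (@enc_rterm r)) (enc_system (@enc_gterm s)) (fun S => TRS S 1).
Proof.
pose K := 22 * tsize + 180 + 2 * r.
(* With L the input length, [K] satisfies [cost B <= K * L.+1], so the loop takes T <= 2 K L^2 + 1
   steps. Reversing costs four units per output bit, and there are at most 1 + T bits: the total 5
   (1 + T) + 1 is at most 10 K L^2 + 11. *)
exists translator, (10 * K + 11), 2 => S.
set L := size _; pose B := L.+2.
pose st0 := mk (enc_req S ++ [:: false]) [::] [::] [:: true] [::] [::] [::] [::].
have LE : L = size (enc_req S) + 1 by rewrite /L /enc_system size_cat.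
have ok0 : ok st0 (enc_req S ++ [:: false]) [::] [::] 1 B.
  by exists [::], [::], [::], [::].
have [||st1 [k1 ok1] L1] := loops_sys ok0 => //.
  by rewrite /B LE; lia.
have [|||st2 ok2 L2] := @loops_top [:: false] [::] (rev (enc_eqs (TRS S 1)) ++ [::])
   (false :: (rev (enc_eqs (TRS S 1)) ++ [::])) [::] k1 k1 B (cost B) 3 st1 ok1.
- by [].
- move=> n a b v sn sa sb sv.
  exists (mk [::] (false :: (rev (enc_eqs (TRS S 1)) ++ [::])) [::] (nseq k1 true) n a b v).
    exact: ok_mk.
  apply: (@runs_read _ false [::]) => //; rewrite set_mk.
  by apply: runs_mk; [exact: runs_push|rewrite set_mk|].
- by rewrite /cost; lia.
have stop2 : runs main st2 st2 1.
  by apply: runs_stop; case: ok2 => ? [? [? [? [-> _]]]].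
have {L1 L2 stop2} := loops_trans L1 L2 stop2; set T := _ + 1 => Hm.
have [t1 E1 tT1] : runs (Seq (Push 3 true) main) (input_store (enc_system (@enc_rterm r) S))
    st2 (1 + T).
  apply: runs_seq Hm; apply: runs_to; first exact: runs_push.
    rewrite (_ : input_store _ = mk (enc_req S ++ [:: false]) [::] [::] [::] [::] [::] [::] [::]).
      by rewrite set_mk.
    by apply/funext => -[|[|[|[|[|[|[|[|?]]]]]]]] //=; rewrite /mk /= nth_nil.
  by [].
have out2 : st2 1 = false :: (rev (enc_eqs (TRS S 1)) ++ [::]).
  by case: ok2 => ? [? [? [? [-> _]]]].
have sz2 := exec_size E1 1; rewrite /= add0n out2 in sz2.
have [t2 E2 tT2] := @runs_mv st2 1 0 isT.
(* The output length was bounded from the run of the first two programs; that run is split again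
   because [translator] associates them to the right. *)
inversion E1 as [| | |p q s1' s2' s3' u1 u2 Hp Hq| | | |]; subst.
exists (u1 + (u2 + t2)), (set_stack (set_stack st2 1 [::]) 0 (rev (st2 1) ++ st2 0)); split.
- by apply: ExecSeq Hp _; apply: ExecSeq Hq E2.
- rewrite set_stack_same out2 cats0 rev_cons revK.
  case: ok2 => ? [? [? [? [-> _]]]].
  by rewrite /mk /= cats0 -cats1.
- have costB : cost B <= K * L.+1 by rewrite /cost /B /K; nia.
  have TE : T = L * cost B + 1 by rewrite /T LE; nia.
  have sz_t2 : u1 + (u2 + t2) <= 5 * (1 + T) + 1.
    by clearbody T; move: tT1 tT2 sz2; rewrite out2 /=; lia.
  apply: leq_trans sz_t2 _; rewrite TE -mulnn.
  have H : L * cost B <= L * (K * L.+1) by rewrite leq_mul2l costB orbT.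
  have L0 : 0 < L by rewrite LE addn1.
  nia.
Qed.

End Program.

(** * Templates from an e-interpretation *)

Section Reduction.
Variables (G : groupType) (s : nat) (g : 'I_s -> G).
Hypothesis gen : generates_group g.

(** The coefficients of the e-definitions are arbitrary but fixed elements, so a word for each of
    them can be compiled into the templates. *)
Lemma word_exists (c : G) : exists t : gterm void 'I_s, geval g (of_void G) t = c.
Proof.
have sub : (generated (range g) `<=`
    [set c | exists t : gterm void 'I_s, geval g (of_void G) t = c])%classic.
  apply: smallest_sub.
    split=> [|x y [t1 <-] [t2 <-]|x [t1 <-]].
    - by exists (GOne _ _).
    - by exists (GMul t1 t2).
    - by exists (GInv t1).
  by move=> _ [i _ <-]; exists (GCst _ i).
by apply: sub; rewrite gen.
Qed.

Definition word (V : Type) (c : G) : gterm V 'I_s :=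
  gsubst (of_void _) (fun i => GCst V i) (projT1 (cid (word_exists c))).

Lemma geval_word V (rho : V -> G) c : geval g rho (word V c) = c.
Proof.
rewrite /word geval_subst; case: cid => t /= <-.
by apply: eq_geval => // -[].
Qed.

Definition tpl (n k : nat) (S : gsystem ('I_n + 'I_k) G) (b : 'I_n -> gterm tvar 'I_s) :
    template s :=
  gsys_subst (fun v => match v with inl i => b i | inr j => GVar _ (inr (val j)) end)
    (fun c => word tvar c) S.

Lemma tpl_holds n k (S : gsystem ('I_n + 'I_k) G) b x (v : 'I_n -> G) :
  (forall y i, geval g (tvar_val x y) (b i) = v i) ->
  tholds g (tpl S b) x <->
  exists y : k.-tuple G, gsatisfies id (tuple_valuation [tuple v i | i < n] y) S.
Proof.
move=> bv; rewrite /tholds /tpl; split=> [[y]|[y H]].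
  rewrite gsatisfies_subst => H; exists [tuple y (val j) | j < k]; move: H.
  rewrite (@eq_gsatisfies _ _ _ _ id _
    (tuple_valuation [tuple v i | i < n] [tuple y (val j) | j < k])) //.
    by move=> c; apply: geval_word.
  by case=> i /=; rewrite ?bv tnth_mktuple.
exists (nth 1%g y); rewrite gsatisfies_subst; move: H.
rewrite (@eq_gsatisfies _ _ _ _ id _ (tuple_valuation [tuple v i | i < n] y)) //.
  by move=> c; apply: geval_word.
by case=> i /=; rewrite ?bv ?tnth_mktuple // -tnth_nth.
Qed.

Variables (R : pzRingType) (r : nat) (o : 'I_r -> R) (m : nat).

Definition block (h : hole) (i : 'I_m) : gterm tvar 'I_s := GVar _ (inl (h, val i)).
Definition cblock (x : m.-tuple G) (i : 'I_m) : gterm tvar 'I_s := word tvar (tnth x i).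

Definition cat_fun (T : Type) n1 n2 (f1 : 'I_n1 -> T) (f2 : 'I_n2 -> T)
    (i : 'I_(n1 + n2)) : T :=
  match fintype.split i with inl j => f1 j | inr j => f2 j end.

Lemma cat_fun_tuple (T : Type) n1 n2 (f1 : 'I_n1 -> T) (f2 : 'I_n2 -> T) :
  [tuple cat_fun f1 f2 i | i < n1 + n2] = [tuple of [tuple f1 i | i < n1] ++
    [tuple f2 i | i < n2]].
Proof.
apply/tuple_cat_inv; split; apply/eq_from_tnth => i; rewrite !tnth_mktuple /cat_fun.
  by rewrite (unsplitK (inl i)).
by rewrite (unsplitK (inr i)).
Qed.

Definition is_block (b : 'I_m -> gterm tvar 'I_s)
    (f : (hole -> nat -> G) -> m.-tuple G) : Prop :=
  forall x y i, geval g (tvar_val x y) (b i) = tnth (f x) i.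

Lemma is_block_hole h : is_block (block h) (fun x => [tuple x h (val i) | i < m]).
Proof. by move=> x y i; rewrite tnth_mktuple. Qed.

Lemma is_block_cst c : is_block (cblock c) (fun=> c).
Proof. by move=> x y i; apply: geval_word. Qed.

Lemma cat_tuple_inj (T : Type) n1 n2 (x x' : n1.-tuple T) (y y' : n2.-tuple T) :
  [tuple of x ++ y] = [tuple of x' ++ y'] -> x = x' /\ y = y'.
Proof.
move=> e; split; apply/eq_from_tnth => i.
  by rewrite -(tnth_lshift x y) e tnth_lshift.
by rewrite -(tnth_rshift x y) e tnth_rshift.
Qed.

Lemma tuple_tnth (T : Type) n (x : n.-tuple T) : [tuple tnth x i | i < n] = x.
Proof. by apply/eq_from_tnth => i; rewrite tnth_mktuple. Qed.

Variables (X : set (m.-tuple G)) (phi : m.-tuple G -> R).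

Lemma binary_template : e_definable [set t : (m + m).-tuple G | exists x y,
    [/\ X x, X y, t = [tuple of x ++ y] & phi x = phi y]] ->
  exists T : ('I_m -> gterm tvar 'I_s) -> ('I_m -> gterm tvar 'I_s) -> template s,
    forall b1 b2 f1 f2, is_block b1 f1 -> is_block b2 f2 -> forall x,
      tholds g (T b1 b2) x <-> [/\ X (f1 x), X (f2 x) & phi (f1 x) = phi (f2 x)].
Proof.
case=> k [S HS]; exists (fun b1 b2 => tpl S (cat_fun b1 b2)) => b1 b2 f1 f2 B1 B2 x.
rewrite (@tpl_holds _ _ _ _ _ (cat_fun (tnth (f1 x)) (tnth (f2 x)))).
  rewrite -HS cat_fun_tuple !tuple_tnth; split=> [[x1 [x2 [X1 X2]]]|[X1 X2 e]].
    by case/cat_tuple_inj=> -> ->.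
  by exists (f1 x), (f2 x).
by move=> y i; rewrite /cat_fun; case: fintype.split.
Qed.

Lemma ternary_template (op : R -> R -> R) :
  e_definable [set t : (m + (m + m)).-tuple G | exists x y z,
    [/\ X x, X y, X z, t = [tuple of x ++ (y ++ z)] & op (phi x) (phi y) = phi z]] ->
  exists T : ('I_m -> gterm tvar 'I_s) -> ('I_m -> gterm tvar 'I_s) ->
      ('I_m -> gterm tvar 'I_s) -> template s,
    forall b1 b2 b3 f1 f2 f3, is_block b1 f1 -> is_block b2 f2 -> is_block b3 f3 ->
      forall x, tholds g (T b1 b2 b3) x <->
        [/\ X (f1 x), X (f2 x), X (f3 x) & op (phi (f1 x)) (phi (f2 x)) = phi (f3 x)].
Proof.
case=> k [S HS].
exists (fun b1 b2 b3 => tpl S (cat_fun b1 (cat_fun b2 b3))) => b1 b2 b3 f1 f2 f3 B1 B2 B3 x.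
rewrite (@tpl_holds _ _ _ _ _
  (cat_fun (tnth (f1 x)) (cat_fun (tnth (f2 x)) (tnth (f3 x))))).
  rewrite -HS !cat_fun_tuple !tuple_tnth; split=> [[x1 [x2 [x3 [X1 X2 X3]]]]|[X1 X2 X3 e]].
    by case/cat_tuple_inj=> -> /cat_tuple_inj[-> ->].
  by exists (f1 x), (f2 x), (f3 x).
move=> y i; rewrite /cat_fun; case: fintype.split => // j; by case: fintype.split.
Qed.

End Reduction.

Lemma e_interpretable_reducible (R : pzRingType) (G : groupType) (r s : nat)
    (o : 'I_r -> R) (g : 'I_s -> G) :
  e_interpretable R G -> generates_group g -> diophantine_reducible o g.
Proof.
case=> m [X [phi [_ surj deq dadd dmul]]] gen.
have [TE HE] := binary_template gen deq.
have [TA HTA] := ternary_template (op := +%R) gen dadd.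
have [TM HM] := ternary_template (op := *%R) gen dmul.
have /choice[e He] : forall c : R, exists x, X x /\ phi x = c.
  by move=> c; have [x] := surj c; exists x.
pose bl := @block s m.
pose cb := cblock gen (m := m).
pose tVar := TE (bl HN) (bl HV).
(* Constants are tested by the formula for equality against a fixed code, written out in words. *)
pose tCst i := TE (bl HN) (cb (e (o i))).
pose tZero := TE (bl HN) (cb (e 0%R)).
pose tOne := TE (bl HN) (cb (e 1%R)).
pose tEq := TE (bl HA) (bl HB).
pose tAdd := TA (bl HA) (bl HB) (bl HN).
pose tMul := TM (bl HA) (bl HB) (bl HN).
(* The opposite comes from the graph of addition: child plus node equals a fixed code of zero. *)
pose tOpp := TA (bl HA) (bl HN) (cb (e 0%R)).
pose D (a : nat -> G) := X [tuple a (val i) | i < m].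
pose ph (a : nat -> G) := phi [tuple a (val i) | i < m].
have surjD c : exists a, D a /\ ph a = c.
  have [Xe <-] := He c; exists (nth 1%g (e c)); rewrite /D /ph.
  rewrite (_ : [tuple _ | _ < _] = e c) //.
  by apply/eq_from_tnth => i; rewrite tnth_mktuple -tnth_nth.
have Bh h := @is_block_hole G s g m h.
have Bc c := @is_block_cst G s g gen m c.
exists (fun S => tr_sys tVar tAdd tMul tOpp tZero tOne tEq tCst S 1).
  exact: translator_poly.
move=> S; apply: (tr_sys_solvable (D := D) (phi := ph)) => //.
- by move=> x; apply: (HE _ _ _ _ (Bh _) (Bh _)).
- move=> c x; rewrite (HE _ _ _ _ (Bh HN) (Bc _)); have [Xe ->] := He (o c).
  by split=> [[]|[]].
- move=> x; rewrite (HE _ _ _ _ (Bh HN) (Bc _)); have [Xe ->] := He 0%R.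
  by split=> [[]|[]].
- move=> x; rewrite (HE _ _ _ _ (Bh HN) (Bc _)); have [Xe ->] := He 1%R.
  by split=> [[]|[]].
- move=> x; rewrite (HTA _ _ _ _ _ _ (Bh _) (Bh _) (Bh _)).
  by split=> -[].
- move=> x; rewrite (HM _ _ _ _ _ _ (Bh _) (Bh _) (Bh _)).
  by split=> -[].
- move=> x; rewrite (HTA _ _ _ _ _ _ (Bh _) (Bh _) (Bc _)).
  have [Xe ->] := He 0%R; split=> [[XA XN _ /eqP]|[XN XA eN]].
    by rewrite addrC addr_eq0 => /eqP.
  by split=> //; rewrite -/(ph _) -/(ph _) eN subrr.
- by move=> x; apply: (HE _ _ _ _ (Bh _) (Bh _)).
Qed.

(** * Lattices and finitely generated abelian groups *)

Section Lattices.
Local Open Scope ring_scope.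

Definition zclosed (V : zmodType) (L : set V) : Prop :=
  L 0 /\ forall x y, L x -> L y -> L (x - y).

Section Zclosed.
Variables (V : zmodType) (L : set V).
Hypothesis HL : zclosed L.

Lemma zclosed0 : L 0. Proof. by case: HL. Qed.

Lemma zclosedB x y : L x -> L y -> L (x - y). Proof. by case: HL => _; apply. Qed.

Lemma zclosedN x : L x -> L (- x).
Proof. by move=> Lx; rewrite -sub0r; apply: zclosedB => //; apply: zclosed0. Qed.

Lemma zclosedD x y : L x -> L y -> L (x + y).
Proof. by move=> Lx Ly; rewrite -(opprK y); apply/zclosedB/zclosedN. Qed.

Lemma zclosedMn x n : L x -> L (x *+ n).
Proof.
move=> Lx; elim: n => [|n IH]; first exact: zclosed0.
by rewrite mulrS; apply: zclosedD.
Qed.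

Lemma zclosedMz x z : L x -> L (x *~ z).
Proof. by case: z => n Lx; [|apply: zclosedN]; apply: zclosedMn. Qed.

Lemma zclosed_sum (I : finType) (F : I -> V) : (forall i, L (F i)) -> L (\sum_i F i).
Proof. by move=> LF; apply: big_ind => //; [exact: zclosed0|exact: zclosedD]. Qed.

End Zclosed.

Lemma scale_intE (V : lmodType int) (z : int) (x : V) : z *: x = x *~ z.
Proof. by rewrite -{1}[z]intz scaler_int. Qed.

Lemma rV_int_sum p (c : 'rV[int]_p) : c = \sum_i delta_mx 0 i *~ c 0 i.
Proof.
by rewrite [LHS]row_sum_delta; apply: eq_bigr => i _; rewrite scale_intE.
Qed.

Lemma rV_int_ind p (P : set 'rV[int]_p) :
  zclosed P -> (forall i, P (delta_mx 0 i)) -> forall x, P x.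
Proof.
move=> zP Pd x; rewrite (rV_int_sum x); apply: zclosed_sum => // i.
exact: zclosedMz.
Qed.

(** Echelon form: a vector of [L] with least positive first coordinate is put before a basis of the
    sublattice where that coordinate vanishes, and division with remainder reduces every vector to
    this sublattice. *)
Lemma lattice_basis n (L : set 'rV[int]_n) : zclosed L ->
  exists p (E : 'M[int]_(p, n)), (forall x, L x <-> exists c : 'rV_p, x = c *m E) /\
    (forall c : 'rV_p, c *m E = 0 -> c = 0).
Proof.
elim: n L => [|n IH] L HL.
  exists 0, 0; split=> [x|c _]; last by rewrite [c]thinmx0.
  rewrite [x]thinmx0; split=> _; last exact: zclosed0.
  by exists 0; rewrite mulmx0.
rewrite -[n.+1]/(1 + n)%N in L HL *.
pose L' := [set y : 'rV[int]_n | L (row_mx 0 y)]%classic.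
have HL' : zclosed L'.
  split; first by rewrite /L' /= row_mx0; apply: zclosed0.
  move=> x y Lx Ly; rewrite /L' /= -[X in row_mx X _](subr0 0) -add_row_mx.
  by rewrite -opp_row_mx; apply: zclosedB.
have [p [E [LE injE]]] := IH L' HL'.
have [all0|] := pselect (forall x, L x -> lsubmx x = 0).
  exists p, (row_mx 0 E); split=> [x|c]; last first.
    by rewrite mul_mx_row -[0 in RHS]row_mx0 => /eq_row_mx[_ /injE].
  split=> [Lx|[c ->]].
    have : L' (rsubmx x) by rewrite /L' /= -(all0 _ Lx) hsubmxK.
    move=> /LE[c ec]; exists c; rewrite mul_mx_row mulmx0 -ec -(all0 _ Lx).
    by rewrite hsubmxK.
  by rewrite mul_mx_row mulmx0; apply/LE; exists c.
move=> /existsNP[x0 /not_implyP[Lx0 /eqP x0N]].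
pose P (d : nat) := `[< (0 < d)%N /\ exists2 x, L x & x 0 (lshift n ord0) = d%:Z >].
have exP : exists d, P d.
  pose a0 := x0 0 (lshift n ord0).
  exists `|a0|%N; apply/asboolP; split.
    rewrite absz_gt0; apply: contra x0N => /eqP x00; apply/eqP/rowP => i.
    by rewrite ord1 !mxE.
  case: (ltrgtP a0 0) => h.
  - exists (- x0); first exact: zclosedN.
    by rewrite mxE -/a0; lia.
  - by exists x0; rewrite // -/a0; lia.
  - by exists x0; rewrite // -/a0 h.
have [d /asboolP[d_gt0 [e Le ed]] dmin] := ex_minnP exP.
exists p.+1, (col_mx e (row_mx 0 E) : 'M_(1 + p, 1 + n)); split=> [x|]; last first.
  rewrite -[p.+1]/(1 + p)%N => c; rewrite -[c]hsubmxK mul_row_col mul_mx_row mulmx0.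
  rewrite -[e]hsubmxK mul_mx_row add_row_mx addr0 -[0 in RHS]row_mx0.
  move=> /eq_row_mx[/rowP /(_ 0)].
  rewrite !mxE big_ord1 !mxE ed => /eqP; rewrite mulf_eq0 => /orP[]; last by lia.
  move=> /eqP c0; have -> : lsubmx c = 0 by apply/rowP => i; rewrite ord1 !mxE.
  by rewrite mul0mx add0r => /injE ->; rewrite row_mx0.
split=> [Lx|[c]]; last first.
  rewrite -[p.+1]/(1 + p)%N in c *; move=> ->; rewrite -[c]hsubmxK mul_row_col.
  apply: zclosedD => //.
    rewrite [lsubmx c]mx11_scalar mul_scalar_mx [_ *: e]scale_intE.
    exact: zclosedMz.
  by rewrite mul_mx_row mulmx0; apply/LE; exists (rsubmx c).
pose a := x 0 (lshift n ord0); pose q := (a %/ d%:Z)%Z.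
pose y := x - e *~ q.
have Ly : L y by apply: zclosedB => //; apply: zclosedMz.
have y0 : y 0 (lshift n ord0) = (a %% d%:Z)%Z.
  rewrite !mxE; rewrite -scale_intE !mxE ed /modz; by rewrite -/a /q.
have ly0 : lsubmx y = 0.
  apply/rowP => i; rewrite ord1 [LHS]mxE y0 mxE.
  apply/eqP; apply: contraT => m0.
  have : (d <= `|(a %% d%:Z)%Z|)%N.
    apply: dmin; apply/asboolP; split; first by rewrite absz_gt0.
    exists y => //; rewrite y0 gez0_abs //; lia.
  have : ((a %% d%:Z)%Z < d%:Z) by rewrite ltz_pmod.
  have : (0 <= (a %% d%:Z)%Z) by rewrite modz_ge0 //; lia.
  lia.
have [c ec] : exists c : 'rV_p, rsubmx y = c *m E.
  by apply/LE; rewrite /L' /= -ly0 hsubmxK.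
exists (row_mx (q%:M) c : 'rV_(1 + p)).
rewrite [RHS](mul_row_col q%:M c e (row_mx 0 E)) mul_scalar_mx mul_mx_row mulmx0.
rewrite -ec -ly0 hsubmxK /y.
by rewrite -scale_intE addrC subrK.
Qed.

Lemma zclosed_fg (V : zmodType) n (f : {additive V -> 'rV[int]_n}) (L : set V) :
  injective f -> zclosed L ->
  exists k (u : 'I_k -> V), (forall i, L (u i)) /\
    forall x, L x -> exists c : 'I_k -> int, x = \sum_i u i *~ c i.
Proof.
move=> injf HL; pose L1 := [set y | exists2 x, L x & f x = y]%classic.
have HL1 : zclosed L1.
  split; first by exists 0; [exact: zclosed0|rewrite raddf0].
  move=> _ _ [x Lx <-] [y Ly <-]; exists (x - y); last by rewrite raddfB.
  exact: zclosedB.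
have [p [E [LE injE]]] := lattice_basis HL1.
have /choice[u Hu] : forall i : 'I_p, exists x, L x /\ f x = row i E.
  move=> i; suff [x Lx e] : L1 (row i E) by exists x.
  by apply/LE; exists (delta_mx 0 i); rewrite rowE.
exists p, u; split=> [i|x Lx]; first by case: (Hu i).
have [c ec] : exists c : 'rV_p, f x = c *m E by apply/LE; exists x.
exists (c 0); apply: injf; rewrite ec mulmx_sum_row raddf_sum.
by apply: eq_bigr => i _; rewrite raddfMz; case: (Hu i) => _ ->; rewrite scale_intE.
Qed.

Lemma zclosed_fg_mx m n (L : set 'M[int]_(m, n)) : zclosed L ->
  exists k (u : 'I_k -> 'M[int]_(m, n)), (forall i, L (u i)) /\
    forall x, L x -> exists c : 'I_k -> int, x = \sum_i u i *~ c i.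
Proof. by move=> HL; apply: (zclosed_fg (f := mxvec)) HL; apply: can_inj mxvecK. Qed.

End Lattices.

(** * Torsion in finitely generated abelian groups *)

Section FgAbelian.
Local Open Scope ring_scope.

Lemma common_denominator (I : finType) (f : I -> rat) :
  exists2 D : nat, (0 < D)%N & exists c : I -> int, forall i, (c i)%:~R = D%:R * f i.
Proof.
exists (\prod_i `|denq (f i)|)%N; first by apply: prodn_gt0 => i; rewrite absz_gt0 denq_eq0.
exists (fun i => numq (f i) * (\prod_(j | j != i) `|denq (f j)|)%N%:Z) => i.
have e : `|denq (f i)|%N%:R * f i = (numq (f i))%:~R.
  have d0 : (denq (f i))%:~R != 0 :> rat by rewrite intr_eq0 denq_eq0.
  rewrite -{2}[f i]divq_num_den -[_%:R]/((`|denq (f i)|%N : int)%:~R) absz_denq.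
  by rewrite mulrC divfK.
by rewrite [in RHS](bigD1 i) //= natrM mulrAC e rmorphM.
Qed.

Lemma common_denominator_mx m n (A : 'M[rat]_(m, n)) :
  exists2 D : nat, (0 < D)%N &
    exists B : 'M[int]_(m, n), map_mx intr B = D%:R *: A.
Proof.
have [D D0 [c Hc]] := common_denominator (fun ij : 'I_m * 'I_n => A ij.1 ij.2).
exists D => //; exists (\matrix_(i, j) c (i, j)).
by apply/matrixP => i j; rewrite !mxE Hc.
Qed.

Definition torsion (V : zmodType) (L : set V) : set V :=
  [set v | exists2 N : nat, (0 < N)%N & L (v *+ N)]%classic.

Lemma torsion_zclosed (V : zmodType) (L : set V) : zclosed L -> zclosed (torsion L).
Proof.
move=> HL; split; first by exists 1; rewrite ?mul0rn //; apply: zclosed0.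
move=> x y [N N0 LN] [M M0 LM]; exists (N * M)%N; first by rewrite muln_gt0 N0.
rewrite mulrnBl mulrnA mulnC mulrnA; apply: zclosedB => //; exact: zclosedMn.
Qed.

(** The vectors with a multiple in [L] themselves form a lattice, so the product of the exponents of
    its generators serves for all of them. *)
Lemma torsion_exponent n (L : set 'rV[int]_n) : zclosed L ->
  exists2 N : nat, (0 < N)%N & forall v, torsion L v <-> L (v *+ N).
Proof.
move=> HL; have [k [u [Tu Hu]]] :=
  zclosed_fg (f := idfun) (fun _ _ => id) (torsion_zclosed HL).
have /choice[N HN] : forall i, exists N : nat, (0 < N)%N /\ L (u i *+ N).
  by move=> i; have [N] := Tu i; exists N.
have N_gt0 : (0 < \prod_i N i)%N by apply: prodn_gt0 => i; case: (HN i).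
exists (\prod_i N i)%N => // v; split=> [/Hu[c ->]|Lv]; last by exists (\prod_i N i)%N.
rewrite -sumrMnl; apply: zclosed_sum => // i.
rewrite (bigD1 i) //= mulrnA; apply: zclosedMn => //.
rewrite pmulrn mulrzAC -pmulrn; apply: zclosedMz => //.
by case: (HN i).
Qed.

(** The vectors with a multiple in [L] are the integer points of its rational span; [C] is an
    integer multiple of the cokernel matrix of that span. *)
Lemma torsion_free_quotient n (L : set 'rV[int]_n) : zclosed L ->
  exists C : 'M[int]_n, forall v, torsion L v <-> v *m C = 0.
Proof.
move=> HL; have [p [E [LE _]]] := lattice_basis HL.
have [D D0 [C HC]] := common_denominator_mx (cokermx (map_mx intr E : 'M[rat]__)).
exists C => v.
have inj m (x : 'M[int]_(m, n)) : map_mx intr x = 0 :> 'M[rat]_(m, n) -> x = 0.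
  move=> /matrixP e; apply/matrixP => i j; have := e i j; rewrite !mxE.
  by move/eqP; rewrite intr_eq0 => /eqP.
have -> : v *m C = 0 <-> (map_mx intr v <= (map_mx intr E : 'M[rat]__))%MS.
  rewrite submxE; split=> [e|/eqP e].
    have : map_mx intr (v *m C) = 0 :> 'rV[rat]_n by rewrite e map_mx0.
    rewrite map_mxM HC -scalemxAr => /eqP; rewrite scaler_eq0 pnatr_eq0.
    by case/orP=> // /eqP D00; rewrite D00 in D0.
  by apply: inj; rewrite map_mxM HC -scalemxAr e scaler0.
split=> [[N N0 /LE[c ec]]|/submxP[c ec]].
  have : (map_mx intr (v *+ N) : 'rV[rat]_n) = N%:R *: map_mx intr v.
    by rewrite raddfMn scaler_nat.
  rewrite ec map_mxM => eN.
  have N0' : N%:R != 0 :> rat by rewrite pnatr_eq0 -lt0n.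
  by rewrite -(eqmx_scale _ N0') -eN submxMl.
have [N N0 [c' ec']] := common_denominator_mx c.
exists N => //; apply/LE; exists c'; apply/eqP; rewrite -subr_eq0; apply/eqP/inj.
by rewrite map_mxB map_mxM ec' -scalemxAl -ec raddfMn scaler_nat subrr.
Qed.

(** [A] is a quotient of a free group by a lattice of relations [L]. A set-theoretic lift followed
    by the matrix [C], which kills [L], is additive, and its kernel is the torsion of [A], of
    bounded exponent. *)
Lemma fg_abelian_torsion (A : zmodType) n (a : 'I_n -> A) :
  (forall x, exists c : 'I_n -> int, x = \sum_i a i *~ c i) ->
  exists r (lam : A -> 'rV[int]_r), (forall x y, lam (x + y) = lam x + lam y) /\
    exists2 N : nat, (0 < N)%N & forall x, lam x = 0 <-> x *+ N = 0.
Proof.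
move=> gen; pose pi (v : 'rV[int]_n) := \sum_i a i *~ v 0 i.
have piB u v : pi (u - v) = pi u - pi v.
  by rewrite /pi -sumrB; apply: eq_bigr => i _; rewrite !mxE mulrzBr.
have piD u v : pi (u + v) = pi u + pi v.
  by rewrite /pi -big_split; apply: eq_bigr => i _; rewrite !mxE mulrzDr.
have pi0 : pi 0 = 0 by rewrite -[0 in LHS](subrr 0) piB subrr.
have piMn u N : pi (u *+ N) = pi u *+ N.
  by elim: N => [|N IH]; rewrite ?mulr0n // !mulrS piD IH.
pose L := [set v | pi v = 0]%classic.
have HL : zclosed L by split=> // x y; rewrite /L /= piB => -> ->; rewrite subrr.
have [C HC] := torsion_free_quotient HL.
have [N N0 HN] := torsion_exponent HL.
have /choice[w Hw] : forall x, exists v, pi v = x.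
  move=> x; have [c ->] := gen x; exists (\row_i c i).
  by apply: eq_bigr => i _; rewrite mxE.
have LC v : pi v = 0 -> v *m C = 0.
  by move=> e; apply/HC; exists 1 => //=; rewrite mulr1n.
exists n, (fun x => w x *m C); split.
  move=> x y; apply/eqP; rewrite -mulmxDl -subr_eq0 -mulmxBl; apply/eqP/LC.
  by rewrite piB piD !Hw subrr.
by exists N => // x; rewrite -HC HN /L /= piMn Hw.
Qed.

End FgAbelian.

(** * Nilpotent subgroups *)

Section Groups.
Variable G : groupType.
Implicit Types (A B H K M P : set G) (x y z : G).
Local Open Scope group_scope.
Local Open Scope classical_set_scope.

Lemma subgroup_generated A : subgroup (generated A).
Proof.
split=> [K [[]]//|x y Kx Ky K [sK AK]|x Kx K [sK AK]].
  by case: (sK) => _ KM _; apply: KM; [apply: Kx|apply: Ky].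
by case: (sK) => _ _ KV; apply: KV; apply: Kx.
Qed.

Lemma mem_generated A x : A x -> generated A x.
Proof. by move=> Ax K [_]; apply. Qed.

Lemma generated_sub A H : subgroup H -> A `<=` H -> generated A `<=` H.
Proof. exact: smallest_sub. Qed.

Section Subgroup.
Variables (H : set G) (sH : subgroup H).

Lemma subgroup1 : H 1. Proof. by case: sH. Qed.
Lemma subgroupM x y : H x -> H y -> H (x * y). Proof. by case: sH => _ h _; apply: h. Qed.
Lemma subgroupV x : H x -> H x^-1. Proof. by case: sH => _ _ h; apply: h. Qed.
Lemma subgroupJ x y : H x -> H y -> H (x ^ y).
Proof. by move=> Hx Hy; rewrite conjgE; do ?apply: subgroupM => //; apply: subgroupV. Qed.
Lemma subgroupR x y : H x -> H y -> H [~ x, y].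
Proof. by move=> Hx Hy; rewrite commgEl; apply: subgroupM; [apply: subgroupV|apply: subgroupJ]. Qed.
Lemma subgroupX x n : H x -> H (x ^+ n).
Proof.
move=> Hx; elim: n => [|n IH]; first exact: subgroup1.
by rewrite expgS; apply: subgroupM.
Qed.
End Subgroup.

Definition centraliser A : set G := [set x | forall a, A a -> commute x a].

Lemma subgroup_centraliser A : subgroup (centraliser A).
Proof.
split=> [a _|x y Cx Cy a Aa|x Cx a Aa].
- exact/commute_sym/commute1.
- by apply/commute_sym/commuteM; apply/commute_sym; [apply: Cx|apply: Cy].
- by apply/commute_sym/commuteV/commute_sym/Cx.
Qed.

Lemma centraliser_generated A x :
  (forall a, A a -> commute x a) -> centraliser (generated A) x.
Proof.
move=> xA a ga; suff : centraliser [set x] a by move=> /(_ x erefl)/commute_sym.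
apply: generated_sub ga; first exact: subgroup_centraliser.
by move=> b Ab _ ->; apply/commute_sym/xA.
Qed.

Lemma conjg_comm x y : commute x y -> x ^ y = x.
Proof. by move=> xy; rewrite conjgE xy mulKg. Qed.

Lemma commg_comm x y : commute x y -> [~ x, y] = 1.
Proof. by move/commgP/eqP. Qed.

Lemma commMg x y z : [~ x * y, z] = [~ x, z] ^ y * [~ y, z].
Proof. by rewrite !commgEl (conjMg x) [_ ^ y]conjgE invgM -!mulgA (mulVKg y). Qed.

Lemma commgM x y z : [~ x, y * z] = [~ x, z] * [~ x, y] ^ z.
Proof.
rewrite !commgEl conjgM (conjMg x^-1) conjVg -[RHS]mulgA.
by rewrite (mulVKg (x ^ z)).
Qed.

Lemma subgroup_lower_central H n : subgroup H -> subgroup (lower_central H n).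
Proof. by case: n => // n _; apply: subgroup_generated. Qed.

Lemma lower_central_sub H n : subgroup H -> lower_central H n `<=` H.
Proof.
move=> sH; elim: n => //= n IH; apply: generated_sub => // _ [x [y [/IH Hx Hy ->]]].
exact: subgroupR.
Qed.

Lemma lower_central_mono H K n : H `<=` K -> lower_central H n `<=` lower_central K n.
Proof.
move=> HK; elim: n => //= n IH; apply: generated_sub; first exact: subgroup_generated.
by move=> _ [x [y [/IH Kx /HK Ky ->]]]; apply: mem_generated; exists x, y.
Qed.

Lemma c_nilpotent_sub c H K : subgroup H -> H `<=` K -> c_nilpotent c K -> c_nilpotent c H.
Proof.
move=> sH HK [sK eK]; split=> //; apply/seteqP; split=> [x /(lower_central_mono HK)|_ ->].
  by rewrite eK.
by apply: subgroup1; apply: subgroup_lower_central.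
Qed.

Lemma c_nilpotentS c H : c_nilpotent c H -> c_nilpotent c.+1 H.
Proof.
move=> [sH eH]; split=> //; apply/seteqP; split=> [|_ ->]; last first.
  by apply: subgroup1; apply: subgroup_generated.
apply: generated_sub => [|_ [x [y [Hx Hy ->]]]]; first last.
  by have := Hx : lower_central H c x; rewrite eH => ->; rewrite /= comm1g.
by split=> [|x y -> ->|x ->] /=; rewrite ?mulg1 ?invg1.
Qed.

Lemma c_nilpotent1 H : subgroup H -> (forall x y, H x -> H y -> commute x y) ->
  c_nilpotent 1 H.
Proof.
move=> sH cH; split=> //; apply/seteqP; split=> [|_ ->]; last first.
  by apply: subgroup1; apply: subgroup_generated.
apply: generated_sub => [|_ [x [y [Hx Hy ->]]]]; last by rewrite /= commg_comm //; apply: cH.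
by split=> [|x y -> ->|x ->] /=; rewrite ?mulg1 ?invg1.
Qed.

Definition fin_gen K : Prop :=
  exists s : seq G, (forall x, x \in s -> K x) /\ K = generated [set` s].

(** A maximal finitely generated subgroup of [K] contains every element of [K], which could
    otherwise be added to its generators. *)
Lemma Nmax_fin_gen c K : Nmax G -> (0 < c)%N -> c_nilpotent c K -> fin_gen K.
Proof.
move=> hG c0 nK; have sK : subgroup K by case: nK.
pose F := [set L : set G | exists2 s : seq G, (forall x, x \in s -> K x) &
  L = generated [set` s]].
have FK L : F L -> L `<=` K.
  by move=> [s sK' ->]; apply: generated_sub.
have [||M [[s sK' ->] maxM]] := hG c c0 F.
- by exists (generated [set` [::]]), [::].
- move=> L FL; apply: c_nilpotent_sub (FK _ FL) nK.
  by case: FL => s _ ->; apply: subgroup_generated.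
exists s; split=> //; apply/seteqP; split; last exact: generated_sub.
move=> x Kx; rewrite -(maxM (generated [set` x :: s])).
- by apply: mem_generated; rewrite /= inE eqxx.
- exists (x :: s) => // y; rewrite inE => /predU1P[->//|]; exact: sK'.
- apply: generated_sub; first exact: subgroup_generated.
  by move=> y ys; apply: mem_generated; rewrite /= inE ys orbT.
Qed.

(** Commutators do not see the factor [P], so from the second term on the lower central series of
    the product lies in that of [M]. *)
Lemma c_nilpotent_central_product c M P : (0 < c)%N -> c_nilpotent c M -> subgroup P ->
  (forall x y, P x -> P y -> commute x y) -> (forall x y, P x -> M y -> commute x y) ->
  c_nilpotent c [set z | exists x y, [/\ M x, P y & z = x * y]].
Proof.
case: c => // c _ [sM eM] sP cP cPM; set N := [set z | _].
have sN : subgroup N.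
  split=> [|_ _ [x [p [Mx Pp ->]]] [y [q [My Pq ->]]]|_ [x [p [Mx Pp ->]]]].
  - by exists 1, 1; rewrite mulg1; split=> //; apply: subgroup1.
  - exists (x * y), (p * q); split; [exact: subgroupM|exact: subgroupM|].
    by rewrite -!mulgA; congr (_ * _); rewrite !mulgA; congr (_ * _); apply: cPM.
  - exists x^-1, p^-1; split; [exact: subgroupV|exact: subgroupV|].
    rewrite invgM; apply: cPM; [exact: subgroupV|exact: subgroupV].
have comm_N x p y q : M x -> P p -> M y -> P q -> [~ x * p, y * q] = [~ x, y].
  move=> Mx Pp My Pq; have MR : M [~ x, y] by apply: subgroupR.
  rewrite commMg [X in _ * X]commg_comm ?mulg1; last first.
    by apply: commuteM; [apply: cPM|apply: cP].
  rewrite commgM [X in X * _]commg_comm ?mul1g; last exact/commute_sym/cPM.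
  by rewrite !conjg_comm //; apply/commute_sym/cPM => //; rewrite ?conjg_comm //;
    apply/commute_sym/cPM.
split=> //; apply/seteqP; split=> [|_ ->]; last by apply: subgroup1; apply: subgroup_lower_central.
have step n : lower_central N n.+1 `<=` lower_central M n.+1.
  elim: n => [|n IH]; apply: generated_sub; try exact: subgroup_generated.
    move=> _ [_ [_ [[x [p [Mx Pp ->]]] [y [q [My Pq ->]]] ->]]].
    by rewrite comm_N //; apply: mem_generated; exists x, y.
  move=> _ [z [_ [/IH Mz [y [q [My Pq ->]]] ->]]].
  have Mz' : M z by apply: lower_central_sub Mz.
  rewrite -[z]mulg1 comm_N //; last exact: subgroup1.
  by apply: mem_generated; exists z, y.
by move=> x /step; rewrite eM.
Qed.

Lemma centraliser_maximal c M : (0 < c)%N -> c_nilpotent c M ->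
  (forall K, c_nilpotent c K -> M `<=` K -> K = M) -> centraliser M `<=` M.
Proof.
(* The double centraliser of x replaces the cyclic group of x: it contains x, is abelian and
   commutes with [M]. By maximality M P = M. *)
move=> c0 nM maxM x Cx; pose P := centraliser (centraliser [set x]).
have Px : P x by move=> y Cy; apply: (commute_sym (Cy x erefl)).
have cxx : centraliser [set x] x by move=> _ ->.
have Mcx y : M y -> centraliser [set x] y by move=> My _ ->; apply/commute_sym/Cx.
have PC y : P y -> centraliser [set x] y by move=> Py _ ->; apply: Py.
have sM : subgroup M by case: nM.
have nN := c_nilpotent_central_product c0 nM (subgroup_centraliser _)
  (fun y z (Py : P y) (Pz : P z) => Py z (PC z Pz))
  (fun y z (Py : P y) Mz => Py z (Mcx z Mz)).
rewrite -(maxM _ nN); first by exists 1, x; rewrite mul1g; split=> //; apply: subgroup1.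
move=> y My; exists y, 1; rewrite mulg1; split=> //.
by apply: subgroup1; apply: subgroup_centraliser.
Qed.

End Groups.

(** * Abelian subgroups in additive notation *)

Section AbelianSubgroup.
Variables (G : groupType) (Z : set G).

(** The proofs are parameters of the type so that the additive structure, which depends on them, can
    be attached to it. *)
Definition absub (sZ : subgroup Z)
  (cZ : forall x y, Z x -> Z y -> commute x y) : Type := {x : G | `[< Z x >]}.

Variables (sZ : subgroup Z) (cZ : forall x y, Z x -> Z y -> commute x y).
Local Notation T := (absub sZ cZ).
Local Open Scope group_scope.

HB.instance Definition _ := Choice.copy T {x : G | `[< Z x >]}.

Definition absub_val (x : T) : G := sval x.

Lemma absub_valP (x : T) : Z (absub_val x).
Proof. by apply/asboolP; apply: (svalP x). Qed.

Lemma absub_inj : injective absub_val.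
Proof. exact: val_inj. Qed.

Definition absub_mk x (Zx : Z x) : T := exist _ x (asboolT Zx).

Definition absub0 : T := absub_mk (subgroup1 sZ).
Definition absub_add (x y : T) : T := absub_mk (subgroupM sZ (absub_valP x) (absub_valP y)).
Definition absub_opp (x : T) : T := absub_mk (subgroupV sZ (absub_valP x)).

Fact absub_addA : associative absub_add.
Proof. by move=> x y z; apply: absub_inj; apply: mulgA. Qed.
Fact absub_addC : commutative absub_add.
Proof. by move=> x y; apply: absub_inj; apply: cZ; apply: absub_valP. Qed.
Fact absub_add0 : left_id absub0 absub_add.
Proof. by move=> x; apply: absub_inj; apply: mul1g. Qed.
Fact absub_addN : left_inverse absub0 absub_opp absub_add.
Proof. by move=> x; apply: absub_inj; apply: mulVg. Qed.

HB.instance Definition _ :=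
  GRing.isZmodule.Build T absub_addA absub_addC absub_add0 absub_addN.

Lemma absub_valX (x : T) n : absub_val (x *+ n)%R = absub_val x ^+ n.
Proof. by elim: n => [|n IH]; rewrite ?expg0 // mulrS expgS -IH. Qed.

Hypothesis fgZ : fin_gen Z.

Lemma absub_fg : exists n (a : 'I_n -> T),
  forall x, exists c : 'I_n -> int, (x = \sum_i a i *~ c i)%R.
Proof.
have [s [sZ' Zs]] := fgZ.
pose a (i : 'I_(size s)) : T := absub_mk (sZ' (tnth (in_tuple s) i) (mem_tnth i (in_tuple s))).
exists (size s), a.
pose span := [set x : G | exists c : 'I_(size s) -> int,
  x = absub_val (\sum_i a i *~ c i)%R]%classic.
have subspan : (Z `<=` span)%classic.
  rewrite Zs; apply: generated_sub.
    split=> [|_ _ [c ->] [d ->]|_ [c ->]].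
    - by exists (fun=> 0%R); rewrite big1 // => i _; rewrite mulr0z.
    - exists (fun i => (c i + d i)%R).
      rewrite -[LHS]/(absub_val (_ + _)%R) -big_split; congr absub_val.
      by apply: eq_bigr => i _; rewrite mulrzDr.
    - exists (fun i => (- c i)%R).
      rewrite -[LHS]/(absub_val (- _)%R) -sumrN; congr absub_val.
      by apply: eq_bigr => i _; rewrite mulrNz.
  move=> x /= /seq_tnthP[i ->]; exists (fun j => (j == i)%:R%R).
  have e0 (j : 'I_(size s)) : j != i -> (a j *~ (j == i)%:R = 0)%R.
    by move=> /negPf ->; rewrite mulr0z.
  rewrite (bigD1 i) // (big1 _ _ _ e0) eqxx mulr1z.
  exact: (congr1 absub_val (esym (addr0 (a i)))).

move=> x; have [c ec] := subspan _ (absub_valP x).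
by exists c; apply: absub_inj.
Qed.

(** The map is the one to the torsion-free quotient. Its kernel is given by an equation, which is
    what keeps equality of its values e-definable. *)
Lemma abelian_lattice_map : exists r (lam : G -> 'rV[int]_r) N,
  [/\ (0 < N)%N, forall x y, Z x -> Z y -> lam (x * y) = (lam x + lam y)%R
    & forall x, Z x -> lam x = 0%R <-> x ^+ N = 1].
Proof.
have [n [a gen]] := absub_fg.
have [r [lam [lamD [N N0 lam0]]]] := fg_abelian_torsion gen.
(* Outside [Z] the value is set to zero. *)
exists r, (fun x => if pselect (Z x) is left Zx then lam (absub_mk Zx) else 0%R), N.
split=> // [x y Zx Zy|x Zx].
  case: pselect => [Zxy|/(_ (subgroupM sZ Zx Zy))//].
  case: pselect => // Zx'; case: pselect => // Zy'; rewrite -lamD.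
  by congr lam; apply: absub_inj.
case: pselect => // Zx'; rewrite lam0; split=> [e|e].
  by rewrite -[x]/(absub_val (absub_mk Zx')) -absub_valX e.
by apply: absub_inj; rewrite absub_valX.
Qed.

(** The integer coefficients on the generators can be reduced modulo [N]. *)
Lemma bounded_abelian_finite N : (0 < N)%N -> (forall x, Z x -> x ^+ N = 1) ->
  exists t : seq G, forall x, Z x -> x \in t.
Proof.
move=> N0 ZN; have [n [a gen]] := absub_fg.
exists [seq absub_val (\sum_i a i *+ (h i : nat))%R | h : {ffun 'I_n -> 'I_N}] => x Zx.
have [c ec] := gen (absub_mk Zx).
have N0z : (Posz N != 0)%R by lia.
have lt i : (`|(c i %% Posz N)%Z| < N)%N.
  have := ltz_pmod (c i) (d := Posz N) ltac:(lia); have := modz_ge0 (c i) N0z; lia.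
have aN i : (a i *+ N = 0)%R.
  by apply: absub_inj; rewrite absub_valX ZN //; apply: absub_valP.
apply/fintype.imageP; exists [ffun i => Ordinal (lt i)] => //.
rewrite -[x]/(absub_val (absub_mk Zx)) ec; congr absub_val.
apply: eq_bigr => i _; rewrite ffunE /= {1}(divz_eq (c i) (Posz N)) mulrzDr.
rewrite mulrC mulrzA -pmulrn aN mul0rz add0r pmulrn gez0_abs //.
exact: modz_ge0.
Qed.

End AbelianSubgroup.

(** * Finiteness modulo a subgroup and the upper central series *)

Section FiniteModulo.
Variable G : groupType.
Implicit Types (A B C H K M N : set G) (x y z : G).
Local Open Scope group_scope.
Local Open Scope classical_set_scope.

(** A covering of [A] by finitely many right cosets of [B]; the representatives may lie outside
    [A]. *)
Definition fin_mod A B : Prop :=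
  exists s : seq G, forall x, A x -> exists2 r, r \in s & B (x * r^-1).

Lemma fin_mod_key (F : finType) (key : G -> F) A B :
  (forall x y, A x -> A y -> key x = key y -> B (x * y^-1)) -> fin_mod A B.
Proof.
move=> H.
pose rep f := if pselect (exists x, A x /\ key x = f) is left e then projT1 (cid e) else 1.
exists [seq rep f | f : F] => x Ax; exists (rep (key x)); first exact: fintype.image_f.
rewrite /rep; case: pselect => [e|[]]; last by exists x.
by case: cid => y /= [Ay ky]; apply: H.
Qed.

Lemma fin_mod_trans A B C : fin_mod A B -> fin_mod B C -> fin_mod A C.
Proof.
move=> [s Hs] [t Ht]; exists [seq q * r | q <- t, r <- s] => x /Hs[r rs /Ht[q qt Cq]].
exists (q * r); first exact: allpairs_f.
by rewrite invgM mulgA.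
Qed.

Lemma commVg x y : [~ x^-1, y] = [~ x, y]^-1 ^ x^-1.
Proof.
have := commMg x x^-1 y; rewrite mulgV comm1g => /esym/mulg1_eq <-.
by rewrite conjVg.
Qed.

Lemma commgV x y : [~ x, y^-1] = ([~ x, y] ^ y^-1)^-1.
Proof.
have := commgM x y y^-1; rewrite mulgV commg1 => /esym /(congr1 (fun z => z / [~ x, y] ^ y^-1)).
by rewrite mulgK mul1g.
Qed.

Section UpperCentral.
Variable M : set G.
Hypothesis sM : subgroup M.

Fixpoint upper_central n : set G :=
  if n is n'.+1 then [set x | M x /\ forall m, M m -> upper_central n' [~ x, m]]
  else [set 1].

Lemma upper_central_sub n : upper_central n `<=` M.
Proof. by case: n => [|n] x => [->|[]//]; apply: subgroup1. Qed.

Lemma upper_central_normal n x y : upper_central n x -> M y -> upper_central n (x ^ y).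
Proof.
elim: n x => [|n IH] x /= => [-> _|[Mx Hx] My]; first by rewrite conj1g.
split=> [|m Mm]; first exact: subgroupJ.
have -> : [~ x ^ y, m] = [~ x, m ^ y^-1] ^ y by rewrite conjRg conjgKV.
by apply: IH => //; apply: Hx; apply: subgroupJ => //; apply: subgroupV.
Qed.

Lemma subgroup_upper_central n : subgroup (upper_central n).
Proof.
elim: n => [|n IH]; first by split=> [|x y -> ->|x ->] /=; rewrite ?mulg1 ?invg1.
split=> [|x y [Mx Hx] [My Hy]|x [Mx Hx]]; split.
- exact: subgroup1.
- by move=> m _; rewrite comm1g; apply: subgroup1.
- exact: subgroupM.
- move=> m Mm; rewrite commMg; apply: subgroupM => //; last exact: Hy.
  by apply: upper_central_normal => //; apply: Hx.
- exact: subgroupV.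
- move=> m Mm; rewrite commVg; apply: upper_central_normal; last exact: subgroupV.
  by apply: subgroupV => //; apply: Hx.
Qed.

Lemma nilpotent_upper_central c : lower_central M c = [set 1] -> M `<=` upper_central c.
Proof.
move=> ec.
have H i : (i <= c)%N -> lower_central M (c - i) `<=` upper_central i.
  elim: i => [|i IH] ic; first by rewrite subn0 ec.
  move=> x Hx; split=> [|m Mm]; first exact: lower_central_sub Hx.
  apply: (IH (ltnW ic)); rewrite subnS in Hx.
  have -> : (c - i)%N = (c - i).-1.+1 by rewrite prednK // subn_gt0.
  by apply: mem_generated; exists x, m.
by move=> x Mx; apply: (H c) => //; rewrite subnn.
Qed.

Variable s : seq G.
Hypothesis Ms : M = generated [set` s].

(** The m in [M] with [x, m] in the n-th term form a subgroup, because that term is normal in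
    [M]. *)
Lemma upper_central_gen n x : M x -> (forall m, m \in s -> upper_central n [~ x, m]) ->
  upper_central n.+1 x.
Proof.
move=> Mx Hx; split=> // m; rewrite Ms => Mm.
suff [] : [set m | M m /\ upper_central n [~ x, m]] m by [].
apply: generated_sub Mm => [|y ys]; last first.
  by split; [rewrite Ms; apply: mem_generated|apply: Hx].
have sU := subgroup_upper_central n.
split=> [|y z [My Hy] [Mz Hz]|y [My Hy]]; split.
- exact: subgroup1.
- by rewrite commg1; apply: subgroup1.
- exact: subgroupM.
- by rewrite commgM; apply: subgroupM => //; apply: upper_central_normal.
- exact: subgroupV.
- rewrite commgV; apply: subgroupV => //; apply: upper_central_normal => //.
  exact: subgroupV.
Qed.

(** Modulo the term [n.+1], x is determined by the cosets modulo the term [n] of its commutators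
    with the generators, and these range over a finite set. *)
Lemma fin_mod_upper_step n (t : seq G) :
  (forall x m, upper_central n.+2 x -> m \in s ->
     exists2 r, r \in t & upper_central n ([~ x, m] * r^-1)) ->
  fin_mod (upper_central n.+2) (upper_central n.+1).
Proof.
move=> Ht.
have /choice[rho Hrho] : forall xm : G * G, exists r,
    upper_central n.+2 xm.1 -> xm.2 \in s -> r \in t /\
    upper_central n ([~ xm.1, xm.2] * r^-1).
  move=> [x m] /=; have [[Ux ms]|Nxm] := pselect (upper_central n.+2 x /\ m \in s).
    by have [r] := Ht x m Ux ms; exists r.
  by exists 1 => Ux ms; case: Nxm.
have sU := subgroup_upper_central n.
pose key x := [ffun j : 'I_(size s) =>
  inord (index (rho (x, tnth (in_tuple s) j)) t) : 'I_(size t).+1].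
apply: (@fin_mod_key _ key) => x y Ux Uy /ffunP exy.
have Mx : M x := upper_central_sub Ux; have My : M y := upper_central_sub Uy.
apply: upper_central_gen => [|m ms]; first by apply: subgroupM => //; apply: subgroupV.
have [rxt Hx] := Hrho (x, m) Ux ms; have [ryt Hy] := Hrho (y, m) Uy ms.
have exy' : rho (x, m) = rho (y, m).
  have [j ej] := seq_tnthP ms.
  have := exy j; rewrite !ffunE -ej => /(congr1 val) /=.
  rewrite !inordK ?ltnS ?index_size // => ei.
  by rewrite -(nth_index 1 rxt) ei nth_index.
rewrite commMg commVg -(conjMg [~ x, m]).
apply: upper_central_normal; last exact: subgroupV.
rewrite /= in Hx Hy; rewrite -exy' in Hy.
have := subgroupM sU Hx (subgroupV sU Hy).
by rewrite invgM invgK -mulgA mulKg.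
Qed.

(** Commutators with a generator send each term into the one below, which by induction is finite
    modulo the next; so finiteness climbs the series from its second factor. *)
Lemma fin_mod_centre c (t : seq G) : lower_central M c.+1 = [set 1] ->
  (forall x m, upper_central 2 x -> m \in s -> [~ x, m] \in t) ->
  fin_mod M (upper_central 1).
Proof.
move=> ec Ht.
have step n : fin_mod (upper_central n.+2) (upper_central n.+1).
  elim: n => [|n [u Hu]].
    apply: (@fin_mod_upper_step _ t) => x m Ux ms.
    by exists [~ x, m]; [apply: Ht|rewrite mulgV].
  apply: (@fin_mod_upper_step _ u) => x m [Mx Ux] ms.
  by apply: Hu; apply: Ux; rewrite Ms; apply: mem_generated.
have all n : fin_mod (upper_central n.+1) (upper_central 1).
  elim: n => [|n IH]; last exact: fin_mod_trans (step n) IH.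
  by exists [:: 1] => x Ux; exists 1; rewrite ?inE // invg1 mulg1.
have [u Hu] := all c; exists u => x Mx; apply: Hu.
exact: nilpotent_upper_central Mx.
Qed.

End UpperCentral.

Lemma virtually_abelian_central M H Z : subgroup M -> subgroup H -> subgroup Z ->
  H `<=` M -> Z `<=` centraliser M -> fin_mod H Z -> virtually_abelian H.
Proof.
move=> sM sH sZ HM ZC [s Hs]; exists (H `&` Z); split.
- split=> [|x y [Hx Zx] [Hy Zy]|x [Hx Zx]]; split.
  + exact: subgroup1.
  + exact: subgroup1.
  + exact: subgroupM.
  + exact: subgroupM.
  + exact: subgroupV.
  + exact: subgroupV.
- by move=> x [].
- by move=> x y [_ /ZC Cx] [/HM My _]; apply: Cx.
(* Representatives are chosen anew inside [H], since those of [fin_mod] may lie outside. *)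
pose rep r := if pselect (exists x, H x /\ Z (x * r^-1)) is left e then projT1 (cid e) else 1.
apply: (@sub_finite_set _ _ [set [set rep r * a | a in H `&` Z] | r in [set` s]]);
  last exact/finite_image/finite_seq.
move=> _ [x Hx <-]; have [r rs Zr] := Hs x Hx; exists r => //.
rewrite /rep; case: pselect => [e|[]]; last by exists x.
case: cid => y /= [Hy Zy].
have Zyx : Z (y * x^-1).
  have := subgroupM sZ Zy (subgroupV sZ Zr).
  by rewrite invgM invgK mulgA mulgVK.
pose z := y * x^-1; have ey : y = x * z.
  by rewrite /z -(ZC _ Zyx x (HM _ Hx)) mulgVK.
have Hz : H z by apply: subgroupM => //; apply: subgroupV.
have Zz : Z z := Zyx; clearbody z.
apply/seteqP; split=> _ [a [Ha Za] <-].
  exists (z * a); first by split; apply: subgroupM.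
  by rewrite ey mulgA.
exists (z^-1 * a); first by split; apply: subgroupM => //; apply: subgroupV.
by rewrite ey -!mulgA mulVKg.
Qed.

End FiniteModulo.

(** * The commutator pairing of a maximal nilpotent subgroup *)

Section Pairing.
Variable G : groupType.
Implicit Types (A B C H K M N W U Z : set G) (x y z : G).
Local Open Scope group_scope.
Local Open Scope classical_set_scope.

(** The values of [f] lie outside G, so only equality of two values is e-definable. By [pairing_det]
    the left kernel is the common kernel of finitely many homomorphisms to a lattice, which makes
    [W] modulo it a lattice. *)
Record def_pairing W U r (f : G -> G -> 'rV[int]_r) : Prop := DefPairing {
  pairing_left : subgroup W;
  pairing_right : subgroup U;
  pairing_leftP : gdef (fun a : unit -> G => W (a tt));
  pairing_rightP : gdef (fun a : unit -> G => U (a tt));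
  pairing_eqP : gdef (fun a : bool * bool -> G =>
    [/\ W (a (false, false)), U (a (false, true)), W (a (true, false)), U (a (true, true))
      & f (a (false, false)) (a (false, true)) = f (a (true, false)) (a (true, true))]);
  pairing_Dl : forall x y u, W x -> W y -> U u -> (f (x * y)%g u = f x u + f y u)%R;
  pairing_Dr : forall x u v, W x -> U u -> U v -> (f x (u * v)%g = f x u + f x v)%R;
  pairing_det : exists s : seq G, (forall u, u \in s -> U u) /\
    forall x, W x -> (forall u, u \in s -> f x u = 0%R) -> forall u, U u -> f x u = 0%R;
  pairing_neq0 : exists x u, [/\ W x, U u & f x u <> 0%R] }.

Lemma comm_bil_l Z x y u : Z [~ x, u] -> centraliser Z y ->
  [~ x * y, u] = [~ x, u] * [~ y, u].
Proof. by move=> Zxu Cy; rewrite commMg conjg_comm //; apply/commute_sym/Cy. Qed.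

Lemma comm_bil_r Z x u v : Z [~ x, u] -> centraliser Z v ->
  [~ x, u * v] = [~ x, v] * [~ x, u].
Proof. by move=> Zxu Cv; rewrite commgM conjg_comm //; apply/commute_sym/Cv. Qed.

Lemma comm_bil_Xl Z x u n : subgroup Z -> Z [~ x, u] -> centraliser Z x ->
  [~ x ^+ n, u] = [~ x, u] ^+ n.
Proof.
move=> sZ Zxu Cx; elim: n => [|n IH]; first by rewrite comm1g.
rewrite expgSr (@comm_bil_l Z) // ?IH ?expgSr //; exact: subgroupX.
Qed.

Lemma subgroup_comm_right Z x : subgroup Z ->
  subgroup [set u | centraliser Z u /\ Z [~ x, u]].
Proof.
move=> sZ; have sC := subgroup_centraliser Z.
split=> [|u v [Cu Zu] [Cv Zv]|u [Cu Zu]]; split.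
- exact: (subgroup1 sC).
- by rewrite commg1; apply: subgroup1.
- exact: (subgroupM sC).
- by rewrite (@comm_bil_r Z) //; apply: subgroupM.
- exact: (subgroupV sC).
- have CV : centraliser Z u^-1 by apply: (subgroupV sC).
  by rewrite commgV conjg_comm; [apply: subgroupV|apply/commute_sym/CV].
Qed.

Lemma subgroup_comm_left Z u : subgroup Z ->
  subgroup [set x | centraliser Z x /\ Z [~ x, u]].
Proof.
move=> sZ; have sC := subgroup_centraliser Z.
split=> [|x y [Cx Zx] [Cy Zy]|x [Cx Zx]]; split.
- exact: (subgroup1 sC).
- by rewrite comm1g; apply: subgroup1.
- exact: (subgroupM sC).
- by rewrite (@comm_bil_l Z) //; apply: subgroupM.
- exact: (subgroupV sC).
- have CV : centraliser Z x^-1 by apply: (subgroupV sC).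
  rewrite commVg conjg_comm; first exact: subgroupV.
  exact: (commute_sym (CV _ (subgroupV sZ Zx))).
Qed.

Lemma gdef_centraliser (s : seq G) A : A = generated [set` s] ->
  gdef (fun a : unit -> G => centraliser A (a tt)).
Proof.
move=> As; pose t1 (x : G) := GMul (GVar G tt) (GCst unit x).
pose t2 (x : G) := GMul (GCst unit x) (GVar G tt).
apply: gdef_ext (gdef_all_seq s (fun x => gdef_eq (t1 x) (t2 x))) => a /=.
split=> [H|H x xs]; first by rewrite As; apply: centraliser_generated => x; apply: H.
by apply: H; rewrite As; apply: mem_generated.
Qed.

Theorem nilpotent_pairing : Nmax G ->
  (exists H, [/\ subgroup H, nilpotent H & ~ virtually_abelian H]) ->
  exists W U r (f : G -> G -> 'rV[int]_r), def_pairing W U f.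
Proof.
move=> hG [H [sH [c nH] nvH]].
(* The class is raised by one because the maximal condition concerns positive classes and c may be
   0. *)
have [||M [[nM HM] maxM]] := hG c.+1 isT [set K | c_nilpotent c.+1 K /\ H `<=` K].
- by exists H; split=> //; apply: c_nilpotentS.
- by move=> K [].
have sM : subgroup M by case: nM.
pose Z := centraliser M.
have sZ : subgroup Z by apply: subgroup_centraliser.
have ZM : Z `<=` M.
  apply: (centraliser_maximal _ nM) => // K nK MK; apply: maxM => //.
  by split=> // x /HM /MK.
have cZ x y : Z x -> Z y -> commute x y by move=> Zx /ZM; apply: Zx.
have [s [sM' Ms]] := Nmax_fin_gen hG (ltn0Sn _) nM.
have nZ := c_nilpotent1 sZ cZ.
have fgZ := Nmax_fin_gen hG (ltn0Sn _) nZ; have [z [zZ Zz]] := fgZ.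
have MC x : M x -> centraliser Z x by move=> Mx y Zy; apply/commute_sym/Zy.
pose W := [set x | centraliser Z x /\ forall m, m \in s -> Z [~ x, m]].
have WZ x m : W x -> M m -> Z [~ x, m].
  move=> [Cx Zx]; rewrite Ms => Mm.
  suff [] : [set u | centraliser Z u /\ Z [~ x, u]] m by [].
  apply: generated_sub Mm; first exact: subgroup_comm_right.
  by move=> u us; split; [apply/MC/sM'|apply: Zx].
have sC := subgroup_centraliser Z.
have sW : subgroup W.
  split=> [|x y [Cx Zx] [Cy Zy]|x [Cx Zx]]; split.
  - exact: (subgroup1 sC).
  - by move=> m _; rewrite comm1g; apply: subgroup1.
  - exact: (subgroupM sC).
  - move=> m ms; have [_ sub _] := subgroup_comm_left m sZ.
    by case: (sub x y (conj Cx (Zx m ms)) (conj Cy (Zy m ms))).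
  - exact: (subgroupV sC).
  - move=> m ms; have [_ _ sub] := subgroup_comm_left m sZ.
    by case: (sub x (conj Cx (Zx m ms))).
(* Each w in W acts on M by m -> m [w, m]^-1, where [w, m] lies in Z and is fixed by W. Such maps
   commute, so [x, y] centralises M. *)
have WR x y : W x -> W y -> Z [~ x, y].
  move=> Wx Wy m Mm.
  have conjW w m' : W w -> M m' -> m' ^ w = m' * [~ w, m']^-1.
    by move=> Ww Mm'; rewrite invgR commgEl mulVKg.
  have conjWM w m' : W w -> M m' -> M (m' ^ w).
    move=> Ww Mm'; rewrite conjW //; apply: subgroupM => //; apply: subgroupV => //.
    exact/ZM/WZ.
  have conjZ w a : W w -> Z a -> a ^ w = a.
    by move=> [Cw _] Za; apply: conjg_comm; apply/commute_sym/Cw.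
  have swap m' : M m' -> m' ^ (x * y) = m' ^ (y * x).
    move=> Mm'; rewrite !conjgM (conjW x m') // (conjW y m') // !(conjMg m').
    rewrite (conjW x m') // (conjW y m') // !conjVg !conjZ //; try exact: WZ.
    by rewrite -!mulgA; congr (_ * _); apply: cZ; apply: (subgroupV sZ); apply: WZ.
  have Myx : M (m ^ (y * x)^-1).
    rewrite invgM conjgM; apply: (conjWM _ _); first exact: (subgroupV sW).
    by apply: conjWM => //; exact: (subgroupV sW).
  have e : m ^ [~ x, y] = m.
    have -> : [~ x, y] = (y * x)^-1 * (x * y).
      by rewrite commgEl conjgE invgM -!mulgA.
    by rewrite conjgM swap // -conjgM mulVg conjg1.
  by apply/commute_sym/commgP; rewrite -conjg_fix e.
(* Commutators of W lie in Z, which W centralises; thus the maximal condition yields finitely many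
   generators of W, and through them a definition of U. *)
have nW : c_nilpotent 2 W.
  split=> //; apply/seteqP; split=> [|_ ->]; last first.
    by apply: subgroup1; apply: subgroup_lower_central.
  apply: generated_sub => [|_ [x [y [Zx Wy ->]]]].
    by split=> [|x y -> ->|x ->] /=; rewrite ?mulg1 ?invg1.
  rewrite /= commg_comm //; case: Wy => Cy _; apply/commute_sym/Cy.
  by apply: generated_sub Zx => // _ [x' [y' [Wx' Wy' ->]]]; apply: WR.
have [w [wW Ww]] := Nmax_fin_gen hG (ltn0Sn _) nW.
pose U := [set u | centraliser Z u /\ forall x, x \in w -> Z [~ x, u]].
have UZ x u : W x -> U u -> Z [~ x, u].
  rewrite Ww => Wx [Cu Zu].
  suff [] : [set x | centraliser Z x /\ Z [~ x, u]] x by [].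
  apply: generated_sub Wx; first exact: subgroup_comm_left.
  by move=> y yw; split; [case: (wW y yw)|apply: Zu].
have sU : subgroup U.
  split=> [|x y [Cx Zx] [Cy Zy]|x [Cx Zx]]; split.
  - exact: (subgroup1 sC).
  - by move=> m _; rewrite commg1; apply: subgroup1.
  - exact: (subgroupM sC).
  - move=> m ms; have [_ sub _] := subgroup_comm_right m sZ.
    by case: (sub x y (conj Cx (Zx m ms)) (conj Cy (Zy m ms))).
  - exact: (subgroupV sC).
  - move=> m ms; have [_ _ sub] := subgroup_comm_right m sZ.
    by case: (sub x (conj Cx (Zx m ms))).
have MU x : M x -> U x by move=> Mx; split=> [|y yw]; [apply: MC|apply: WZ => //; apply: wW].
have [r [lam [N [N0 lamD lam0]]]] := abelian_lattice_map sZ cZ fgZ.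
(* Equality of values modulo torsion is turned into an equation in the group. *)
have lamE a b : Z a -> Z b -> lam a = lam b <-> (a^-1 * b) ^+ N = 1.
  move=> Za Zb; rewrite -lam0; last by apply: (subgroupM sZ) => //; apply: (subgroupV sZ).
  have -> : lam b = (lam a + lam (a^-1 * b)%g)%R.
    by rewrite -lamD // ?mulVKg //; apply: (subgroupM sZ) => //; apply: (subgroupV sZ).
  by split=> [/eqP|->]; rewrite ?addr0 // -{1}[lam a]addr0 (inj_eq (addrI _)) => /eqP.
have dZ : gdef (fun a : unit -> G => Z (a tt)) := gdef_centraliser Ms.
have dC : gdef (fun a : unit -> G => centraliser Z (a tt)) := gdef_centraliser Zz.
pose ct (V : Type) (t u : gterm V G) := GMul (GInv t) (GMul (GInv u) (GMul t u)).
have dW : gdef (fun a : unit -> G => W (a tt)).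
  apply: gdef_and dC _; apply: gdef_all_seq => m.
  exact: (gdef_subst (fun _ => ct unit (GVar G tt) (GCst _ m)) dZ).
have dU : gdef (fun a : unit -> G => U (a tt)).
  apply: gdef_and dC _; apply: gdef_all_seq => m.
  exact: (gdef_subst (fun _ => ct unit (GCst _ m) (GVar G tt)) dZ).
exists W, U, r, (fun x u => lam [~ x, u]); split=> //.
- pose v b b' := GVar G (b, b') : gterm (bool * bool) G.
  pose t0 := GMul (GInv (ct _ (v false false) (v false true)))
                 (ct _ (v true false) (v true true)).
  pose tN := iter N (GMul t0) (GOne _ _).
  have tNE a : geval id a tN = (geval id a t0) ^+ N.
    by rewrite /tN; elim: (N) => [|k IH] /=; rewrite ?expg0 // expgS -IH.
  have := gdef_and (gdef_comp (fun=> (true, false)) dW) (gdef_and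
    (gdef_comp (fun=> (true, true)) dU) (gdef_eq tN (GOne _ _))).
  move=> /(gdef_and (gdef_comp (fun=> (false, true)) dU)).
  move=> /(gdef_and (gdef_comp (fun=> (false, false)) dW)).
  apply: gdef_ext => a; rewrite tNE; split.
    move=> [Wx [Uu [Wy [Uv e]]]]; split=> //; apply/lamE => //; exact: UZ.
  move=> [Wx Uu Wy Uv /lamE e]; do 4 (split=> //); apply: e; exact: UZ.
- move=> x y u Wx Wy Uu; rewrite (@comm_bil_l Z); [|exact: UZ|by case: Wy].
  by apply: lamD; apply: UZ.
- move=> x u v Wx Uu Uv; rewrite (@comm_bil_r Z); [|exact: UZ|by case: Uv].
  by rewrite [RHS]addrC; apply: lamD; apply: UZ.
(* If [x, m] is torsion for all generators m of M, then [x^N, m] = [x, m]^N = 1, so x^N lies in Z.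
   As U centralises Z, also [x, u]^N = [x^N, u] = 1 for every u in U. *)
- exists s; split=> [u us|x Wx Hx u Uu]; first exact/MU/sM'.
  have Cx : centraliser Z x by case: Wx.
  have ZxN : Z (x ^+ N).
    rewrite /Z Ms; apply: centraliser_generated => m ms; apply/commgP/eqP.
    rewrite (@comm_bil_Xl Z) //; last by apply: UZ => //; apply/MU/sM'.
    by apply/lam0; [apply: UZ => //; apply/MU/sM'|apply: Hx].
  apply/lam0; first exact: UZ.
  rewrite -(@comm_bil_Xl Z) //; last exact: UZ.
  by apply: commg_comm; case: Uu => Cu _; apply/commute_sym/Cu.
apply: contrapT => allE; apply: nvH.
have {}allE x m : W x -> M m -> [~ x, m] ^+ N = 1.
  move=> Wx Mm; apply/lam0; first exact: WZ.
  by apply: contrapT => ne; apply: allE; exists x, m; split=> //; apply: MU.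
(* Now all commutators of W with M lie in the finite torsion group T of Z. Since W contains the
   second centre of M, finiteness of M modulo its centre follows. *)
pose T := [set x | Z x /\ x ^+ N = 1].
have sT : subgroup T.
  split=> [|x y [Zx ex] [Zy ey]|x [Zx ex]]; split.
  - exact: (subgroup1 sZ).
  - exact: expg1n.
  - exact: (subgroupM sZ).
  - by rewrite expgMn ?ex ?ey ?mulg1 //; apply: cZ.
  - exact: (subgroupV sZ).
  - by rewrite expVgn ex invg1.
have cT x y : T x -> T y -> commute x y by move=> [Zx _] [Zy _]; apply: cZ.
have [t Ht] := bounded_abelian_finite sT cT
  (Nmax_fin_gen hG (ltn0Sn _) (c_nilpotent1 sT cT)) N0 (fun x (Tx : T x) => proj2 Tx).
have U1 x : upper_central M 1 x -> Z x.
  by move=> [Mx Hx] m Mm; apply/commgP/eqP; apply: Hx.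
have [u Hu] : fin_mod M (upper_central M 1).
  apply: (fin_mod_centre sM Ms (t := t)) => [|x m [Mx Ux] ms]; first by case: nM => _; exact.
  have Mm := sM' _ ms.
  have Wx : W x by split=> [|m' m's]; [apply: MC|apply/U1/Ux/sM'].
  by apply: Ht; split; [apply: WZ|apply: allE].
apply: (virtually_abelian_central sM sH sZ HM) => //.
by exists u => x /HM /Hu[y yu /U1 Zxy]; exists y.
Qed.

End Pairing.

(** * The ring of scalars of a bilinear map *)

Section ScalarRing.
Variables (G : groupType) (W U : set G) (r : nat) (f : G -> G -> 'rV[int]_r).
Hypothesis P : def_pairing W U f.
Local Open Scope ring_scope.

Let sW := pairing_left P.
Let sU := pairing_right P.

Lemma pairing1l u : U u -> f 1%g u = 0.
Proof.
move=> Uu; have := pairing_Dl P (subgroup1 sW) (subgroup1 sW) Uu.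
by rewrite mulg1 => /eqP; rewrite -subr_eq0 opprD addNKr oppr_eq0 => /eqP.
Qed.

Lemma pairingVl x u : W x -> U u -> f x^-1%g u = - f x u.
Proof.
move=> Wx Uu; apply/eqP; rewrite -addr_eq0 -(pairing_Dl P) ?mulVg ?pairing1l //.
exact: subgroupV.
Qed.

Lemma pairing1r x : W x -> f x 1%g = 0.
Proof.
move=> Wx; have := pairing_Dr P Wx (subgroup1 sU) (subgroup1 sU).
by rewrite mulg1 => /eqP; rewrite -subr_eq0 opprD addNKr oppr_eq0 => /eqP.
Qed.

Lemma pairingVr x u : W x -> U u -> f x u^-1%g = - f x u.
Proof.
move=> Wx Uu; apply/eqP; rewrite -addr_eq0 -(pairing_Dr P) ?mulVg ?pairing1r //.
exact: subgroupV.
Qed.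

(** The values of [f x] on the finite determining set embed [W] modulo the left kernel in a lattice;
    [kappa] gives coordinates in a basis of the image. *)
Lemma pairing_coordinates : exists p (kappa : G -> 'rV[int]_p),
  [/\ forall x y, W x -> W y -> kappa (x * y)%g = kappa x + kappa y,
      forall c, exists2 x, W x & kappa x = c,
      forall x, W x -> (forall u, U u -> f x u = 0) -> kappa x = 0
    & forall x, W x -> kappa x = 0 -> forall u, U u -> f x u = 0].
Proof.
have [s [sU' det]] := pairing_det P.
pose n := size s; pose sj := tnth (in_tuple s).
have Us j : U (sj j) by apply: sU'; apply: mem_tnth.
pose h x := mxvec (\matrix_(j < n, k < r) f x (sj j) 0 k).
have hD x y : W x -> W y -> h (x * y)%g = h x + h y.
  move=> Wx Wy; rewrite /h -raddfD; congr mxvec; apply/matrixP => j k.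
  by rewrite !mxE (pairing_Dl P) // mxE.
have h0 x : W x -> h x = 0 <-> forall u, U u -> f x u = 0.
  move=> Wx; split=> [hx|fx].
    apply: det => // u /seq_tnthP[j ->]; apply/rowP => k.
    have /(can_inj mxvecK)/matrixP/(_ j k) : h x = mxvec 0 by rewrite hx raddf0.
    by rewrite !mxE.
  rewrite /h (_ : \matrix_(_, _) _ = 0) ?raddf0 //; apply/matrixP => j k.
  by rewrite !mxE fx // mxE.
pose L := [set v | exists2 x, W x & h x = v]%classic.
have zL : zclosed L.
  split; first by exists 1%g; [exact: subgroup1|apply/h0; [exact: subgroup1|exact: pairing1l]].
  move=> _ _ [x Wx <-] [y Wy <-]; have Wy' := subgroupV sW Wy.
  exists (x * y^-1)%g; first exact: subgroupM.
  rewrite hD //; congr (_ + _); apply/eqP; rewrite -addr_eq0 -hD // mulVg.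
  by apply/eqP/h0; [exact: subgroup1|exact: pairing1l].
have [p [E [LE injE]]] := lattice_basis zL.
have /choice[kappa Hk] : forall x, exists c : 'rV_p, W x -> h x = c *m E.
  move=> x; have [Wx|nWx] := pselect (W x); last by exists 0.
  by have [c ec] : exists c, h x = c *m E by [apply/LE; exists x]; exists c.
have inj (c d : 'rV_p) : c *m E = d *m E -> c = d.
  by move=> e; apply/eqP; rewrite -subr_eq0; apply/eqP/injE; rewrite mulmxBl e subrr.
exists p, kappa; split.
- by move=> x y Wx Wy; apply: inj; rewrite mulmxDl -!Hk ?hD //; apply: subgroupM.
- move=> c; have [x Wx hx] : L (c *m E) by apply/LE; exists c.
  by exists x => //; apply: inj; rewrite -Hk.
- by move=> x Wx fx; apply: injE; rewrite -Hk //; apply/h0.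
- by move=> x Wx kx; apply/h0; rewrite // Hk // kx mul0mx.
Qed.

(** The rows of [F u] are the values at u of lifts of the basis vectors; additivity in the first
    argument does the rest. *)
Lemma pairing_matrices : exists p (kappa : G -> 'rV[int]_p) (F : G -> 'M[int]_(p, r)),
  [/\ forall x y, W x -> W y -> kappa (x * y)%g = kappa x + kappa y,
      forall c, exists2 x, W x & kappa x = c,
      forall x u, W x -> U u -> f x u = kappa x *m F u,
      forall c : 'rV_p, (forall u, U u -> c *m F u = 0) -> c = 0
    & forall u v, U u -> U v -> F (u * v^-1)%g = F u - F v].
Proof.
have [p [kappa [kD ksurj k0 kf]]] := pairing_coordinates.
have /choice[w Hw] : forall i : 'I_p, exists x, W x /\ kappa x = delta_mx 0 i.
  by move=> i; have [x] := ksurj (delta_mx 0 i); exists x.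
pose F u := \matrix_(i < p, k < r) f (w i) u 0 k.
have fk x y u : W x -> W y -> U u -> kappa x = kappa y -> f x u = f y u.
  move=> Wx Wy Uu e; have Wy' := subgroupV sW Wy.
  have : f (x * y^-1)%g u = 0.
    apply: kf => //; first exact: subgroupM.
    by rewrite kD // e -kD // mulgV; apply: k0; [exact: subgroup1|exact: pairing1l].
  by rewrite (pairing_Dl P) // pairingVl // => /eqP; rewrite subr_eq0 => /eqP.
have fE x u : W x -> U u -> f x u = kappa x *m F u.
  move=> Wx Uu.
  pose Q := [set c | forall x, W x -> kappa x = c -> f x u = c *m F u]%classic.
  suff : Q (kappa x) by apply.
  apply: rV_int_ind => [|i y Wy ky].
    split=> [y Wy ky|c d Qc Qd y Wy ky]; first by rewrite mul0mx; apply: kf.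
    have [z Wz kz] := ksurj d.
    have := Qc (y * z)%g (subgroupM sW Wy Wz); rewrite kD // ky kz subrK => /(_ erefl).
    by rewrite (pairing_Dl P) // (Qd z) // mulmxBl => <-; rewrite addrK.
  have [Wi ki] := Hw i; rewrite (fk y (w i)) ?ky ?ki //.
  by apply/rowP => k; rewrite -rowE !mxE.
exists p, kappa, F; split=> //.
- move=> c Hc; have [x Wx kx] := ksurj c; rewrite -kx; apply: k0 => // u Uu.
  by rewrite fE // kx Hc.
- move=> u v Uu Uv; apply/matrixP => i k; rewrite !mxE.
  have [Wi _] := Hw i; have Uv' := subgroupV sU Uv.
  by rewrite (pairing_Dr P) // pairingVr // !mxE.
Qed.

Theorem scalar_ring_interp : exists p (S : set 'M[int]_p) (I : finType)
    (D : (I -> G) -> Prop) (phi : (I -> G) -> 'M[int]_p),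
  [/\ (0 < p)%N, Defs.subring S, forall x y, S x -> S y -> x *m y = y *m x
    & interp D phi S].
Proof.
have [p [kappa [F [kD ksurj fE faith FB]]]] := pairing_matrices.
pose Phi := [set A | exists2 u, U u & F u = A]%classic.
have zPhi : zclosed Phi.
  split; last first.
    move=> _ _ [u Uu <-] [v Uv <-]; exists (u * v^-1)%g; last exact: FB.
    by apply: subgroupM => //; apply: subgroupV.
  have U1 := subgroup1 sU; exists 1%g => //.
  by have := FB _ _ U1 U1; rewrite subrr mulgV.
have [q [ph [Phi_ph genPhi]]] := zclosed_fg_mx zPhi.
have /choice[u Hu] : forall j : 'I_q, exists u, U u /\ F u = ph j.
  by move=> j; have [u] := Phi_ph j; exists u.
have Uu j : U (u j) by case: (Hu j).
(* A matrix is determined by its products with the finitely many generators of [Phi], by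
   faithfulness. *)
have faithM m (A B : 'M[int]_(m, p)) : (forall j, A *m F (u j) = B *m F (u j)) -> A = B.
  move=> AB; apply/eqP; rewrite -subr_eq0; apply/eqP/row_matrixP => i; rewrite row0.
  apply: faith => v Uv; rewrite -row_mul mulmxBl.
  have [c ->] : exists c : 'I_q -> int, F v = \sum_j ph j *~ c j by apply: genPhi; exists v.
  rewrite !mulmx_sumr -sumrB big1 ?row0 // => j _; have [_ <-] := Hu j.
  by rewrite -!scaler_int -!scalemxAr AB subrr.
(* The ring of left multipliers of [Phi]. *)
pose R0 := [set A : 'M[int]_p | forall B, Phi B -> Phi (A *m B)]%classic.
have R0u A : (forall j, Phi (A *m F (u j))) -> R0 A.
  move=> HA B /genPhi[c ->]; rewrite mulmx_sumr; apply: zclosed_sum => // j.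
  have [_ <-] := Hu j; rewrite -scaler_int -scalemxAr scaler_int; exact: zclosedMz.
have zR0 : zclosed R0.
  split=> [B _|A A' HA HA' B PB]; first by rewrite mul0mx; apply: zclosed0.
  by rewrite mulmxBl; apply: zclosedB => //; [apply: HA|apply: HA'].
have R0M A A' : R0 A -> R0 A' -> R0 (A *m A').
  by move=> HA HA' B PB; rewrite -mulmxA; apply/HA/HA'.
have R01 : R0 1%:M by move=> B; rewrite mul1mx.
have [l [rho [R0rho genR0]]] := zclosed_fg_mx zR0.
(* The centre of [R0]: it is enough to commute with additive generators. *)
pose S := [set A | R0 A /\ forall t, A *m rho t = rho t *m A]%classic.
have SC A B : S A -> R0 B -> A *m B = B *m A.
  move=> [_ HA] /genR0[c ->]; rewrite mulmx_sumr mulmx_suml; apply: eq_bigr => t _.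
  by rewrite -!scaler_int -scalemxAr HA scalemxAl.
have subS : Defs.subring S.
  split=> [|A B [RA cA] [RB cB]|A B [RA cA] [RB cB]]; split.
  - exact: R01.
  - by move=> t; rewrite mul1mx mulmx1.
  - exact: (zclosedB zR0).
  - by move=> t; rewrite mulmxBl mulmxBr cA cB.
  - exact: R0M.
  - by move=> t; rewrite -[A * B]/(A *m B) -mulmxA cB mulmxA cA mulmxA.
have /choice[w Hw] : forall i : 'I_p, exists x, W x /\ kappa x = delta_mx 0 i.
  by move=> i; have [x] := ksurj (delta_mx 0 i); exists x.
have Ww i : W (w i) by case: (Hw i).
(* Each scalar is coded by preimages of its rows and of its products with the
   generators of Phi. *)
have code A : R0 A -> exists g : 'I_p + 'I_q -> G,
    [/\ forall i, W (g (inl i)), forall i, kappa (g (inl i)) = row i A,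
        forall j, U (g (inr j)) & forall j, F (g (inr j)) = A *m F (u j)].
  move=> RA.
  have /choice[x Hx] : forall i : 'I_p, exists x, W x /\ kappa x = row i A.
    by move=> i; have [x] := ksurj (row i A); exists x.
  have /choice[v Hv] : forall j : 'I_q, exists v, U v /\ F v = A *m F (u j).
    by move=> j; have [|v] := RA (F (u j)); [exists (u j)|exists v].
  exists (fun k => match k with inl i => x i | inr j => v j end).
  by split=> k; [case: (Hx k)|case: (Hx k)|case: (Hv k)|case: (Hv k)].
have /choice[g0 Hg0] : forall t, exists g : 'I_p + 'I_q -> G,
    [/\ forall i, W (g (inl i)), forall i, kappa (g (inl i)) = row i (rho t),
        forall j, U (g (inr j)) & forall j, F (g (inr j)) = rho t *m F (u j)].
  by move=> t; apply: code.
(* With A the matrix whose rows are coded in g, the third condition says that the elements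
   [g (inr j)] code the products A F(u_j), and the fourth compares A rho_t F(u_j) with rho_t A
   F(u_j), that is, A commutes with every rho_t. *)
pose D (g : 'I_p + 'I_q -> G) : Prop :=
  [/\ forall i, W (g (inl i)), forall j, U (g (inr j)),
      forall i j, f (g (inl i)) (u j) = f (w i) (g (inr j))
    & forall t i j, f (g (inl i)) (g0 t (inr j)) = f (g0 t (inl i)) (g (inr j))].
pose phi (g : 'I_p + 'I_q -> G) := \matrix_i kappa (g (inl i)).
have rowphi g i : row i (phi g) = kappa (g (inl i)) by rewrite rowK.
have DF g j : D g -> F (g (inr j)) = phi g *m F (u j).
  move=> [Wg Ug fg _]; apply/row_matrixP => i; rewrite row_mul rowphi -fE // fg fE //.
  by have [_ ->] := Hw i; rewrite -rowE.
have fF g i v : D g -> U v -> f (g (inl i)) v = row i (phi g *m F v).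
  by move=> [Wg _ _ _] Uv; rewrite fE // row_mul rowphi.
have DE g : D g -> S (phi g).
  move=> Dg; have [Wg Ug fg cg] := Dg; split.
    by apply: R0u => j; rewrite -DF //; exists (g (inr j)).
  move=> t; have [Wt kt Ut Ft] := Hg0 t.
  apply: faithM => j; apply/row_matrixP => i.
  rewrite -[LHS]/(row i (phi g *m rho t *m F (u j))) -mulmxA -Ft -fF // cg fE // kt DF //.
  by rewrite -row_mul mulmxA.
exists p, S, ('I_p + 'I_q)%type, D, phi; split=> //.
- case: (posnP p) => // p0; have [x [v [Wx Uv]]] := pairing_neq0 P.
  case; rewrite fE // (_ : kappa x = 0) ?mul0mx //.
  by apply/rowP => i; have := ltn_ord i; rewrite [in X in (_ < X)%N]p0.
- by move=> A B SA [RB _]; apply: SC.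
have deq V (t1 t2 t3 t4 : gterm V G) : gdef (fun a => [/\ W (geval id a t1),
    U (geval id a t2), W (geval id a t3), U (geval id a t4) &
    f (geval id a t1) (geval id a t2) = f (geval id a t3) (geval id a t4)]).
  exact: (gdef_subst (fun b : bool * bool => match b with
    | (false, false) => t1 | (false, true) => t2 | (true, false) => t3
    | (true, true) => t4 end) (pairing_eqP P)).
have dD : gdef D.
  pose X k := GVar G k : gterm ('I_p + 'I_q) G.
  pose C c := GCst ('I_p + 'I_q) c : gterm _ G.
  have d1 := gdef_all (fun i => gdef_subst (fun _ : unit => X (inl i)) (pairing_leftP P)).
  have d2 := gdef_all (fun j => gdef_subst (fun _ : unit => X (inr j)) (pairing_rightP P)).
  have d3 := gdef_all (fun i => gdef_all (fun j =>
    deq _ (X (inl i)) (C (u j)) (C (w i)) (X (inr j)))).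
  have d4 := gdef_all (fun t => gdef_all (fun i => gdef_all (fun j =>
    deq _ (X (inl i)) (C (g0 t (inr j))) (C (g0 t (inl i))) (X (inr j))))).
  apply: gdef_ext (gdef_and d1 (gdef_and d2 (gdef_and d3 d4))) => g /=.
  split=> [[H1 [H2 [H3 H4]]]|[H1 H2 H3 H4]].
    by split=> // [i j|t i j]; [case: (H3 i j)|case: (H4 t i j)].
  split=> //; split=> //; split=> [i j|t i j]; first by split.
  by have [Wt _ Ut _] := Hg0 t; split.
have sd V (Q : (V -> 'M[int]_p) -> Prop) (e : 'I_p -> 'I_q ->
     gterm (V * ('I_p + 'I_q)) G * gterm (V * ('I_p + 'I_q)) G *
     (gterm (V * ('I_p + 'I_q)) G * gterm (V * ('I_p + 'I_q)) G)) :
   gdef (fun g : V * ('I_p + 'I_q) -> G => forall v, D (fun k => g (v, k))) ->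
   (forall g, (forall v, D (fun k => g (v, k))) ->
     Q (fun v => phi (fun k => g (v, k))) <-> forall i j,
       [/\ W (geval id g (e i j).1.1), U (geval id g (e i j).1.2),
        W (geval id g (e i j).2.1), U (geval id g (e i j).2.2) &
        f (geval id g (e i j).1.1) (geval id g (e i j).1.2) =
        f (geval id g (e i j).2.1) (geval id g (e i j).2.2)]) ->
   sdef D phi Q.
  move=> dV QE; have de := gdef_all (fun i => gdef_all (fun j =>
    deq _ (e i j).1.1 (e i j).1.2 (e i j).2.1 (e i j).2.2)).
  by apply: gdef_ext (gdef_and dV de) => g; split=> -[Dg Hg]; split=> //; apply/QE.
have dV (V : finType) :
    gdef (fun g : V * ('I_p + 'I_q) -> G => forall v, D (fun k => g (v, k))).
  by apply: gdef_all => v; apply: (gdef_comp (fun k => (v, k))) dD.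
have phiP g A : D g -> phi g = A <-> forall i j, f (g (inl i)) (u j) = row i (A *m F (u j)).
  move=> Dg; split=> [<- i j|H]; first by rewrite fF.
  by apply: faithM => j; apply/row_matrixP => i; rewrite -H fF.
split=> //.
- move=> A SA; have [RA cA] := SA; have [g [Wg kg Ug Fg]] := code A RA.
  have phig : phi g = A by apply/row_matrixP => i; rewrite rowphi.
  exists g => //; split=> // [i j|t i j].
    by rewrite !fE // kg Fg; have [_ ->] := Hw i; rewrite -rowE row_mul.
  have [Wt kt Ut Ft] := Hg0 t; rewrite !fE // kg kt Ft Fg -!row_mul !mulmxA.
  by rewrite cA.
- pose X v k := GVar G (v, k) : gterm ('I_2 * ('I_p + 'I_q)) G.
  apply: (sd _ _ (fun i j => (X 0 (inl i), GCst _ (u j), (X 1 (inl i), GCst _ (u j))))) => //.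
  move=> g Dg /=; rewrite (phiP _ _ (Dg 0)); have D1 := Dg 1.
  have [[W0 _ _ _] [W1 _ _ _]] := (Dg 0, Dg 1).
  split=> [H i j|H i j]; first by split=> //; rewrite H -fF.
  by have [_ _ _ _ ->] := H i j; rewrite -fF.
(* The rows of a sum are coded by the products in [W] of the row codes. *)
- pose X v k := GVar G (v, k) : gterm ('I_3 * ('I_p + 'I_q)) G.
  apply: (sd _ _ (fun i j => (X 2%:R (inl i), GCst _ (u j),
    (GMul (X 0 (inl i)) (X 1 (inl i)), GCst _ (u j))))) => //.
  move=> g Dg /=; set A := phi _; set B := phi _; set C := phi _.
  rewrite (_ : A + B = C <-> C = A + B); last by split=> ->.
  rewrite (phiP _ _ (Dg 2%:R)).
  have [[W0 _ _ _] [W1 _ _ _] [W2 _ _ _]] := And3 (Dg 0) (Dg 1) (Dg 2%:R).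
  have D0 := Dg 0; have D1 := Dg 1.
  have E i j : f (g (0, inl i) * g (1%R, inl i))%g (u j) = row i ((A + B) *m F (u j)).
    rewrite (pairing_Dl P) // [f (g (0, inl i)) _](fF (fun k => g (0, k)) i _ D0) //.
    by rewrite [f (g (1, inl i)) _](fF (fun k => g (1, k)) i _ D1) // -raddfD -mulmxDl.
  split=> [H i j|H i j]; first by split=> //; [apply: subgroupM|rewrite H E].
  by have [_ _ _ _ ->] := H i j; rewrite E.
(* The rows of A are paired with the product codes of B: [f] takes there the rows of A B F(u_j),
   which determine A B. *)
- pose X v k := GVar G (v, k) : gterm ('I_3 * ('I_p + 'I_q)) G.
  apply: (sd _ _ (fun i j => (X 2%:R (inl i), GCst _ (u j),
    (X 0 (inl i), X 1 (inr j))))) => //.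
  move=> g Dg /=; set A := phi _; set B := phi _; set C := phi _.
  rewrite (_ : A * B = C <-> C = A *m B); last by split=> e; apply: esym.
  rewrite (phiP _ _ (Dg 2%:R)).
  have [[W0 _ _ _] [W1 U1 _ _] [W2 _ _ _]] := And3 (Dg 0) (Dg 1) (Dg 2%:R).
  have E i j : f (g (0, inl i)) (g (1, inr j)) = row i (A *m B *m F (u j)).
    rewrite [LHS](fF (fun k => g (0, k)) i _ (Dg 0)) //.
    by rewrite (DF (fun k => g (1, k)) j (Dg 1)) mulmxA.
  split=> [H i j|H i j]; first by split=> //; rewrite H E.
  by have [_ _ _ _ ->] := H i j; rewrite E.
Qed.

End ScalarRing.

(** * Rings of algebraic integers *)

Section AlgebraicNumbers.
Local Open Scope ring_scope.

Local Notation toC := (intr : int -> algC).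

Lemma monic_intr (p : {poly int}) : (map_poly toC p \is monic) = (p \is monic).
Proof.
rewrite !monicE lead_coef_map_inj ?rmorph0 //; last exact: intr_inj.
by rewrite -[1 in LHS]/(1%:~R) eqr_int.
Qed.

Lemma Aint_integral x : x \in Aint <-> integralOver toC x.
Proof.
split=> [/floorpP[p Dp]|[p monp rp]].
  exists p; last by rewrite -Dp root_minCpoly.
  by rewrite -monic_intr -Dp minCpoly_monic.
apply: (root_monic_Aint rp); first exact: monic_map.
by apply/polyOverP => i; rewrite coef_map /= rpred_int.
Qed.

Lemma integral_over_fmorph (L : fieldType) (h : {rmorphism L -> algC}) (l : L) :
  integralOver (intr : int -> L) l <-> h l \in Aint.
Proof.
have E p : root (map_poly (intr : int -> L) p) l = root (map_poly toC p) (h l).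
  rewrite -(fmorph_root h) -map_poly_comp; congr root.
  by apply: eq_map_poly => z /=; rewrite rmorph_int.
by rewrite Aint_integral; split=> -[p mp rp]; exists p => //; move: rp; rewrite E.
Qed.

Lemma Aint_root_monic (p : {poly algC}) x :
  p \is monic -> (forall i, p`_i \in Aint) -> root p x -> x \in Aint.
Proof.
move=> mp Ap rp; apply/Aint_integral.
apply: (integral_root_monic (RtoK := intr : {rmorphism int -> algC}) mp rp).
by move=> _ /(nthP 0)[i _ <-]; apply/Aint_integral.
Qed.

(** The inverse of k is rational and would have to be an integer. *)
Lemma Aint_Mn_neq1 (x : algC) k : (1 < k)%N -> x \in Aint -> x *+ k != 1.
Proof.
move=> k1 Ax; apply/eqP => e.
have k0 : k%:R != 0 :> algC by rewrite pnatr_eq0; lia.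
have : x \in Num.int.
  apply: Cint_rat_Aint => //; rewrite (_ : x = k%:R^-1) ?rpredV ?rpred_nat //.
  by apply: (mulIf k0); rewrite mulVf // mulr_natr.
case/intrP=> n xn; move: e; rewrite xn pmulrn -mulrzA -[RHS]/(1%:~R) => /eqP.
rewrite eqr_int => /eqP /(congr1 absz); rewrite abszM => /eqP.
by rewrite muln_eq1 => /andP[_ /eqP] /= ek; rewrite ek in k1.
Qed.

(** The minimal polynomial of x has integer coefficients and degree at most n; a power of X brings
    the degree to exactly n, so that one equation shape fits all x. *)
Lemma Aint_degree (q : {poly rat}) n x : q != 0 -> (size q <= n.+1)%N ->
  root (map_poly ratr q) x -> x \in Aint ->
  exists c : 'I_n -> int, x ^+ n + \sum_(i < n) (c i)%:~R * x ^+ i = 0.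
Proof.
move=> q0 szq rq Ax.
have [/floorpP[p Dp] [m [Dm monm] dvdm]] := (Ax : _ \is a polyOver _, minCpolyP x).
have szp : (size (minCpoly x) <= n.+1)%N.
  apply: leq_trans szq; rewrite Dm size_map_poly; apply: dvdp_leq => //.
  by rewrite -dvdm.
have szp0 : (0 < size (minCpoly x))%N by rewrite size_poly_gt0 monic_neq0 ?minCpoly_monic.
pose k := (n.+1 - size (minCpoly x))%N; pose P := p * 'X^k.
have monp : p \is monic.
  by rewrite -monic_intr -Dp minCpoly_monic.
have szP : size P = n.+1.
  rewrite size_Mmonic ?monic_neq0 ?monicXn // size_polyXn.
  have -> : size p = size (minCpoly x).
    by rewrite Dp size_map_inj_poly //; apply: intr_inj.
  by rewrite /k; lia.
have monP : P \is monic by rewrite rpredM // monicXn.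
exists (fun i => P`_i).
have : (map_poly toC P).[x] = 0.
  by rewrite rmorphM /= hornerM -Dp (rootP (root_minCpoly x)) mul0r.
rewrite horner_coef size_map_inj_poly //; last exact: intr_inj.
rewrite szP big_ord_recr /= !coef_map /= => e0.
rewrite -[RHS]e0 [LHS]addrC; congr (_ + _).
  by apply: eq_bigr => i _; rewrite coef_map.
have -> : P`_n = 1 by have := monicP monP; rewrite lead_coefE szP.
by rewrite mul1r.
Qed.

(** Let |N| = 2^a m with m odd. Take 2v - 1 = m and 3w - 1 = 2 4^a, possible because 4^a is 1 modulo
    3; the cofactor is 2 2^a up to sign. *)
Lemma half_third_multiple (N : int) : N != 0 ->
  exists v w k : int, (v *+ 2 - 1) * (w *+ 3 - 1) = N * k.
Proof.
move=> N0; have N_gt0 : (0 < `|N|)%N by rewrite absz_gt0.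
have [m cm em] := pfactor_coprime (p := 2) isT N_gt0.
set a := logn 2 _ in em.
have [w ew] : exists w : nat, (3 * w = 2 * 4 ^ a + 1)%N.
  elim: (a) => [|b [w ew]]; first by exists 1.
  by exists (4 * w - 1)%N; rewrite expnS; lia.
rewrite coprime2n in cm.
have em2 : m = (m./2.*2.+1)%N by rewrite -[LHS]odd_double_half cm.
have e4 : (4 ^ a = 2 ^ a * 2 ^ a)%N by rewrite -expnMn.
exists (m./2.+1)%:Z, w%:Z, (sgz N * (2 * 2 ^ a)%N%:Z).
have eN : N = sgz N * (m * 2 ^ a)%N%:Z by rewrite -em; lia.
have sN : sgz N * sgz N = 1 by lia.
have -> : N * (sgz N * (2 * 2 ^ a)%N%:Z) = (m * (2 * 4 ^ a))%N%:Z.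
  rewrite {1}eN mulrACA sN mul1r -PoszM; congr Posz; rewrite e4; lia.
have -> : (m./2.+1)%:Z *+ 2 - 1 = m%:Z by lia.
have -> : w%:Z *+ 3 - 1 = (2 * 4 ^ a)%N%:Z by lia.
by [].
Qed.

End AlgebraicNumbers.

(** * A character of a commutative ring of integer matrices and its number field *)

Section NumberField.
Local Open Scope ring_scope.
Variables (p : nat) (S : set 'M[int]_p).
Hypotheses (p_gt0 : (0 < p)%N) (subS : Defs.subring S).
Hypothesis commS : forall x y, S x -> S y -> x *m y = y *m x.

Local Notation toC := (map_mx (intr : int -> algC)).

Lemma subring_zclosed : zclosed S.
Proof. by split; [exact: subring0 subS|case: subS]. Qed.

(* The eigenvalue of x on a common eigenvector of S. *)
Lemma character_exists : exists chi : 'M[int]_p -> algC,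
  [/\ forall x y, chi (x - y) = chi x - chi y, chi 1 = 1,
      forall x y, S x -> S y -> chi (x * y) = chi x * chi y
    & forall x, S x -> root (map_poly intr (char_poly x)) (chi x)].
Proof.
have [k [u [Su genS]]] := zclosed_fg_mx subring_zclosed.
have [|v v0 /allP Hv] := @common_eigenvector algC p [seq toC (u i) | i <- enum 'I_k] p_gt0.
  move=> _ _ /mapP[i _ ->] /mapP[j _ ->].
  by rewrite /comm_mx -!map_mxM commS.
have [i0 vi0] : exists i, v 0 i != 0.
  apply: contrapT => Hn; move/eqP: v0; apply; apply/rowP => i; rewrite mxE.
  by apply: contrapT => vi; apply: Hn; exists i; apply/eqP.
have eig x : S x -> exists a, v *m toC x = a *: v.
  move=> /genS[c ->].
  have /choice[a Ha] : forall i, exists a, v *m toC (u i) = a *: v.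
    move=> i; have /sub_rVP[a ea] := Hv (toC (u i)) (map_f _ (mem_enum _ i)).
    by exists a.
  exists (\sum_i (c i)%:~R * a i); rewrite map_mx_sum mulmx_sumr scaler_suml.
  apply: eq_bigr => i _; rewrite -scaler_int map_mxZ -scalemxAr Ha scalerA.
  by rewrite /= intz.
(* Read off at a nonzero coordinate of the eigenvector: this is additive on all matrices, though an
   eigenvalue, and multiplicative, only on [S]. *)
pose chi (x : 'M[int]_p) := (v *m toC x) 0 i0 / v 0 i0.
have chiE x : S x -> v *m toC x = chi x *: v.
  by move=> /eig[a e]; rewrite /chi e mxE mulfK.
exists chi; split.
- by move=> x y; rewrite /chi map_mxB mulmxBr !mxE mulrBl.
- have e1 : toC 1 = 1%:M by apply: map_mx1.
  by rewrite /chi e1 mulmx1 divff.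
- move=> x y Sx Sy; rewrite {1}/chi -[x * y]/(x *m y) map_mxM mulmxA chiE // -scalemxAl.
  by rewrite chiE // !mxE !mulrA mulfK.
- move=> x Sx; rewrite map_char_poly -eigenvalue_root_char; apply/eigenvalueP.
  by exists v => //; apply: chiE.
Qed.

Variable chi : 'M[int]_p -> algC.
Hypotheses (chiB : forall x y, chi (x - y) = chi x - chi y) (chi1 : chi 1 = 1).
Hypothesis chiM : forall x y, S x -> S y -> chi (x * y) = chi x * chi y.
Hypothesis chiR : forall x, S x -> root (map_poly intr (char_poly x)) (chi x).

Lemma chi0 : chi 0 = 0.
Proof. by rewrite -[0 in LHS](subrr 0) chiB subrr. Qed.

Lemma chiN x : chi (- x) = - chi x.
Proof. by rewrite -sub0r chiB chi0 sub0r. Qed.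

Lemma chiD x y : chi (x + y) = chi x + chi y.
Proof. by rewrite -{1}(opprK y) chiB chiN opprK. Qed.

Lemma chiMn x n : chi (x *+ n) = chi x *+ n.
Proof. by elim: n => [|n IH]; rewrite ?mulr0n ?chi0 // !mulrS chiD IH. Qed.

Lemma chiMz x z : chi (x *~ z) = chi x *~ z.
Proof. by case: z => n; rewrite -?nmulrn -?pmulrn ?chiN chiMn. Qed.

Lemma chi_sum (I : finType) (F : I -> 'M[int]_p) : chi (\sum_i F i) = \sum_i chi (F i).
Proof. by apply: (big_morph chi chiD chi0). Qed.

Lemma chi_Aint x : S x -> chi x \in Aint.
Proof.
move=> Sx; apply: (root_monic_Aint (chiR Sx)); first exact/monic_map/char_poly_monic.
by apply/polyOverP => i; rewrite coef_map /= rpred_int.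
Qed.

Lemma subring_int z : S (1 *~ z).
Proof. by apply: (zclosedMz subring_zclosed); case: subS. Qed.

Lemma chi_int z : chi (1 *~ z) = z%:~R.
Proof. by rewrite chiMz chi1. Qed.

Lemma chi_horner (q : {poly int}) x : S x ->
  exists2 y, S y & chi y = (map_poly intr q).[chi x].
Proof.
move=> Sx; have [S1 SB SM] := subS; elim/poly_ind: q => [|q c [y Sy ey]].
  by exists 0; [exact: subring0 subS|rewrite chi0 rmorph0 horner0].
exists (y * x + 1 *~ c).
  by apply: (zclosedD subring_zclosed); [apply: SM|apply: subring_int].
by rewrite chiD chi_int chiM // ey rmorphD rmorphM /= map_polyX map_polyC hornerMXaddC.
Qed.

(** If chi x were 0, then 2 chi v = 1 or 3 chi w = 1, impossible for algebraic integers. Conversely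
    a nonzero chi x divides a nonzero integer, which divides such a product with v and w
    integers. *)
Lemma chi_neq0 x : S x ->
  (exists z v w, [/\ S z, S v, S w &
     chi x * chi z = (chi v + chi v - 1) * (chi w + chi w + chi w - 1)]) <-> chi x != 0.
Proof.
move=> Sx; split=> [[z [v [w [Sz Sv Sw e]]]]|x0].
  apply/eqP => x0; move/esym/eqP: e; rewrite x0 mul0r mulf_eq0 !subr_eq0.
  rewrite -[chi v + _]mulr2n -[_ + _ + _]mulr1n -{1}[chi w]mulr1n -mulr2n -mulrSr.
  by rewrite !(negPf (Aint_Mn_neq1 _ (chi_Aint _))).
(* The characteristic polynomial is q X^m with q(0) nonzero. As chi x is not 0 it is a root of q,
   and hence divides q(0). *)
have [m [q q0 eq]] := multiplicity_XsubC (char_poly x) 0.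
rewrite monic_neq0 ?char_poly_monic //= in q0.
have qx : root (map_poly intr q) (chi x).
  have := chiR Sx; rewrite eq rmorphM rmorphXn /= rmorphB /= map_polyX map_polyC /=.
  rewrite rootM => /orP[//|]; rewrite /root horner_exp !hornerE /= subr0.
  by rewrite expf_eq0 (negPf x0) andbF.
elim/poly_ind: q {eq} q0 qx => [|q c _ qc qx]; first by rewrite root0.
have c0 : c != 0 by move: qc; rewrite /root hornerMXaddC mulr0 add0r.
have [v [w [k e]]] := half_third_multiple c0.
have [y Sy ey] := chi_horner q Sx.
exists (- y *~ k), (1 *~ v), (1 *~ w); split; try exact: subring_int.
  by apply: (zclosedMz subring_zclosed); apply: (zclosedN subring_zclosed).
have eC := congr1 (intr : int -> algC) e.
rewrite !rmorphM !rmorphB !rmorphMn /= in eC.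
rewrite chiMz chiN ey !chi_int -!mulr2n -mulrSr eC mulrzAr mulrN.
move: qx; rewrite /root rmorphD rmorphM /= map_polyX map_polyC hornerMXaddC /=.
rewrite addr_eq0 => /eqP qx; rewrite -mulrzr; congr (_ * _).
by rewrite mulrC qx opprK.
Qed.

(** The equation is a monic equation for the quotient u, cleared of denominators. Its coefficients
    are algebraic integers, so it implies integrality; conversely u has degree at most p over the
    rationals and integer coefficients suffice. *)
Lemma chi_ratio x y : S x -> S y -> chi y != 0 ->
  (exists s N, [/\ S s, (0 < N)%N & chi x / chi y * N%:R = chi s]) ->
  (exists c : 'I_p -> 'M[int]_p, (forall i, S (c i)) /\
     chi x ^+ p + \sum_(i < p) chi (c i) * chi x ^+ i * chi y ^+ (p - i) = 0) <->
  chi x / chi y \in Aint.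
Proof.
move=> Sx Sy y0 [s [N [Ss N0 eN]]]; set u := chi x / chi y in eN *.
have xE : chi x = u * chi y by rewrite /u divfK.
have scaled (c : 'I_p -> algC) :
    chi x ^+ p + \sum_(i < p) c i * chi x ^+ i * chi y ^+ (p - i) =
    chi y ^+ p * (u ^+ p + \sum_(i < p) c i * u ^+ i).
  rewrite mulrDr xE exprMn [u ^+ p * _]mulrC; congr (_ + _).
  rewrite mulr_sumr; apply: eq_bigr => i _.
  have -> : chi y ^+ p = chi y ^+ i * chi y ^+ (p - i).
    by rewrite -exprD subnKC // ltnW.
  by rewrite exprMn; ring.
split=> [[c [Sc]]|Au].
  rewrite scaled => /eqP; rewrite mulf_eq0 expf_eq0 (negPf y0) andbF /= => /eqP e.
  pose q0 : {poly algC} := \poly_(i < p) (if insub i is Some j then chi (c j) else 0).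
  pose q := 'X^p + q0.
  have szq : (size q0 < size ('X^p : {poly algC}))%N by rewrite size_polyXn ltnS size_poly.
  apply: (@Aint_root_monic q).
  - by rewrite monicE lead_coefDl // lead_coefXn.
  - move=> i; rewrite coefD coefXn coef_poly; apply: rpredD; first exact: rpred_nat.
    case: ifP => ip; last exact: rpred0.
    by case: insub => [j|]; [apply: chi_Aint|apply: rpred0].
  - rewrite /q0 /root hornerD hornerXn horner_poly -[X in _ == X]e; apply/eqP; congr (_ + _).
    by apply: eq_bigr => i _; rewrite valK.
(* N u = chi s is a root of the characteristic polynomial of s; substituting N X gives a polynomial
   of degree p with root u. *)
pose q : {poly rat} := map_poly intr (char_poly s) \Po (N%:R *: 'X).
have szq : size q = p.+1.
  rewrite size_comp_poly2; first by rewrite size_map_inj_poly ?size_char_poly //; exact: intr_inj.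
  by rewrite size_scale ?size_polyX // pnatr_eq0 -lt0n.
have [|||c Hc] := @Aint_degree q p u _ _ _ Au.
- by rewrite -size_poly_eq0 szq.
- by rewrite szq.
- rewrite /q map_comp_poly map_polyZ map_polyX /= ratr_nat /root horner_comp.
  rewrite hornerZ hornerX mulrC eN -map_poly_comp.
  rewrite (eq_map_poly (g := intr)) ?(rootP (chiR Ss)) // => z /=.
  exact: ratr_int.
exists (fun i => 1 *~ c i); split=> [i|]; first exact: subring_int.
rewrite scaled (_ : _ + _ = 0) ?mulr0 // -[RHS]Hc; congr (_ + _).
by apply: eq_bigr => i _; rewrite chi_int.
Qed.

(** [L] is generated by the images of additive generators of [S]. Their rational span is closed
    under products, hence is already all of [L]; N is a common denominator of the coordinates. *)
Lemma number_field_exists : exists (L : fieldExtType rat) (h : {rmorphism L -> algC}),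
  (forall x, S x -> exists l, h l = chi x) /\
  forall l, exists s N, [/\ S s, (0 < N)%N & h l * N%:R = chi s].
Proof.
have [k [u [Su genS]]] := zclosed_fg_mx subring_zclosed.
have [L [h [s1 hs1 gens1]]] := num_field_exists [seq chi (u i) | i <- enum 'I_k].
have sz1 : size s1 = k by rewrite -(size_map h) hs1 size_map size_enum_ord.
have hnth (i : 'I_k) : h s1`_i = chi (u i).
  by rewrite -(nth_map 0 0) ?sz1 // hs1 (nth_map i) ?size_enum_ord // nth_ord_enum.
have lift x : S x -> exists c : 'I_k -> int, h (\sum_(i < k) s1`_i *~ c i) = chi x.
  move=> /genS[c ->]; exists c; rewrite rmorph_sum chi_sum; apply: eq_bigr => i _.
  by rewrite rmorphMz hnth chiMz.
exists L, h; split=> [x /lift[c ec]|l]; first by exists (\sum_(i < k) s1`_i *~ c i).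
have spanE x : S x -> exists2 y, y \in <<s1>>%VS & h y = chi x.
  move=> /lift[c ec]; exists (\sum_(i < k) s1`_i *~ c i) => //.
  apply: memv_suml => i _; rewrite -scaler_int memvZ // memv_span // mem_nth // sz1.
  exact: ltn_ord.
have aS : is_aspace <<s1>>%VS.
  apply/andP; split.
    apply: has_algid1; have [S1 _ _] := subS; have [y ys ey] := spanE 1 S1.
    by have <- : y = 1 by apply: (fmorph_inj h); rewrite ey chi1 rmorph1.
  apply/prodvP => a b sa sb; rewrite (coord_span (X := in_tuple s1) sa).
  rewrite (coord_span (X := in_tuple s1) sb) mulr_suml; apply: memv_suml => i _.
  rewrite mulr_sumr; apply: memv_suml => j _.
  rewrite -scalerAl -scalerAr; do 2 apply: memvZ.
  have [i' ei] : exists i' : 'I_k, i = i' :> nat.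
    by exists (cast_ord sz1 i).
  have [j' ej] : exists j' : 'I_k, j = j' :> nat.
    by exists (cast_ord sz1 j).
  have [_ _ SM] := subS; have [y ys ey] := spanE (u i' * u j') (SM _ _ (Su i') (Su j')).
  rewrite /= ei ej; suff <- : y = s1`_i' * s1`_j' by [].
  by apply: (fmorph_inj h); rewrite ey rmorphM !hnth chiM.
have : l \in <<s1>>%VS.
  have : (<<1 & s1>> <= ASpace aS)%VS.
    apply/Fadjoin_seqP; split; first exact: sub1v.
    by move=> x xs; apply: memv_span.
  by rewrite gens1 => /subvP; apply; apply: memvf.
move=> /(coord_span (X := in_tuple s1)) el.
have [N N0 [c Hc]] := common_denominator (fun i => coord (in_tuple s1) i l).
exists (\sum_(i < size s1) u (cast_ord sz1 i) *~ c i), N; split=> //.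
  by apply: (zclosed_sum subring_zclosed) => i; apply: (zclosedMz subring_zclosed).
rewrite {1}el rmorph_sum chi_sum mulr_suml; apply: eq_bigr => i _.
rewrite chiMz -hnth /= -[in RHS]mulrzr -(rmorph_int h) -(rmorph_nat h) -!rmorphM /=.
congr (h _); rewrite -scalerAl mulr_natr -scaler_nat scalerA mulrC -Hc.
by rewrite scaler_int mulrzr.
Qed.

End NumberField.

Section RingTerms.
Local Open Scope ring_scope.
Variables (V C : Type).

Definition rsum (I : finType) (F : I -> rterm V C) : rterm V C :=
  foldr (fun i t => RAdd (F i) t) (RZero V C) (enum I).

Definition rpow (t : rterm V C) (n : nat) : rterm V C := iter n (RMul t) (ROne V C).

Variables (R : pzRingType) (cst : C -> R) (rho : V -> R).

Lemma reval_rsum (I : finType) (F : I -> rterm V C) :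
  reval cst rho (rsum F) = \sum_i reval cst rho (F i).
Proof.
rewrite -big_enum /rsum; elim: (enum I) => [|i s IH] /=; first by rewrite big_nil.
by rewrite big_cons IH.
Qed.

Lemma reval_rpow t n : reval cst rho (rpow t n) = reval cst rho t ^+ n.
Proof. by elim: n => [|n IH] /=; rewrite ?expr0 // exprS -IH. Qed.

End RingTerms.

(** * Algebraic integers as fractions of values of the character *)

Section Fractions.
Local Open Scope ring_scope.
Variables (G : groupType) (p : nat) (S : set 'M[int]_p) (I : finType).
Variables (D : (I -> G) -> Prop) (phi : (I -> G) -> 'M[int]_p).
Hypotheses (subS : Defs.subring S) (HI : interp D phi S).
Variable chi : 'M[int]_p -> algC.
Hypotheses (chiB : forall x y, chi (x - y) = chi x - chi y) (chi1 : chi 1 = 1).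
Hypothesis chiM : forall x y, S x -> S y -> chi (x * y) = chi x * chi y.
Hypothesis chiR : forall x, S x -> root (map_poly intr (char_poly x)) (chi x).

Local Notation C := {x : 'M[int]_p | S x}.
Local Notation cst := (fun c : C => sval c).

Lemma cst_in (c : C) : S (cst c). Proof. exact: svalP. Qed.

Lemma chi_reval V (rho : V -> 'M[int]_p) (t : rterm V C) : (forall v, S (rho v)) ->
  chi (reval cst rho t) = reval (chi \o cst) (chi \o rho) t.
Proof.
move=> Sr; have Sv := subring_reval subS cst_in _ Sr.
elim: t => //= [|t1 IH1 t2 IH2|t1 IH1 t2 IH2|t1 IH1].
- exact: chi0 chiB.
- by rewrite (chiD chiB) IH1 IH2.
- by rewrite chiM ?IH1 ?IH2 //; apply: Sv.
- by rewrite (chiN chiB) IH1.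
Qed.

(* The kernel of chi is finitely generated as an additive group, hence as an ideal. *)
Lemma sdef_chi0 (V : finType) (t : rterm V C) :
  sdef D phi (fun r : V -> 'M[int]_p => chi (reval cst r t) = 0).
Proof.
pose P := [set x | S x /\ chi x = 0]%classic.
have zP : zclosed P.
  split; first by split; [exact: subring0 subS|exact: chi0 chiB].
  move=> x y [Sx x0] [Sy y0]; split; last by rewrite chiB x0 y0 subrr.
  by case: subS => _ SB _; apply: SB.
have [k [u [Pu genP]]] := zclosed_fg_mx zP.

pose emb := fix emb (t : rterm V C) : rterm (V + 'I_k) C := match t with
  | RVar v => RVar _ (inl v) | RCst c => RCst _ c | RZero => RZero _ _ | ROne => ROne _ _
  | RAdd t1 t2 => RAdd (emb t1) (emb t2) | RMul t1 t2 => RMul (emb t1) (emb t2)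
  | ROpp t1 => ROpp (emb t1) end.
have embE (r : V -> 'M[int]_p) y s : reval cst (join_val r y) (emb s) = reval cst r s.
  by elim: s => //= [s1 -> s2 ->|s1 -> s2 ->|s1 ->].
pose uc i : C := exist _ (u i) (proj1 (Pu i)).
have := sdef_req HI subS cst_in (emb t)
  (rsum (fun i => RMul (RCst _ (uc i)) (RVar _ (inr i)))).
move=> /(sdef_ex HI); apply: (sdef_ext HI) => r Sr; split=> [[y [Sy]]|t0].
  rewrite embE reval_rsum => ->; rewrite (chi_sum chiB) big1 // => i _ /=.
  by have [Su u0] := Pu i; rewrite chiM // u0 mul0r.
have Pt : P (reval cst r t) by split=> //; apply: (subring_reval subS cst_in).
have [c ec] := genP _ Pt; exists (fun i => 1 *~ c i); split.
  by move=> i; apply: subring_int.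
rewrite embE reval_rsum ec; apply: eq_bigr => i _ /=.
by rewrite mulrzr.
Qed.

Lemma sdef_chi_eq (V : finType) (t1 t2 : rterm V C) :
  sdef D phi (fun r : V -> 'M[int]_p => chi (reval cst r t1) = chi (reval cst r t2)).
Proof.
apply: (sdef_ext HI) (sdef_chi0 (RAdd t1 (ROpp t2))) => r Sr /=.
by rewrite chiB; split=> [/eqP|->]; rewrite ?subrr // subr_eq0 => /eqP.
Qed.

Lemma sdef_chi_neq0 (V : finType) (x : V) :
  sdef D phi (fun r : V -> 'M[int]_p => chi (r x) != 0).
Proof.
pose y (j : 'I_3) : rterm (V + 'I_3) C := RVar _ (inr j).
pose m1 : rterm (V + 'I_3) C := ROpp (ROne _ _).
have /(sdef_ex HI) := sdef_chi_eq (RMul (RVar _ (inl x)) (y 0))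
  (RMul (RAdd (RAdd (y 1) (y 1)) m1)
        (RAdd (RAdd (RAdd (y 2%:R) (y 2%:R)) (y 2%:R)) m1)).
apply: (sdef_ext HI) => r Sr; rewrite -(chi_neq0 subS chiB chi1 chiM chiR (Sr x)).
split=> [[a [Sa]]|[z [v [w [Sz Sv Sw e]]]]].
  rewrite !chi_reval; try by [case=> [v|j] /=; [apply: Sr|apply: Sa]].
  by move=> /= e; exists (a 0), (a 1), (a 2%:R); split.
pose a (j : 'I_3) := if j == 0 then z else if j == 1 then v else w.
exists a; split; first by move=> j; rewrite /a; do 2 case: eqP => // _.
rewrite !chi_reval; try by case=> [v'|j] /=; [apply: Sr|rewrite /a; do 2 case: eqP => // _].
exact: e.
Qed.

Lemma sdef_integral (V : finType) (x y : V) :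
  sdef D phi (fun r : V -> 'M[int]_p => exists c : 'I_p -> 'M[int]_p,
    (forall i, S (c i)) /\ chi (r x) ^+ p +
       \sum_(i < p) chi (c i) * chi (r x) ^+ i * chi (r y) ^+ (p - i) = 0).
Proof.
pose X : rterm (V + 'I_p) C := RVar _ (inl x).
pose Y : rterm (V + 'I_p) C := RVar _ (inl y).
have /(sdef_ex HI) := sdef_chi0 (RAdd (rpow X p)
  (rsum (fun i : 'I_p => RMul (RMul (RVar _ (inr i)) (rpow X i)) (rpow Y (p - i))))).
apply: (sdef_ext HI) => r Sr.
have E a : (forall i, S (a i)) -> chi (reval cst (join_val r a) (RAdd (rpow X p)
  (rsum (fun i : 'I_p => RMul (RMul (RVar _ (inr i)) (rpow X i)) (rpow Y (p - i)))))) =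
    chi (r x) ^+ p + \sum_(i < p) chi (a i) * chi (r x) ^+ i * chi (r y) ^+ (p - i).
  move=> Sa; rewrite chi_reval /=; last by case=> [v|j] /=; [apply: Sr|apply: Sa].
  rewrite reval_rpow reval_rsum; congr (_ + _); apply: eq_bigr => i _ /=.
  by rewrite !reval_rpow.
by split=> -[a [Sa e]]; exists a; split=> //; move: e; rewrite E.
Qed.

Variables (L : fieldExtType rat) (h : {rmorphism L -> algC}).
Hypothesis hS : forall x, S x -> exists l, h l = chi x.
Hypothesis hL : forall l, exists s N, [/\ S s, (0 < N)%N & h l * N%:R = chi s].

Definition is_fraction (s t : 'M[int]_p) : Prop := chi t != 0 /\ chi s / chi t \in Aint.

(** Total, with value zero where the quotient is not the image of an algebraic integer of [L]. *)
Definition fraction (s t : 'M[int]_p) : algint L :=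
  if pselect (exists a : algint L, h (algint_val a) = chi s / chi t) is left e
  then projT1 (cid e) else 0.

Lemma fractionE s t : S s -> S t -> is_fraction s t ->
  h (algint_val (fraction s t)) = chi s / chi t.
Proof.
move=> Ss St [t0 Ast]; rewrite /fraction; case: pselect => [e|[]]; first by case: cid.
have [[ls els] [lt elt]] := (hS Ss, hS St).
have il : ls / lt \in @integral_pred L.
  apply/integral_predP/(integral_over_fmorph h).
  by rewrite rmorphM fmorphV els elt.
by exists (AlgInt il); rewrite /= rmorphM fmorphV /= els elt.
Qed.

Lemma algint_inj (a b : algint L) : h (algint_val a) = h (algint_val b) -> a = b.
Proof. by move=> e; apply/val_inj/(fmorph_inj h). Qed.

(** Every element of [L] has a positive multiple in the image of [chi], so the monic equation of
    degree [p] characterises integrality of the quotient. *)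
Lemma sdef_is_fraction (V : finType) (x y : V) :
  sdef D phi (fun r : V -> 'M[int]_p => is_fraction (r x) (r y)).
Proof.
apply: (sdef_ext HI) (sdef_and (sdef_chi_neq0 y) (sdef_integral x y)) => r Sr.
have H : chi (r y) != 0 -> exists s N, [/\ S s, (0 < N)%N & chi (r x) / chi (r y) * N%:R = chi s].
  move=> _; have [[ls els] [lt elt]] := (hS (Sr x), hS (Sr y)).
  have [s [N [Ss N0 e]]] := hL (ls / lt); exists s, N; split=> //.
  by rewrite -e rmorphM fmorphV els elt.
have R y0 := chi_ratio subS chiB chi1 chiR (Sr x) (Sr y) y0 (H y0).
by split=> -[y0 c]; split=> //; have [R1 R2] := R y0; [apply: R1|apply: R2].
Qed.

(** [Q] is to be the relation [Q'] after clearing denominators. *)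
Lemma sdef_fractions (V : finType) (Q : (V * bool -> 'M[int]_p) -> Prop)
    (Q' : (V -> algint L) -> Prop) :
  sdef D phi Q ->
  (forall r, (forall v, S (r v)) -> (forall v, is_fraction (r (v, false)) (r (v, true))) ->
     Q r <-> Q' (fun v => fraction (r (v, false)) (r (v, true)))) ->
  sdef D phi (fun r : V * bool -> 'M[int]_p =>
    (forall v, is_fraction (r (v, false)) (r (v, true))) /\
    Q' (fun v => fraction (r (v, false)) (r (v, true)))).
Proof.
move=> dQ QQ'.
have df : sdef D phi (fun r : V * bool -> 'M[int]_p =>
    forall v, is_fraction (r (v, false)) (r (v, true))).
  have := gdef_and (gdef_dom HI _) (gdef_all (fun v : V =>
    sdef_is_fraction (v, false) (v, true))).
  by apply: gdef_ext => g; split=> [[Dg H]|[Dg H]]; split=> // v; case: (H v).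
apply: (sdef_ext HI) (sdef_and df dQ) => r Sr.
by split=> -[fr q]; split=> //; apply/QQ'.
Qed.

Lemma eqr_divP (F : fieldType) (a b c d : F) : b != 0 -> d != 0 ->
  a * d = c * b <-> a / b = c / d.
Proof.
by move=> b0 d0; split=> /eqP; [rewrite -eqr_div|rewrite eqr_div] => // /eqP.
Qed.

Lemma fraction_interp : interp (pair_dom D phi is_fraction) (pair_val phi fraction)
  [set: algint L].
Proof.
have fr0 (V : finType) (r : V * bool -> 'M[int]_p) v :
    (forall v, is_fraction (r (v, false)) (r (v, true))) -> chi (r (v, true)) != 0.
  by move=> H; case: (H v).
pose X V (v : V) : rterm (V * bool) C := RVar _ (v, false).
pose Y V (v : V) : rterm (V * bool) C := RVar _ (v, true).
apply: (pair_interp HI).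
(* Surjectivity already holds with positive integers as denominators. *)
- move=> a; have [s [N [Ss N0 e]]] := hL (algint_val a).
  have SN : S (1 *~ N) := subring_int subS N.
  have N0' : N%:R != 0 :> algC by rewrite pnatr_eq0 -lt0n.
  have eN : chi (1 *~ N) = N%:R by rewrite (chi_int chiB chi1).
  have ea : chi s / chi (1 *~ N) = h (algint_val a) by rewrite eN -e mulfK.
  have fr : is_fraction s (1 *~ N).
    split; first by rewrite eN.
    by rewrite ea; apply/(integral_over_fmorph h)/integral_predP/algint_valP.
  exists (s, 1 *~ N) => //=; split=> //.
  by apply: algint_inj; rewrite fractionE.
- exact: sdef_is_fraction.
- apply: (sdef_fractions (V := 'I_2) (Q' := fun q => q 0 = q 1)).
    exact: (sdef_chi_eq (RMul (X _ 0) (Y _ 1)) (RMul (X _ 1) (Y _ 0))).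
  move=> r Sr fr; have n0 v := fr0 _ r v fr; rewrite /= !chiM //.
  apply: (iff_trans (eqr_divP _ _ (n0 0) (n0 1))); rewrite -!fractionE //.
  by split=> [/algint_inj|->].
- apply: (sdef_fractions (V := 'I_3) (Q' := fun q => q 0 + q 1 = q 2%:R)).
    exact: (sdef_chi_eq (RMul (RAdd (RMul (X _ 0) (Y _ 1)) (RMul (X _ 1) (Y _ 0))) (Y _ 2%:R))
      (RMul (X _ 2%:R) (RMul (Y _ 0) (Y _ 1)))).
  move=> r Sr fr; have n0 v := fr0 _ r v fr; rewrite !chi_reval //=.
  apply: (iff_trans (eqr_divP _ _ (mulf_neq0 (n0 0) (n0 1)) (n0 2%:R))).
  rewrite -addf_div // -!fractionE // -rmorphD.
  by split=> [e|<-//]; apply: algint_inj.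
- apply: (sdef_fractions (V := 'I_3) (Q' := fun q => q 0 * q 1 = q 2%:R)).
    exact: (sdef_chi_eq (RMul (RMul (X _ 0) (X _ 1)) (Y _ 2%:R))
      (RMul (X _ 2%:R) (RMul (Y _ 0) (Y _ 1)))).
  move=> r Sr fr; have n0 v := fr0 _ r v fr; rewrite !chi_reval //=.
  apply: (iff_trans (eqr_divP _ _ (mulf_neq0 (n0 0) (n0 1)) (n0 2%:R))).
  rewrite -mulf_div -!fractionE // -rmorphM.
  by split=> [e|<-//]; apply: algint_inj.
Qed.

End Fractions.

Theorem theorem4p16 (G : groupType) (hG : Nmax G)
    (hH : exists H : set G,
        [/\ subgroup H, nilpotent H & ~ virtually_abelian H]) :
  exists L : fieldExtType rat,
    e_interpretable (algint L) G /\
    forall (r s : nat) (o : 'I_r -> algint L) (g : 'I_s -> G),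
      generates_ring o -> generates_group g -> diophantine_reducible o g.
Proof.
have [W [U [r [f Pf]]]] := nilpotent_pairing hG hH.
have [p [S [I [D [phi [p_gt0 subS commS HI]]]]]] := scalar_ring_interp Pf.
have [chi [chiB chi1 chiM chiR]] := character_exists p_gt0 subS commS.
have [L [h [hS hL]]] := number_field_exists subS chiB chi1 chiM.
have eL : e_interpretable (algint L) G.
  exact: interp_e_interpretable (fraction_interp subS HI chiB chi1 chiM chiR hS hL).
exists L; split=> // m n o g _ gen.
exact: e_interpretable_reducible.
Qed.
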